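(* Let $K$ be a convex body in $\mathbb{R}^d$, and let $\mathcal F=\{\lambda_1 K,\lambda_2 K,\dots\}$ with $\lambda_i>0$ for all $i$ be a (countably infinite) family of homothets of $K$ satisfying \[\sum_{i=1}^{\infty}\lambda_i^d=\infty.\] Let $\Lambda:=\{\lambda_1,\lambda_2,\ldots\}$. (a) If $\Lambda$ is bounded and has a limit point other than zero, then $\mathcal F$ permits a translative covering of $\mathbb{R}^d$ of density $\vartheta(K)$. (b) If $\Lambda$ is bounded and has no limit point other than zero, then $\mathcal F$ permits a translative covering of $\mathbb{R}^d$ of density one. (c) If $\Lambda$ is unbounded, then $\mathcal F$ permits a translative covering of $\mathbb{R}^d$ with maximum multiplicity $4d$, that is, one in which no point of $\mathbb{R}^d$ is covered by more than $4d$ of the translated sets.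
   Context: A convex body is a compact convex subset of $\mathbb{R}^d$ with nonempty interior. For a family $\mathcal F$ of sets in $\mathbb{R}^d$ and $A\subseteq\mathbb{R}^d$, we say $\mathcal F$ permits a translative covering of $A$ (with density $\vartheta$) if one can select a translation vector $x_F\in\mathbb{R}^d$ for each member $F$ of $\mathcal F$ such that $A\subseteq\bigcup_{F\in\mathcal F}(x_F+F)$ (and the density of this covering is $\vartheta$). The density of a covering of $\mathbb{R}^d$ by sets $\{C_i\}$ is $\limsup_{r\to\infty}\frac{\sum_{i:\,C_i\subseteq rB}\operatorname{vol}(C_i)}{\operatorname{vol}(rB)}$, where $B$ is the Euclidean unit ball. $\vartheta(K)$, the translative covering density of $K$, is the minimum (infimum) density of a covering of $\mathbb{R}^d$ by translates of $K$. *)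

(* Defs.v *)
From Stdlib Require Import Reals Lra Lia.
From Stdlib Require Fin.
Open Scope R_scope.

Definition pt (d : nat) := Fin.t d -> R.
Definition rset (d : nat) := pt d -> Prop.

Fixpoint fsum (n : nat) : (Fin.t n -> R) -> R :=
  match n with
  | O => fun _ => 0
  | S m => fun f => f Fin.F1 + fsum m (fun i => f (Fin.FS i))
  end.
Fixpoint fprod (n : nat) : (Fin.t n -> R) -> R :=
  match n with
  | O => fun _ => 1
  | S m => fun f => f Fin.F1 * fprod m (fun i => f (Fin.FS i))
  end.

Definition enorm {d} (x : pt d) : R := sqrt (fsum d (fun j => x j ^ 2)).
Definition edist {d} (x y : pt d) : R := enorm (fun j => x j - y j).

Definition subset {d} (A B : rset d) : Prop := forall x, A x -> B x.

Definition rball {d} (r : R) : rset d := fun x => enorm x <= r.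

Definition convex {d} (K : rset d) : Prop :=
  forall x y t, K x -> K y -> 0 <= t <= 1 ->
    K (fun j => (1 - t) * x j + t * y j).
Definition is_open {d} (U : rset d) : Prop :=
  forall x, U x -> exists e, 0 < e /\ forall y, edist y x < e -> U y.
Definition is_closed {d} (A : rset d) : Prop := is_open (fun x => ~ A x).
Definition bounded {d} (A : rset d) : Prop :=
  exists M, forall x, A x -> enorm x <= M.
Definition nonempty_interior {d} (A : rset d) : Prop :=
  exists x e, 0 < e /\ forall y, edist y x < e -> A y.
Definition convex_body {d} (K : rset d) : Prop :=
  convex K /\ is_closed K /\ bounded K /\ nonempty_interior K.

Definition hom {d} (x : pt d) (lam : R) (K : rset d) : rset d :=
  fun p => exists y, K y /\ forall j, p j = x j + lam * y j.

Definition is_inf (E : R -> Prop) (m : R) : Prop :=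
  (forall x, E x -> m <= x) /\ (forall y, (forall x, E x -> y <= x) -> y <= m).

(** Lebesgue (outer) measure: infimum of total volumes of countable covers
    by closed axis-parallel boxes.  [is_vol A v] means vol(A) = v (finite). *)
Definition in_box {d} (a b : pt d) (x : pt d) : Prop :=
  forall j, a j <= x j <= b j.
Definition box_vol {d} (a b : pt d) : R := fprod d (fun j => b j - a j).
Definition is_vol {d} (A : rset d) (v : R) : Prop :=
  is_inf (fun s => exists a b : nat -> pt d,
             (forall k j, a k j <= b k j) /\
             (forall x, A x -> exists k, in_box (a k) (b k) x) /\
             infinite_sum (fun k => box_vol (a k) (b k)) s) v.

Definition limsup_infty (g : R -> R) (v : R) : Prop :=
  (forall eps, 0 < eps -> exists R0, forall r, R0 <= r -> g r <= v + eps) /\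
  (forall eps, 0 < eps -> forall R0, exists r, R0 <= r /\ v - eps <= g r).

Definition covers {d} (C : nat -> rset d) : Prop :=
  forall p : pt d, exists i, C i p.

Definition density_is {d} (C : nat -> rset d) (v : R) : Prop :=
  exists g : R -> R,
    (forall r, 0 < r ->
       exists (t : nat -> R) (S V : R),
         (forall i, (subset (C i) (rball r) -> is_vol (C i) (t i)) /\
                    (~ subset (C i) (rball r) -> t i = 0)) /\
         infinite_sum t S /\ is_vol (@rball d r) V /\ g r = S / V) /\
    limsup_infty g v.

Definition is_transl_cov_density {d} (K : rset d) (th : R) : Prop :=
  is_inf (fun v => exists x : nat -> pt d,
             covers (fun i => hom (x i) 1 K) /\ density_is (fun i => hom (x i) 1 K) v) th.

Definition cluster_point (lam : nat -> R) (L : R) : Prop :=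
  forall eps, 0 < eps -> forall N, exists i, (N <= i)%nat /\ Rabs (lam i - L) < eps.

Definition multiplicity_le {d} (C : nat -> rset d) (m : nat) : Prop :=
  forall (p : pt d) (l : list nat), List.NoDup l ->
    (forall i, List.In i l -> C i p) -> (length l <= m)%nat.

(* Main.v *)
(** The density of a covering is an upper density, so bodies that are not needed can be placed
    along a ray in such a way that they contribute any prescribed density c >= 0. It is therefore
    enough to cover space by part of the family with upper density at most the target, leaving
    out bodies of infinite total volume. For this, tile space by cubes whose side 2^n grows
    slowly with the distance to the origin, and cover the tiles one after the other by finite
    batches of bodies of total volume (target + e_n) (2^n)^d, with e_n -> 0.

    (a) A covering by translates of K of density close to theta(K) yields, by pigeonhole, economic
    coverings of all large cubes by translates of K, and the bodies with lambda_i near the limit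
    point L, which are slightly rescaled copies of L K, can replace these translates.
    (b) When lambda_i -> 0, fill a cube with disjoint containers, each holding one body; the bodies
    take up a fixed proportion of the volume, and the rest is, up to a small relative error, a
    union of small cubes. After a few rounds the remainder is so small that it may be covered
    wastefully.
    (c) Boundary points of K touched from inside by a ball have normals positively spanning space,
    and by Steinitz' theorem 2d of them, n_1, ..., n_2d, already do. A very large homothet touching
    at such a point looks like a half-space, and 2d of these half-spaces cover the complement of
    a bounded polytope, no point lying in all of them. Repeating this at rapidly growing scales,
    each point meets at most two consecutive stages; a stage also receives one of the other
    bodies, which still leaves multiplicity at most 2d per stage. *)
Require Import Defs.
From Stdlib Require Import Reals.
From Stdlib Require Import Compare_dec Lra Lia List Classical ClassicalEpsilon FunctionalExtensionality PropExtensionality.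
From Stdlib Require Fin.
Open Scope R_scope.

(** * Finite sums and choice *)

(** Two features of the definitions shape the proof. [density_is] fixes the limsup exactly, while an
    economical covering only has some upper density b at most the target. The padding must supply
    the difference, and with a genuine limit, because limsups are not additive. Secondly, volume is
    an outer measure given by box covers, and additivity is never established for it. Volumes are
    only compared with finite families of cubes: from above by covering with cubes, from below by
    packing half-open cubes, the latter justified by counting points of a fine lattice.

    Tiles of side 2^n begin at distance 4^n, so the side is about the square root of the distance.
    Hence tiles meeting the ball of radius r stay within radius r + d sqrt r, which changes the
    volume by a factor tending to 1; yet the sides grow, so that the relative excess e_n of the
    batches can tend to 0. Every finite construction is stated for an arbitrary starting index N,
    the bodies before N being regarded as spent; this is how no index is used twice. *)

Definition lsum {A : Type} (f : A -> R) (l : list A) : R :=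
  fold_right (fun a s => f a + s) 0 l.

Lemma choice {A B : Type} (R : A -> B -> Prop) :
  (forall a, exists b, R a b) -> exists f, forall a, R a (f a).
Proof.
  intros H. exists (fun a => proj1_sig (constructive_indefinite_description _ (H a))).
  intros a; destruct constructive_indefinite_description; auto.
Qed.

Lemma choice2 {A B C : Type} (R : A -> B -> C -> Prop) :
  (forall a b, exists c, R a b c) -> exists f, forall a b, R a b (f a b).
Proof. intros H. apply (choice (fun a f => forall b, R a b (f b))). intros a. apply choice; auto. Qed.

Definition chi (P : Prop) : R := if excluded_middle_informative P then 1 else 0.

Lemma chi_true (P : Prop) : P -> chi P = 1.
Proof. intros H; unfold chi; destruct (excluded_middle_informative P); tauto. Qed.

Lemma chi_false (P : Prop) : ~ P -> chi P = 0.
Proof. intros H; unfold chi; destruct (excluded_middle_informative P); tauto. Qed.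

Lemma chi_bounds (P : Prop) : 0 <= chi P <= 1.
Proof. unfold chi; destruct (excluded_middle_informative P); lra. Qed.

Lemma chi_le (P Q : Prop) : (P -> Q) -> chi P <= chi Q.
Proof.
  intros H; destruct (classic P) as [p|p].
  - rewrite (chi_true P), (chi_true Q); auto; lra.
  - rewrite (chi_false P) by auto; apply chi_bounds.
Qed.

Lemma chi_iff (P Q : Prop) : (P <-> Q) -> chi P = chi Q.
Proof. intros H. f_equal. apply propositional_extensionality; auto. Qed.

Lemma lsum_app {A} (f : A -> R) l1 l2 : lsum f (l1 ++ l2) = lsum f l1 + lsum f l2.
Proof. induction l1; simpl; lra. Qed.

Lemma lsum_le {A} (f g : A -> R) l :
  (forall a, In a l -> f a <= g a) -> lsum f l <= lsum g l.
Proof.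
  induction l as [|a l IH]; simpl; intros H; [lra|].
  assert (f a <= g a) by auto. assert (lsum f l <= lsum g l) by auto. lra.
Qed.

Lemma lsum_ext {A} (f g : A -> R) l :
  (forall a, In a l -> f a = g a) -> lsum f l = lsum g l.
Proof.
  induction l as [|a l IH]; simpl; intros H; [lra|].
  rewrite H, IH by auto; auto.
Qed.

Lemma lsum_nonneg {A} (f : A -> R) l :
  (forall a, In a l -> 0 <= f a) -> 0 <= lsum f l.
Proof.
  induction l as [|a l IH]; simpl; intros H; [lra|].
  assert (0 <= f a) by auto. assert (0 <= lsum f l) by auto. lra.
Qed.

Lemma lsum_scal {A} (c : R) (f : A -> R) l : lsum (fun a => c * f a) l = c * lsum f l.
Proof. induction l; simpl; lra. Qed.

Lemma lsum_plus {A} (f g : A -> R) l :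
  lsum (fun a => f a + g a) l = lsum f l + lsum g l.
Proof. induction l; simpl; lra. Qed.

Lemma lsum_const {A} (c : R) (l : list A) : lsum (fun _ => c) l = INR (length l) * c.
Proof.
  induction l as [|a l IH]; [simpl; lra|].
  change (c + lsum (fun _ => c) l = INR (S (length l)) * c). rewrite S_INR, IH; lra.
Qed.

Lemma lsum_map {A B} (f : B -> R) (g : A -> B) l :
  lsum f (map g l) = lsum (fun a => f (g a)) l.
Proof. induction l; simpl; congruence. Qed.

Lemma lsum_flat_map {A B} (f : B -> R) (g : A -> list B) l :
  lsum f (flat_map g l) = lsum (fun a => lsum f (g a)) l.
Proof. induction l; simpl; auto. rewrite lsum_app; congruence. Qed.

Lemma lsum_swap {A B} (f : A -> B -> R) l l' :
  lsum (fun a => lsum (fun b => f a b) l') l = lsum (fun b => lsum (fun a => f a b) l) l'.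
Proof.
  induction l as [|a l IH]; simpl.
  - induction l'; simpl; lra.
  - rewrite IH, <- lsum_plus; auto.
Qed.

Lemma lsum_in_le {A} (f : A -> R) l a :
  (forall a, In a l -> 0 <= f a) -> In a l -> f a <= lsum f l.
Proof.
  induction l as [|b l IH]; simpl; intros H Ha; [tauto|].
  destruct Ha as [->|Ha].
  - assert (0 <= lsum f l) by (apply lsum_nonneg; auto). lra.
  - assert (f a <= lsum f l) by auto. assert (0 <= f b) by auto. lra.
Qed.

Lemma lsum_incl {A} (f : A -> R) l l' :
  (forall a, In a l' -> 0 <= f a) -> NoDup l -> incl l l' -> lsum f l <= lsum f l'.
Proof.
  revert l'; induction l as [|a l IH]; intros l' H Hn Hi; [apply lsum_nonneg; auto|].
  inversion_clear Hn as [|? ? Ha Hl].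
  destruct (in_split a l') as (l1 & l2 & ->); [apply Hi; simpl; auto|].
  assert (K : lsum f l <= lsum f (l1 ++ l2)).
  { apply IH; auto.
    - intros b Hb; apply H; rewrite in_app_iff in *; simpl; tauto.
    - intros b Hb. assert (Hb' := Hi b (or_intror Hb)).
      rewrite in_app_iff in *; simpl in Hb'.
      destruct Hb' as [?|[<-|?]]; tauto. }
  rewrite lsum_app in *; simpl; lra.
Qed.

Lemma lsum_chi_unique {A} (P : A -> Prop) l :
  NoDup l -> (forall x y, In x l -> In y l -> P x -> P y -> x = y) ->
  lsum (fun a => chi (P a)) l <= 1.
Proof.
  induction l as [|a l IH]; simpl; intros Hn Hu; [lra|].
  inversion_clear Hn.
  destruct (classic (P a)) as [Pa|Pa].
  - assert (E : lsum (fun a => chi (P a)) l = lsum (fun _ => 0) l).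
    { apply lsum_ext; intros b Hb; apply chi_false; intros Pb.
      assert (a = b) by auto. congruence. }
    rewrite E, lsum_const, chi_true by auto; lra.
  - rewrite chi_false by auto. assert (lsum (fun a => chi (P a)) l <= 1) by auto. lra.
Qed.

Definition cfilter {A} (P : A -> Prop) (l : list A) : list A :=
  filter (fun a => if excluded_middle_informative (P a) then true else false) l.

Lemma in_cfilter {A} (P : A -> Prop) l a : In a (cfilter P l) <-> In a l /\ P a.
Proof.
  unfold cfilter; rewrite filter_In.
  destruct (excluded_middle_informative (P a)); intuition congruence.
Qed.

Lemma NoDup_cfilter {A} (P : A -> Prop) l : NoDup l -> NoDup (cfilter P l).
Proof. apply NoDup_filter. Qed.

Lemma lsum_cfilter {A} (P : A -> Prop) (f : A -> R) l :
  lsum f (cfilter P l) = lsum (fun a => chi (P a) * f a) l.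
Proof.
  induction l as [|a l IH]; simpl; auto. unfold chi at 1.
  destruct (excluded_middle_informative (P a)); simpl; rewrite <- IH; lra.
Qed.

(** * Euclidean space *)

Lemma Fin_case {n} (P : Fin.t (S n) -> Prop) :
  P Fin.F1 -> (forall i, P (Fin.FS i)) -> forall i, P i.
Proof. intros H1 HS i; apply (Fin.caseS' i); auto. Qed.

Lemma fsum_ext n (f g : Fin.t n -> R) : (forall i, f i = g i) -> fsum n f = fsum n g.
Proof. induction n; simpl; intros H; auto. rewrite H, (IHn _ (fun i => g (Fin.FS i))); auto. Qed.

Lemma fsum_plus n (f g : Fin.t n -> R) : fsum n (fun i => f i + g i) = fsum n f + fsum n g.
Proof. induction n; simpl; [lra|]. rewrite IHn; lra. Qed.

Lemma fsum_scal n c (f : Fin.t n -> R) : fsum n (fun i => c * f i) = c * fsum n f.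
Proof. induction n; simpl; [lra|]. rewrite IHn; lra. Qed.

Lemma fsum_le n (f g : Fin.t n -> R) : (forall i, f i <= g i) -> fsum n f <= fsum n g.
Proof.
  induction n; simpl; intros H; [lra|].
  assert (f Fin.F1 <= g Fin.F1) by auto.
  assert (fsum n (fun i => f (Fin.FS i)) <= fsum n (fun i => g (Fin.FS i))) by auto. lra.
Qed.

Lemma fsum_const n c : fsum n (fun _ => c) = INR n * c.
Proof. induction n; [simpl; lra|]. change (c + fsum n (fun _ => c) = INR (S n) * c). rewrite IHn, S_INR; lra. Qed.

Lemma fsum_nonneg n (f : Fin.t n -> R) : (forall i, 0 <= f i) -> 0 <= fsum n f.
Proof. intros H. rewrite <- (Rmult_0_r (INR n)), <- fsum_const. apply fsum_le; auto. Qed.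

Lemma fsum_term_le n (f : Fin.t n -> R) i : (forall i, 0 <= f i) -> f i <= fsum n f.
Proof.
  intros H. induction n; [inversion i|]. revert i. apply Fin_case; simpl.
  - assert (0 <= fsum n (fun i => f (Fin.FS i))) by (apply fsum_nonneg; auto). lra.
  - intros i. assert (f (Fin.FS i) <= fsum n (fun i => f (Fin.FS i))) by (apply (IHn (fun i => f (Fin.FS i))); auto).
    assert (0 <= f Fin.F1) by auto. lra.
Qed.

Definition dot {d} (x y : pt d) : R := fsum d (fun j => x j * y j).

Lemma dot_comm {d} (x y : pt d) : dot x y = dot y x.
Proof. apply fsum_ext; intros; ring. Qed.

Lemma dot_lin {d} (u x y : pt d) a b :
  dot u (fun j => a * x j + b * y j) = a * dot u x + b * dot u y.
Proof.
  unfold dot. rewrite <- !fsum_scal, <- fsum_plus. apply fsum_ext; intros; ring.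
Qed.

Lemma enorm_dot {d} (x : pt d) : enorm x = sqrt (dot x x).
Proof. unfold enorm, dot. f_equal. apply fsum_ext; intros; ring. Qed.

Lemma dot_self_nonneg {d} (x : pt d) : 0 <= dot x x.
Proof. apply fsum_nonneg; intros; nra. Qed.

Lemma enorm_nonneg {d} (x : pt d) : 0 <= enorm x.
Proof. apply sqrt_pos. Qed.

Lemma enorm_sq {d} (x : pt d) : enorm x * enorm x = dot x x.
Proof. rewrite enorm_dot. apply sqrt_sqrt, dot_self_nonneg. Qed.

Lemma enorm_le_sq {d} (x : pt d) r : 0 <= r -> dot x x <= r * r -> enorm x <= r.
Proof.
  intros Hr H. rewrite <- enorm_sq in H. assert (H0 := enorm_nonneg x).
  destruct (Rle_dec (enorm x) r); auto. nra.
Qed.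

Lemma enorm_lt_sq {d} (x : pt d) r : 0 < r -> dot x x < r * r -> enorm x < r.
Proof.
  intros Hr H. rewrite <- enorm_sq in H. assert (H0 := enorm_nonneg x).
  destruct (Rlt_dec (enorm x) r); auto. nra.
Qed.

Lemma dot_comb_self {d} (x y : pt d) a b :
  dot (fun j => a * x j + b * y j) (fun j => a * x j + b * y j)
  = a * a * dot x x + 2 * a * b * dot x y + b * b * dot y y.
Proof.
  unfold dot. rewrite <- !fsum_scal, <- !fsum_plus. apply fsum_ext; intros; ring.
Qed.

Lemma dot_cs {d} (x y : pt d) : dot x y <= enorm x * enorm y.
Proof.
  assert (Hx := enorm_nonneg x). assert (Hy := enorm_nonneg y).
  assert (H : forall a b, 0 <= a * a * dot x x + 2 * a * b * dot x y + b * b * dot y y)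
    by (intros; rewrite <- dot_comb_self; apply dot_self_nonneg).
  rewrite <- !enorm_sq in H.
  set (a := enorm x) in *. set (b := enorm y) in *. set (t := dot x y) in *.
  destruct (Req_dec a 0) as [Ea|Ea]; [|destruct (Req_dec b 0) as [Eb|Eb]].
  (* With a = 0 these coefficients turn the form into -(b^2 + 2) t^2, which forces t = 0; the next
     case is symmetric. *)
  - specialize (H (- (b * b + 1)) t). rewrite Ea in *.
    assert (0 <= t * t * (b * b)) by (apply Rmult_le_pos; nra). nra.
  - specialize (H t (- (a * a + 1))). rewrite Eb in *.
    assert (0 <= t * t * (a * a)) by (apply Rmult_le_pos; nra). nra.
  - specialize (H b (- a)). assert (0 < a * b) by (apply Rmult_lt_0_compat; lra).
    assert (0 <= (a * b) * (a * b - t)) by lra.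
    destruct (Rle_dec t (a * b)); auto. nra.
Qed.

Lemma enorm_triang {d} (x y : pt d) : enorm (fun j => x j + y j) <= enorm x + enorm y.
Proof.
  assert (Hx := enorm_nonneg x). assert (Hy := enorm_nonneg y).
  apply enorm_le_sq; [lra|].
  assert (E : (fun j => x j + y j) = (fun j => 1 * x j + 1 * y j))
    by (apply functional_extensionality; intros; ring).
  rewrite E, dot_comb_self.
  assert (H := dot_cs x y). rewrite <- !enorm_sq. nra.
Qed.

Lemma enorm_ext {d} (x y : pt d) : (forall j, x j = y j) -> enorm x = enorm y.
Proof. intros H. f_equal. apply functional_extensionality; auto. Qed.

Lemma enorm_scal {d} (x : pt d) c : enorm (fun j => c * x j) = Rabs c * enorm x.
Proof.
  rewrite !enorm_dot, <- sqrt_Rsqr_abs, <- sqrt_mult.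
  - f_equal. unfold Rsqr, dot. rewrite <- fsum_scal. apply fsum_ext; intros; ring.
  - apply Rle_0_sqr.
  - apply dot_self_nonneg.
Qed.

Lemma enorm_zero {d} : @enorm d (fun _ => 0) = 0.
Proof.
  rewrite enorm_dot. replace (dot (fun _ : Fin.t d => 0) (fun _ => 0)) with 0; [apply sqrt_0|].
  unfold dot. rewrite (fsum_ext _ _ (fun _ => 0)) by (intros; ring). rewrite fsum_const; ring.
Qed.

Lemma coord_le_enorm {d} (x : pt d) j : Rabs (x j) <= enorm x.
Proof.
  assert (H := enorm_nonneg x).
  assert (x j * x j <= enorm x * enorm x).
  { rewrite enorm_sq. unfold dot. apply (fsum_term_le d (fun j => x j * x j)); intros; nra. }
  unfold Rabs; destruct (Rcase_abs (x j)); nra.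
Qed.

Lemma enorm_le_coord {d} (x : pt d) m :
  0 <= m -> (forall j, Rabs (x j) <= m) -> enorm x <= INR d * m.
Proof.
  intros Hm H. assert (Hd := pos_INR d). apply enorm_le_sq; [nra|].
  apply Rle_trans with (INR d * (m * m)).
  - rewrite <- fsum_const. apply fsum_le; intros j. specialize (H j).
    unfold Rabs in H; destruct (Rcase_abs (x j)); nra.
  - destruct d; [simpl; nra|]. rewrite S_INR in *. assert (H' := pos_INR d).
    assert (0 <= m * m) by nra. nra.
Qed.

Lemma enorm_eq0 {d} (x : pt d) : enorm x = 0 -> forall j, x j = 0.
Proof.
  intros H j. assert (K := coord_le_enorm x j). rewrite H in K.
  unfold Rabs in K; destruct (Rcase_abs (x j)); lra.
Qed.

Lemma edist_comm {d} (x y : pt d) : edist x y = edist y x.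
Proof.
  unfold edist. rewrite (enorm_ext _ (fun j => (-1) * (y j - x j))) by (intros; ring).
  rewrite enorm_scal, Rabs_left by lra; ring.
Qed.

Lemma edist_triang {d} (x y z : pt d) : edist x z <= edist x y + edist y z.
Proof.
  unfold edist. rewrite (enorm_ext _ (fun j => (x j - y j) + (y j - z j))) by (intros; ring).
  apply enorm_triang.
Qed.

Lemma edist_refl {d} (x : pt d) : edist x x = 0.
Proof.
  unfold edist. rewrite (enorm_ext _ (fun _ => 0)) by (intros; ring). apply enorm_zero.
Qed.

Lemma enorm_edist {d} (x y : pt d) : enorm x <= enorm y + edist x y.
Proof.
  unfold edist. rewrite (enorm_ext x (fun j => y j + (x j - y j))) by (intros; ring).
  apply enorm_triang.
Qed.

Lemma enorm_sub_le {d} (x y : pt d) : enorm (fun j => x j - y j) <= enorm x + enorm y.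
Proof.
  rewrite (enorm_ext _ (fun j => x j + (-1) * y j)) by (intros; ring).
  eapply Rle_trans; [apply enorm_triang|].
  rewrite (enorm_scal y), Rabs_left by lra; lra.
Qed.

Lemma dot_edist {d} (u x y : pt d) : dot u x <= dot u y + enorm u * edist x y.
Proof.
  replace (dot u x) with (dot u y + dot u (fun j => x j - y j)).
  - assert (H := dot_cs u (fun j => x j - y j)). unfold edist. lra.
  - unfold dot. rewrite <- fsum_plus. apply fsum_ext; intros; ring.
Qed.

Lemma unit_vector d : (1 <= d)%nat -> exists e : pt d, enorm e = 1.
Proof.
  intros H; destruct d; [lia|].
  exists (fun j => Fin.caseS' j (fun _ => R) 1 (fun _ => 0)).
  rewrite enorm_dot; unfold dot; simpl.
  rewrite (fsum_ext d _ (fun _ => 0)) by (intros; ring). rewrite fsum_const.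
  replace (1 * 1 + INR d * 0) with 1 by ring. apply sqrt_1.
Qed.

Lemma nonempty_interior_point {d} (K : rset d) : nonempty_interior K -> exists c, K c.
Proof.
  intros (x & e & He & H). exists x. apply H. rewrite edist_refl; auto.
Qed.

(** * Sequential compactness *)

Definition increasing (phi : nat -> nat) := forall n, (phi n < phi (S n))%nat.

Lemma increasing_lt phi : increasing phi -> forall n m, (n < m)%nat -> (phi n < phi m)%nat.
Proof. intros H n m L. induction L; [apply H|]. specialize (H m). lia. Qed.

Lemma increasing_ge phi : increasing phi -> forall n, (n <= phi n)%nat.
Proof. intros H n. induction n; [lia|]. specialize (H n); lia. Qed.

(** From an adherence value [l] the subsequence is built recursively, each index chosen beyond the
    previous one and with distance to [l] below 1/(n+1). *)
Lemma real_convergent_subsequence (u : nat -> R) M : (forall n, Rabs (u n) <= M) ->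
  exists phi l, increasing phi /\ Un_cv (fun n => u (phi n)) l.
Proof.
  intros H.
  destruct (Bolzano_Weierstrass u (fun c => - M <= c <= M)) as [l Hl].
  - apply compact_P3.
  - intros n. specialize (H n). unfold Rabs in H; destruct (Rcase_abs (u n)); lra.
  - assert (Hx : forall n N, exists p, (N < p)%nat /\ Rabs (u p - l) < / (INR n + 1)).
    { intros n N. assert (Hn := pos_INR n).
      assert (He : 0 < / (INR n + 1)) by (apply Rinv_0_lt_compat; lra).
      destruct (Hl (disc l (mkposreal _ He)) (S N)) as (p & Hp & Hd).
      - exists (mkposreal _ He). intros y Hy; auto.
      - exists p. split; [lia|]. exact Hd. }
    destruct (choice2 _ Hx) as [nx Hnx].
    pose (phi := fix phi n := match n with O => nx O O | S m => nx (S m) (phi m) end).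
    exists phi, l. split.
    + intros n; simpl. apply Hnx.
    + intros eps Heps. destruct (INR_archimed eps 1 Heps) as [N HN].
      exists N. intros n Hn. unfold Rdist.
      apply Rlt_trans with (/ (INR n + 1)).
      * destruct n; simpl phi; apply Hnx.
      * assert (INR N <= INR n) by (apply le_INR; lia).
        assert (0 <= INR N) by apply pos_INR.
        apply (Rmult_lt_reg_l (INR n + 1)); [lra|]. rewrite Rinv_r by lra. nra.
Qed.

Lemma Un_cv_subseq u l phi : increasing phi -> Un_cv u l -> Un_cv (fun n => u (phi n)) l.
Proof.
  intros Hp H eps He. destruct (H eps He) as [N HN]. exists N. intros n Hn.
  apply HN. assert (K := increasing_ge phi Hp n). lia.
Qed.

Lemma coordinatewise_convergent_subsequence d (u : nat -> pt d) M : (forall n j, Rabs (u n j) <= M) ->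
  exists phi (l : pt d), increasing phi /\ forall j, Un_cv (fun n => u (phi n) j) (l j).
Proof.
  induction d; intros H.
  - exists (fun n => n), (fun _ => 0). split; [intros n; lia|]. intros j; inversion j.
  - destruct (real_convergent_subsequence (fun n => u n Fin.F1) M) as (phi & l1 & Hphi & Hl1); auto.
    destruct (IHd (fun n j => u (phi n) (Fin.FS j))) as (psi & l2 & Hpsi & Hl2); auto.
    exists (fun n => phi (psi n)), (fun j => Fin.caseS' j (fun _ => R) l1 l2).
    split.
    + intros n. apply increasing_lt; auto.
    + apply Fin_case; simpl; auto.
      apply (Un_cv_subseq (fun n => u (phi n) Fin.F1)); auto.
Qed.

Lemma cv_coord_edist d (u : nat -> pt d) l : (forall j, Un_cv (fun n => u n j) (l j)) ->
  forall eps, 0 < eps -> exists N, forall n, (N <= n)%nat -> edist (u n) l < eps.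
Proof.
  intros H eps He.
  assert (K : forall eps, 0 < eps -> exists N, forall n j, (N <= n)%nat -> Rabs (u n j - l j) < eps).
  { clear - H. intros eps He. induction d; [exists O; intros n j; inversion j|].
    destruct (IHd (fun n j => u n (Fin.FS j)) (fun j => l (Fin.FS j))) as [N1 H1]; [intros j; apply (H (Fin.FS j))|].
    destruct (H Fin.F1 eps He) as [N2 H2].
    exists (N1 + N2)%nat. intros n j Hn. revert j. apply Fin_case.
    - apply H2; lia.
    - intros j; apply H1; lia. }
  assert (Hd := pos_INR d).
  destruct (K (eps / (INR d + 1))) as [N HN]; [apply Rdiv_lt_0_compat; lra|].
  exists N; intros n Hn.
  apply Rle_lt_trans with (INR d * (eps / (INR d + 1))).
  - apply enorm_le_coord; [apply Rlt_le, Rdiv_lt_0_compat; lra|].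
    intros j; apply Rlt_le, HN; auto.
  - apply (Rmult_lt_reg_r (INR d + 1)); [lra|]. field_simplify; [|lra]. nra.
Qed.

Lemma convergent_subsequence {d} (u : nat -> pt d) M : (forall n, enorm (u n) <= M) ->
  exists phi l, increasing phi /\
    forall eps, 0 < eps -> exists N, forall n, (N <= n)%nat -> edist (u (phi n)) l < eps.
Proof.
  intros H. destruct (coordinatewise_convergent_subsequence d u M) as (phi & l & Hp & Hl).
  - intros n j. eapply Rle_trans; [apply coord_le_enorm|auto].
  - exists phi, l; split; auto. apply (cv_coord_edist d (fun n => u (phi n))); auto.
Qed.

Lemma Rabs_le_inv x a : Rabs x <= a -> - a <= x <= a.
Proof. unfold Rabs; destruct Rcase_abs; lra. Qed.

Lemma nat_least (P : nat -> Prop) : (exists n, P n) -> exists n, P n /\ forall m, P m -> (n <= m)%nat.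
Proof.
  intros [n Hn]. apply NNPP. intros H.
  assert (K : forall m k, (k < m)%nat -> ~ P k).
  { induction m; intros k Hk HP; [lia|]. apply H. exists k. split; auto.
    intros i Hi. apply Nat.nlt_ge. intros L. apply (IHm i); auto; lia. }
  apply (K (S n) n); auto.
Qed.

(** * Finite products and their continuity *)

Lemma fprod_ext n (f g : Fin.t n -> R) : (forall i, f i = g i) -> fprod n f = fprod n g.
Proof. induction n; simpl; intros H; auto. rewrite H, (IHn _ (fun i => g (Fin.FS i))); auto. Qed.

Lemma fprod_nonneg n (f : Fin.t n -> R) : (forall i, 0 <= f i) -> 0 <= fprod n f.
Proof. induction n; simpl; intros H; [lra|]. apply Rmult_le_pos; auto. Qed.

Lemma fprod_le n (f g : Fin.t n -> R) : (forall i, 0 <= f i <= g i) -> fprod n f <= fprod n g.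
Proof.
  induction n; simpl; intros H; [lra|].
  apply Rmult_le_compat; try apply H.
  - apply fprod_nonneg; intros; apply H.
  - apply IHn; intros; apply H.
Qed.

Lemma fprod_const n c : fprod n (fun _ => c) = c ^ n.
Proof. induction n; simpl; auto. rewrite IHn; auto. Qed.

Lemma fprod_scal n c (f : Fin.t n -> R) : fprod n (fun i => c * f i) = c ^ n * fprod n f.
Proof. induction n; simpl; [lra|]. rewrite (IHn (fun i => f (Fin.FS i))); ring. Qed.

(** Enlarging all edges of a box by the same small amount changes its volume little. The factors may
    have any sign, so that shrinking is covered too, by passing to negated edge lengths. *)
Lemma fprod_shift_cont n (f : Fin.t n -> R) eps : 0 < eps ->
  exists eta, 0 < eta /\ forall t, 0 <= t <= eta ->
    Rabs (fprod n (fun i => f i + t) - fprod n f) <= eps.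
Proof.
  revert eps; induction n; intros eps He.
  - exists 1; split; [lra|]. intros t _; simpl. rewrite Rminus_diag, Rabs_R0; lra.
  - set (a := f Fin.F1). set (g := fun i => f (Fin.FS i)). set (P := fprod n g).
    assert (Ha := Rabs_pos a). assert (HP := Rabs_pos P).
    destruct (IHn g (Rmin 1 (eps / (2 * (Rabs a + 1))))) as (eta & H1 & H2).
    { apply Rmin_glb_lt; [lra|]. apply Rdiv_lt_0_compat; lra. }
    exists (Rmin eta (Rmin 1 (eps / (2 * (Rabs P + 1))))). split.
    { repeat apply Rmin_glb_lt; try lra. apply Rdiv_lt_0_compat; lra. }
    intros t [Ht0 Ht].
    assert (t <= eta) by (eapply Rle_trans; [apply Ht|apply Rmin_l]).
    assert (Ht' : t <= Rmin 1 (eps / (2 * (Rabs P + 1)))) by (eapply Rle_trans; [apply Ht|apply Rmin_r]).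
    assert (t <= 1) by (eapply Rle_trans; [apply Ht'|apply Rmin_l]).
    assert (Ht2 : t <= eps / (2 * (Rabs P + 1))) by (eapply Rle_trans; [apply Ht'|apply Rmin_r]).
    assert (K := H2 t (conj Ht0 H)). simpl. change (fprod n (fun i => f (Fin.FS i) + t)) with (fprod n (fun i => g i + t)).
    set (Q := fprod n (fun i => g i + t)) in *. fold P in K. fold g. fold P. fold a.
    assert (K1 : Rabs (Q - P) <= 1) by (eapply Rle_trans; [apply K|apply Rmin_l]).
    assert (K2 : Rabs (Q - P) <= eps / (2 * (Rabs a + 1))) by (eapply Rle_trans; [apply K|apply Rmin_r]).
    replace ((a + t) * Q - a * P) with (a * (Q - P) + t * (P + (Q - P))) by ring.
    eapply Rle_trans; [apply Rabs_triang|]. rewrite !Rabs_mult, (Rabs_right t) by lra.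
    assert (Rabs (P + (Q - P)) <= Rabs P + 1) by (eapply Rle_trans; [apply Rabs_triang|lra]).
    assert (Rabs a * Rabs (Q - P) <= eps / 2).
    { apply Rle_trans with ((Rabs a + 1) * (eps / (2 * (Rabs a + 1)))); [|right; field; lra].
      apply Rmult_le_compat; try lra. apply Rabs_pos. }
    assert (t * Rabs (P + (Q - P)) <= eps / 2).
    { apply Rle_trans with ((eps / (2 * (Rabs P + 1))) * (Rabs P + 1)); [|right; field; lra].
      apply Rmult_le_compat; try lra. apply Rabs_pos. }
    lra.
Qed.

Lemma pow_shift_cont n c eps : 0 < eps ->
  exists eta, 0 < eta /\ forall t, 0 <= t <= eta -> Rabs ((c + t) ^ n - c ^ n) <= eps.
Proof.
  intros He. destruct (fprod_shift_cont n (fun _ => c) eps He) as (eta & H1 & H2).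
  exists eta; split; auto. intros t Ht. specialize (H2 t Ht). rewrite !fprod_const in H2; auto.
Qed.

(** * Integer grids *)

Definition fcons {A : Type} {d} (k : A) (z : Fin.t d -> A) : Fin.t (S d) -> A :=
  fun j => Fin.caseS' j (fun _ => A) k z.

Fixpoint ngrid (d M : nat) : list (Fin.t d -> nat) :=
  match d with
  | O => (fun _ => O) :: nil
  | S d' => flat_map (fun k => map (fcons k) (ngrid d' M)) (seq 0 M)
  end.

Lemma ngrid_length d M : length (ngrid d M) = (M ^ d)%nat.
Proof.
  induction d; simpl; auto.
  assert (H : forall l : list nat, length (flat_map (fun k => map (fcons k) (ngrid d M)) l) = (length l * M ^ d)%nat).
  { induction l; simpl; auto. rewrite length_app, length_map, IHl, IHd; auto. }
  rewrite H, length_seq; auto.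
Qed.

Lemma in_ngrid d M z : (forall j, (z j < M)%nat) -> In z (ngrid d M).
Proof.
  induction d; simpl; intros H.
  - left. apply functional_extensionality; intros j; inversion j.
  - apply in_flat_map. exists (z Fin.F1). split.
    + apply in_seq. specialize (H Fin.F1). lia.
    + apply in_map_iff. exists (fun j => z (Fin.FS j)). split; auto.
      apply functional_extensionality. apply Fin_case; auto.
Qed.

Lemma ngrid_in d M z : In z (ngrid d M) -> forall j, (z j < M)%nat.
Proof.
  induction d; simpl; intros H.
  - intros j; inversion j.
  - apply in_flat_map in H. destruct H as (k & Hk & H). apply in_seq in Hk.
    apply in_map_iff in H. destruct H as (z' & <- & Hz'). apply Fin_case; simpl; [lia|].
    intros i; apply IHd; auto.
Qed.

(** The distributive law; it reduces the number of grid points in a box to one count per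
    coordinate. *)
Lemma lsum_ngrid_prod d M (f : Fin.t d -> nat -> R) :
  lsum (fun z => fprod d (fun j => f j (z j))) (ngrid d M)
  = fprod d (fun j => lsum (f j) (seq 0 M)).
Proof.
  induction d; simpl; [lra|].
  rewrite lsum_flat_map.
  rewrite (lsum_ext _ (fun k => fprod d (fun j => lsum (f (Fin.FS j)) (seq 0 M)) * f Fin.F1 k)).
  - rewrite lsum_scal; ring.
  - intros k _. rewrite lsum_map.
    rewrite <- (IHd (fun j => f (Fin.FS j))), Rmult_comm, <- lsum_scal. reflexivity.
Qed.

(** The cap [INR M - 1] closes the induction on [M]: if the number [M] is counted, the capped right
    end moves from M - 1 to M and the bound grows by one; otherwise it does not decrease. *)
Lemma count_upper a b M : a <= b ->
  lsum (fun k => chi (a <= INR k <= b)) (seq 0 M) <= Rmax 0 (Rmin b (INR M - 1) - a + 1).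
Proof.
  intros Hab. induction M.
  - simpl. apply Rmax_l.
  - rewrite seq_S, lsum_app, S_INR; simpl lsum.
    unfold Rmax, Rmin in *. destruct (classic (a <= INR M <= b)) as [H|H].
    + rewrite (chi_true _ H). repeat destruct Rle_dec; lra.
    + rewrite (chi_false _ H). repeat destruct Rle_dec; lra.
Qed.

(** The same capped induction; [-1 <= a] makes the bound nonpositive at M = 0. *)
Lemma count_lower a b M : -1 <= a ->
  Rmin (b - 1) (INR M - 1) - a <= lsum (fun k => chi (a <= INR k <= b)) (seq 0 M).
Proof.
  intros Ha. induction M.
  - simpl. unfold Rmin; destruct Rle_dec; lra.
  - rewrite seq_S, lsum_app, S_INR; simpl lsum.
    assert (H0 : 0 <= lsum (fun k => chi (a <= INR k <= b)) (seq 0 M))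
      by (apply lsum_nonneg; intros; apply chi_bounds).
    unfold Rmin in *. destruct (classic (a <= INR M <= b)) as [H|H].
    + rewrite (chi_true _ H). repeat destruct Rle_dec; lra.
    + rewrite (chi_false _ H). destruct (Rlt_dec b (INR M)).
      * repeat destruct Rle_dec; lra.
      * assert (INR M < a) by (apply Rnot_le_lt; intros ?; apply H; lra).
        repeat destruct Rle_dec; lra.
Qed.

Lemma chi_forall d (P : Fin.t d -> Prop) : chi (forall j, P j) = fprod d (fun j => chi (P j)).
Proof.
  induction d; simpl.
  - apply chi_true. intros j; inversion j.
  - rewrite <- (IHd (fun j => P (Fin.FS j))).
    destruct (classic (P Fin.F1)) as [H|H]; [|rewrite (chi_false _ H), (chi_false (forall j, P j)) by auto; lra].
    rewrite (chi_true _ H), Rmult_1_l.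
    destruct (classic (forall j, P (Fin.FS j))) as [H'|H'].
    + rewrite (chi_true _ H'), chi_true; auto. apply Fin_case; auto.
    + rewrite (chi_false _ H'), chi_false; auto.
Qed.

(** A point of the lattice (Z/N)^d; the shift by [T] lets natural indices below 2TN range over the
    lattice points of [-T, T)^d. *)
Definition gridpt {d} (T N : nat) (z : Fin.t d -> nat) : pt d :=
  fun j => INR (z j) / INR N - INR T.

Lemma chi_gridpt_box d T N (a b : pt d) (z : Fin.t d -> nat) : (0 < N)%nat ->
  chi (in_box a b (gridpt T N z))
  = fprod d (fun j => chi (INR N * (a j + INR T) <= INR (z j) <= INR N * (b j + INR T))).
Proof.
  intros HN. apply lt_INR in HN; simpl in HN. unfold in_box. rewrite chi_forall.
  apply fprod_ext. intros j. unfold gridpt.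
  assert (E : INR (z j) = INR N * (INR (z j) / INR N)) by (field; lra).
  set (q := INR (z j) / INR N) in *. rewrite E.
  destruct (classic (a j <= q - INR T <= b j)) as [H|H].
  - rewrite !chi_true; auto. nra.
  - rewrite !chi_false; auto. intros [H1 H2]. apply H.
    apply Rmult_le_reg_l in H1; auto. apply Rmult_le_reg_l in H2; auto. lra.
Qed.

Lemma grid_count_upper d T N M (a b : pt d) : (0 < N)%nat -> (forall j, a j <= b j) ->
  lsum (fun z => chi (in_box a b (gridpt T N z))) (ngrid d M)
  <= INR N ^ d * fprod d (fun j => b j - a j + / INR N).
Proof.
  intros HN Hab. rewrite (lsum_ext _ _ _ (fun z _ => chi_gridpt_box d T N a b z HN)).
  rewrite (lsum_ngrid_prod d M (fun j k => chi (INR N * (a j + INR T) <= INR k <= INR N * (b j + INR T)))).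
  rewrite <- fprod_scal. apply lt_INR in HN; simpl in HN. apply fprod_le. intros j. split.
  - apply lsum_nonneg; intros; apply chi_bounds.
  - specialize (Hab j).
    assert (INR N * (a j + INR T) <= INR N * (b j + INR T)) by (apply Rmult_le_compat_l; lra).
    eapply Rle_trans; [apply count_upper; auto|].
    apply Rmax_lub.
    + apply Rmult_le_pos; [lra|]. assert (0 < / INR N) by (apply Rinv_0_lt_compat; auto). lra.
    + replace (INR N * (b j - a j + / INR N)) with (INR N * (b j - a j) + 1) by (field; lra).
      assert (Rmin (INR N * (b j + INR T)) (INR M - 1) <= INR N * (b j + INR T)) by apply Rmin_l.
      lra.
Qed.

Lemma grid_count_lower d T N (a : pt d) s : (0 < N)%nat ->
  (forall j, - INR T <= a j /\ a j + s <= INR T) -> / INR N <= s ->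
  INR N ^ d * (s - / INR N) ^ d
  <= lsum (fun z => chi (in_box a (fun j => a j + s) (gridpt T N z))) (ngrid d (2 * T * N)).
Proof.
  intros HN Hab Hs.
  rewrite (lsum_ext _ _ _ (fun z _ => chi_gridpt_box d T N a (fun j => a j + s) z HN)).
  rewrite (lsum_ngrid_prod d _ (fun j k => chi (INR N * (a j + INR T) <= INR k <= INR N * (a j + s + INR T)))).
  rewrite <- Rpow_mult_distr, <- fprod_const. apply lt_INR in HN; simpl in HN.
  assert (E : INR N * (s - / INR N) = INR N * s - 1) by (field; lra).
  apply fprod_le. intros j. split.
  - apply Rmult_le_pos; lra.
  - rewrite E. eapply Rle_trans; [|apply count_lower].
    + rewrite !mult_INR. simpl (INR 2). destruct (Hab j).
      assert (INR N * (a j + s) <= INR N * INR T) by (apply Rmult_le_compat_l; lra).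
      rewrite Rmin_left by nra. nra.
    + destruct (Hab j). assert (0 <= INR N * (a j + INR T)) by (apply Rmult_le_pos; lra). lra.
Qed.

(** * Volume *)

(** The predicate inside [is_vol], given a name: [is_vol A v] unfolds to
    [is_inf (box_cover_sum A) v]. *)
Definition box_cover_sum {d} (A : rset d) (s : R) : Prop :=
  exists a b : nat -> pt d,
    (forall k j, a k j <= b k j) /\
    (forall x, A x -> exists k, in_box (a k) (b k) x) /\
    infinite_sum (fun k => box_vol (a k) (b k)) s.

Lemma is_inf_unique E m m' : is_inf E m -> is_inf E m' -> m = m'.
Proof. intros [H1 H2] [H3 H4]. apply Rle_antisym; auto. Qed.

Lemma is_inf_exists (E : R -> Prop) : (exists x, E x) -> (exists m, forall x, E x -> m <= x) ->
  exists m, is_inf E m.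
Proof.
  intros [x Hx] [m Hm].
  destruct (completeness (fun y => E (- y))) as [l [Hl1 Hl2]].
  - exists (- m). intros y Hy. specialize (Hm _ Hy). lra.
  - exists (- x). rewrite Ropp_involutive; auto.
  - exists (- l). split.
    + intros y Hy. assert (- y <= l) by (apply Hl1; rewrite Ropp_involutive; auto). lra.
    + intros y Hy. assert (l <= - y); [|lra]. apply Hl2. intros z Hz. specialize (Hy _ Hz). lra.
Qed.

Lemma sum_f_R0_lsum (f : nat -> R) n : sum_f_R0 f n = lsum f (seq 0 (S n)).
Proof.
  induction n; [simpl; lra|]. rewrite seq_S, lsum_app, <- IHn. simpl. lra.
Qed.

Lemma infinite_sum_nonneg_ge (f : nat -> R) S n : (forall k, 0 <= f k) -> infinite_sum f S ->
  lsum f (seq 0 n) <= S.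
Proof.
  intros Hf HS. destruct n; [|rewrite <- sum_f_R0_lsum].
  - simpl. apply Rnot_lt_le. intros Hlt. destruct (HS (- S)) as [N HN]; [lra|].
    specialize (HN N (Nat.le_refl _)). unfold Rdist in HN. apply Rabs_def2 in HN.
    assert (0 <= sum_f_R0 f N) by (apply cond_pos_sum; auto). lra.
  - apply sum_incr; auto.
Qed.

Lemma infinite_sum_bounded (f : nat -> R) B : (forall k, 0 <= f k) ->
  (forall n, lsum f (seq 0 n) <= B) -> exists S, infinite_sum f S /\ 0 <= S <= B.
Proof.
  intros Hf HB. destruct (growing_cv (sum_f_R0 f)) as [S HS].
  - intros n. simpl. specialize (Hf (Datatypes.S n)). lra.
  - exists B. intros x [n ->]. rewrite sum_f_R0_lsum; auto.
  - exists S. split; [exact HS|]. split.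
    + apply (infinite_sum_nonneg_ge f S 0); auto.
    + apply Rnot_lt_le. intros Hlt. destruct (HS (S - B)) as [N HN]; [lra|].
      specialize (HN N (Nat.le_refl _)). unfold Rdist in HN. apply Rabs_def2 in HN.
      assert (H := HB (Datatypes.S N)). rewrite <- sum_f_R0_lsum in H. lra.
Qed.

Lemma infinite_sum_nth {A} (f : A -> R) l (a : A) : f a = 0 ->
  infinite_sum (fun k => f (nth k l a)) (lsum f l).
Proof.
  intros Ha.
  assert (H : forall n, lsum (fun k => f (nth k l a)) (seq 0 n) = lsum f (firstn n l)).
  { clear - Ha. intros n. revert l. induction n; intros l; auto.
    replace (seq 0 (S n)) with (0%nat :: map S (seq 0 n)) by (rewrite seq_shift; auto).
    destruct l as [|b l].
    - rewrite firstn_nil, (lsum_ext _ (fun _ => 0)), lsum_const; [simpl; lra|].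
      intros k _; destruct k; exact Ha.
    - change (f b + lsum (fun k => f (nth k (b :: l) a)) (map S (seq 0 n)) = f b + lsum f (firstn n l)).
      rewrite lsum_map, <- IHn. reflexivity. }
  intros eps He. exists (length l). intros n Hn. rewrite sum_f_R0_lsum, H, firstn_all2 by lia.
  rewrite Rdist_eq; auto.
Qed.

Lemma box_vol_nonneg {d} (a b : pt d) : (forall j, a j <= b j) -> 0 <= box_vol a b.
Proof. intros H. apply fprod_nonneg. intros j; specialize (H j); lra. Qed.

Lemma box_cover_sum_nonneg {d} (A : rset d) s : box_cover_sum A s -> 0 <= s.
Proof.
  intros (a & b & H1 & H2 & H3). apply (infinite_sum_nonneg_ge _ _ 0) in H3; auto.
  intros k; apply box_vol_nonneg; auto.
Qed.

Lemma is_vol_nonneg {d} (A : rset d) v : is_vol A v -> 0 <= v.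
Proof. intros [_ H]. apply H. intros s Hs. apply (box_cover_sum_nonneg A s Hs). Qed.

Lemma is_vol_exists {d} (A : rset d) : (exists s, box_cover_sum A s) -> exists v, is_vol A v.
Proof.
  intros H. apply is_inf_exists; auto. exists 0. intros s Hs. apply (box_cover_sum_nonneg A s Hs).
Qed.

Definition cube {d} (a : pt d) (s : R) : rset d := in_box a (fun j => a j + s).

Lemma box_vol_cube {d} (a : pt d) s : box_vol a (fun j => a j + s) = s ^ d.
Proof.
  unfold box_vol. rewrite <- fprod_const. apply fprod_ext. intros; ring.
Qed.

Lemma box_cover_sum_cubes {d} (A : rset d) (l : list (pt d * R)) : (1 <= d)%nat ->
  (forall q, In q l -> 0 <= snd q) ->
  (forall x, A x -> exists q, In q l /\ cube (fst q) (snd q) x) ->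
  box_cover_sum A (lsum (fun q => snd q ^ d) l).
Proof.
  (* [o] continues the finite list to a sequence by cubes of side 0, whose volume 0^d vanishes since
     [1 <= d]. *)
  intros Hd Hl Hc. pose (o := ((fun _ => 0) : pt d, 0)).
  exists (fun k => fst (nth k l o)), (fun k j => fst (nth k l o) j + snd (nth k l o)).
  repeat split.
  - intros k j. destruct (nth_in_or_default k l o) as [H| ->]; simpl; [|lra].
    specialize (Hl _ H). lra.
  - intros x Hx. destruct (Hc x Hx) as (q & Hq & Hqx).
    destruct (In_nth l q o Hq) as (k & Hk & Ek). exists k. rewrite Ek; auto.
  - assert (E : (fun k : nat => box_vol (fst (nth k l o)) (fun j : Fin.t d => fst (nth k l o) j + snd (nth k l o)))
       = (fun k => (fun q : pt d * R => snd q ^ d) (nth k l o))).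
    { apply functional_extensionality. intros k. apply box_vol_cube. }
    rewrite E. apply (infinite_sum_nth (fun q : pt d * R => snd q ^ d)). simpl. apply pow_i. lia.
Qed.

Lemma is_vol_le_cubes {d} (A : rset d) v (l : list (pt d * R)) : (1 <= d)%nat ->
  is_vol A v -> (forall q, In q l -> 0 <= snd q) ->
  (forall x, A x -> exists q, In q l /\ cube (fst q) (snd q) x) ->
  v <= lsum (fun q => snd q ^ d) l.
Proof. intros Hd [H _] Hl Hc. apply H. apply box_cover_sum_cubes; auto. Qed.

Lemma bounded_vol {d} (A : rset d) : (1 <= d)%nat -> Defs.bounded A -> exists v, is_vol A v.
Proof.
  intros Hd [M HM]. apply is_vol_exists.
  exists (lsum (fun q => snd q ^ d) (((fun _ : Fin.t d => - Rabs M), 2 * Rabs M) :: nil)).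
  apply (box_cover_sum_cubes A (((fun _ : Fin.t d => - Rabs M), 2 * Rabs M) :: nil)); auto.
  - intros q [<-|[]]. simpl. assert (H := Rabs_pos M). lra.
  - intros x Hx. eexists; split; [left; reflexivity|]. intros j. simpl.
    assert (H := coord_le_enorm x j). specialize (HM x Hx).
    assert (H' := Rle_abs M). unfold Rabs at 1 in H; destruct (Rcase_abs (x j)); lra.
Qed.

Lemma box_cover_sum_subset {d} (A B : rset d) s : subset A B -> box_cover_sum B s -> box_cover_sum A s.
Proof. intros H (a & b & H1 & H2 & H3). exists a, b. repeat split; auto. Qed.

Lemma infinite_sum_scal (f : nat -> R) S c : infinite_sum f S -> infinite_sum (fun k => c * f k) (c * S).
Proof.
  intros H eps He. assert (Hc := Rabs_pos c).
  destruct (H (eps / (Rabs c + 1))) as [N HN]; [apply Rdiv_lt_0_compat; lra|].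
  exists N. intros n Hn. specialize (HN n Hn). unfold Rdist in *.
  rewrite (sum_eq _ (fun k => f k * c)) by (intros; ring). rewrite <- scal_sum.
  rewrite <- Rmult_minus_distr_l, Rabs_mult.
  apply Rle_lt_trans with (Rabs c * (eps / (Rabs c + 1))).
  - apply Rmult_le_compat_l; lra.
  - apply (Rmult_lt_reg_r (Rabs c + 1)); [lra|]. field_simplify; [|lra]. nra.
Qed.

Lemma box_cover_sum_hom {d} (A : rset d) s x lam : 0 < lam -> box_cover_sum A s ->
  box_cover_sum (hom x lam A) (lam ^ d * s).
Proof.
  intros Hl (a & b & H1 & H2 & H3).
  exists (fun k j => x j + lam * a k j), (fun k j => x j + lam * b k j). repeat split.
  - intros k j. specialize (H1 k j). nra.
  - intros p (y & Hy & Hp). destruct (H2 y Hy) as [k Hk]. exists k. intros j.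
    rewrite Hp. specialize (Hk j). nra.
  - assert (E : (fun k => box_vol (fun j => x j + lam * a k j) (fun j => x j + lam * b k j))
      = (fun k => lam ^ d * box_vol (a k) (b k))).
    { apply functional_extensionality; intros k. unfold box_vol. rewrite <- fprod_scal.
      apply fprod_ext; intros; ring. }
    rewrite E. apply infinite_sum_scal; auto.
Qed.

(** Box covers scale with the set, which gives one inequality; the other follows because [A] lies in
    a homothet of [hom x lam A] with ratio 1/lam. *)
Lemma is_vol_hom {d} (A : rset d) v x lam : 0 < lam -> is_vol A v -> is_vol (hom x lam A) (lam ^ d * v).
Proof.
  intros Hl [H1 H2]. assert (Hp : 0 < lam ^ d) by (apply pow_lt; auto). split.
  - intros s Hs.
    assert (Hs' : box_cover_sum A (/ lam ^ d * s)).
    { rewrite <- pow_inv.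
      apply box_cover_sum_subset with (hom (fun j => - / lam * x j) (/ lam) (hom x lam A)).
      - intros p Hp'. exists (fun j => x j + lam * p j). split; [exists p; auto|].
        intros j; field; lra.
      - apply box_cover_sum_hom; auto. apply Rinv_0_lt_compat; auto. }
    apply H1 in Hs'. apply (Rmult_le_reg_l (/ lam ^ d)); [apply Rinv_0_lt_compat; auto|].
    rewrite <- Rmult_assoc, Rinv_l by lra. lra.
  - intros y Hy. assert (/ lam ^ d * y <= v).
    { apply H2. intros s Hs. apply (Rmult_le_reg_l (lam ^ d)); auto.
      rewrite <- Rmult_assoc, Rinv_r, Rmult_1_l by lra. apply Hy. apply box_cover_sum_hom; auto. }
    apply (Rmult_le_reg_l (/ lam ^ d)); [apply Rinv_0_lt_compat; auto|].
    rewrite <- Rmult_assoc, Rinv_l by lra. lra.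
Qed.

Definition in_open_box {d} (a b x : pt d) : Prop := forall j, a j < x j < b j.

Lemma open_box_open {d} (a b x : pt d) : in_open_box a b x ->
  exists e, 0 < e /\ forall y, edist y x < e -> in_open_box a b y.
Proof.
  intros H.
  assert (K : exists e, 0 < e /\ forall j, a j + e < x j < b j - e).
  { clear - H. induction d; [exists 1; split; [lra|intros j; inversion j]|].
    destruct (IHd (fun j => a (Fin.FS j)) (fun j => b (Fin.FS j)) (fun j => x (Fin.FS j))) as (e & He & He').
    - intros j; apply (H (Fin.FS j)).
    - destruct (H Fin.F1) as [H1 H2].
      exists (Rmin e (Rmin ((x Fin.F1 - a Fin.F1) / 2) ((b Fin.F1 - x Fin.F1) / 2))).
      assert (M1 := Rmin_l e (Rmin ((x Fin.F1 - a Fin.F1) / 2) ((b Fin.F1 - x Fin.F1) / 2))).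
      assert (M2 := Rmin_r e (Rmin ((x Fin.F1 - a Fin.F1) / 2) ((b Fin.F1 - x Fin.F1) / 2))).
      assert (M3 := Rmin_l ((x Fin.F1 - a Fin.F1) / 2) ((b Fin.F1 - x Fin.F1) / 2)).
      assert (M4 := Rmin_r ((x Fin.F1 - a Fin.F1) / 2) ((b Fin.F1 - x Fin.F1) / 2)).
      split; [repeat apply Rmin_glb_lt; lra|].
      apply Fin_case; [lra|]. intros i; specialize (He' i); lra. }
  destruct K as (e & He & He'). exists e; split; auto. intros y Hy j.
  assert (C := coord_le_enorm (fun j => y j - x j) j). unfold edist in Hy.
  specialize (He' j). apply Rle_lt_trans with (1 := C) in Hy. apply Rabs_def2 in Hy. lra.
Qed.

(** Heine-Borel for a countable cover by open boxes: otherwise each n has a point missed by the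
    first n boxes. An accumulation point of these lies in some box k, and then so do points missed
    by the first k + 1 boxes. *)
Lemma cube_compact {d} (q : pt d) s (a b : nat -> pt d) :
  (forall x, cube q s x -> exists k, in_open_box (a k) (b k) x) ->
  exists n, forall x, cube q s x -> exists k, (k < n)%nat /\ in_open_box (a k) (b k) x.
Proof.
  intros H. apply NNPP. intros Hn.
  assert (K : forall n, exists x, cube q s x /\ forall k, (k < n)%nat -> ~ in_open_box (a k) (b k) x).
  { intros n. apply NNPP. intros Hx. apply Hn. exists n. intros x Hxq. apply NNPP.
    intros Hk. apply Hx. exists x. split; auto. intros k Hkn Hb. apply Hk. exists k; auto. }
  destruct (choice _ K) as [u Hu].
  assert (Hs : forall n j, Rabs (u n j) <= Rabs (q j) + Rabs s).
  { intros n j. destruct (Hu n) as [Hc _]. specialize (Hc j). unfold Rabs; repeat destruct Rcase_abs; lra. }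
  destruct (convergent_subsequence u (enorm q + INR d * Rabs s)) as (phi & l & Hphi & Hl).
  { intros n. eapply Rle_trans; [apply (enorm_edist _ q)|]. apply Rplus_le_compat_l.
    apply enorm_le_coord; [apply Rabs_pos|]. intros j. destruct (Hu n) as [Hc _].
    specialize (Hc j). unfold Rabs; repeat destruct Rcase_abs; lra. }
  assert (Hlc : cube q s l).
  { assert (C : forall j eps, 0 < eps -> exists n, Rabs (u n j - l j) < eps).
    { intros j eps He. destruct (Hl eps He) as [N HN]. exists (phi N).
      eapply Rle_lt_trans; [apply (coord_le_enorm (fun j => u (phi N) j - l j))|]. apply HN; auto. }
    intros j. split; apply Rnot_lt_le; intros Hlt.
    - destruct (C j (q j - l j)) as [n Hnj]; [lra|]. apply Rabs_def2 in Hnj.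
      destruct (Hu n) as [Hc _]. specialize (Hc j). lra.
    - destruct (C j (l j - (q j + s))) as [n Hnj]; [lra|]. apply Rabs_def2 in Hnj.
      destruct (Hu n) as [Hc _]. specialize (Hc j). lra. }
  destruct (H l Hlc) as [k Hk]. destruct (open_box_open _ _ _ Hk) as (e & He & Hopen).
  destruct (Hl e He) as [N HN]. pose (n := (N + S k)%nat).
  destruct (Hu (phi n)) as [_ Hno]. apply (Hno k).
  - assert (A := increasing_ge phi Hphi n). unfold n in *; lia.
  - apply Hopen, HN. unfold n; lia.
Qed.

Lemma cubes_compact {d} (Q : list (pt d * R)) (a b : nat -> pt d) :
  (forall q x, In q Q -> cube (fst q) (snd q) x -> exists k, in_open_box (a k) (b k) x) ->
  exists n, forall q x, In q Q -> cube (fst q) (snd q) x -> exists k, (k < n)%nat /\ in_open_box (a k) (b k) x.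
Proof.
  induction Q as [|q Q IH]; intros H.
  - exists O. intros q x [].
  - destruct IH as [n1 H1]; [intros; apply (H q0); simpl; auto|].
    destruct (cube_compact (fst q) (snd q) a b) as [n2 H2]; [intros; apply (H q); simpl; auto|].
    exists (n1 + n2)%nat. intros q' x [<-|Hq'] Hx.
    + destruct (H2 x Hx) as (k & ? & ?). exists k; split; auto; lia.
    + destruct (H1 _ x Hq' Hx) as (k & ? & ?). exists k; split; auto; lia.
Qed.

Lemma list_bound {A} (f : A -> R) (l : list A) : exists B, forall a, In a l -> f a <= B.
Proof.
  induction l as [|a l [B HB]]; [exists 0; intros a []|].
  exists (Rmax (f a) B). intros b [<-|Hb]; [apply Rmax_l|].
  eapply Rle_trans; [apply HB; auto|apply Rmax_r].
Qed.

Lemma list_pos_lower_bound {A} (f : A -> R) (l : list A) : (forall a, In a l -> 0 < f a) ->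
  exists e, 0 < e /\ forall a, In a l -> e <= f a.
Proof.
  induction l as [|a l IH]; intros H; [exists 1; split; [lra|intros a []]|].
  destruct IH as (e & He & Hl); [intros; apply H; simpl; auto|].
  exists (Rmin e (f a)). split; [apply Rmin_glb_lt; auto; apply H; simpl; auto|].
  intros b [<-|Hb]; [apply Rmin_r|]. eapply Rle_trans; [apply Rmin_l|auto].
Qed.

Lemma geom_half_sum eps n : lsum (fun k => eps * (/ 2) ^ (S k)) (seq 0 n) = eps * (1 - (/ 2) ^ n).
Proof.
  induction n; [simpl; lra|]. rewrite seq_S, lsum_app, IHn. simpl. lra.
Qed.

Lemma small_inv_INR eps : 0 < eps -> exists n, (0 < n)%nat /\ / INR n <= eps.
Proof.
  intros He. destruct (INR_archimed eps 1 He) as [n Hn]. exists n.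
  assert (0 < INR n). { assert (H := pos_INR n). destruct H as [H|H]; auto. rewrite <- H in Hn; lra. }
  split.
  - apply INR_lt; auto.
  - apply (Rmult_le_reg_l (INR n)); auto. rewrite Rinv_r; lra.
Qed.

Definition half_open_cube {d} (a : pt d) (s : R) : rset d := fun p => forall j, a j <= p j < a j + s.

(* By compactness finitely many slightly enlarged boxes of the cover suffice; then
   compare the numbers of points of the grid (Z/N)^d on both sides. *)
Lemma box_cover_sum_ge {d} (A : rset d) s (Q : list (pt d * R)) :
  (forall q, In q Q -> 0 < snd q) ->
  (forall q p, In q Q -> half_open_cube (fst q) (snd q) p -> A p) ->
  (forall p, lsum (fun q => chi (half_open_cube (fst q) (snd q) p)) Q <= 1) ->
  box_cover_sum A s -> lsum (fun q => snd q ^ d) Q <= s.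
Proof.
  intros Hpos HA Hdisj (a & b & Hab & Hcov & Hsum).
  apply le_epsilon. intros eps Heps.
  assert (Heta : forall k, exists eta, 0 < eta /\ forall t, 0 <= t <= eta ->
            fprod d (fun j => b k j - a k j + t) <= box_vol (a k) (b k) + eps / 2 * (/ 2) ^ (S k)).
  { intros k. assert (He : 0 < eps / 2 * (/ 2) ^ (S k)).
    { apply Rmult_lt_0_compat; [lra|]. apply pow_lt; lra. }
    destruct (fprod_shift_cont d (fun j => b k j - a k j) _ He) as (eta & H1 & H2).
    exists eta; split; auto. intros t Ht. specialize (H2 t Ht). unfold box_vol.
    apply Rabs_le_inv in H2. lra. }
  destruct (choice _ Heta) as [eta Heta'].
  (* [th] is a permitted loss in side: once to put closed cubes inside the half-open ones, once more
     for rounding in the count of grid points. Both together cost at most eps/2 in volume. *)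
  assert (Hth : exists th, 0 < th /\ (forall q, In q Q -> 2 * th <= snd q) /\
            lsum (fun q => snd q ^ d) Q <= lsum (fun q => (snd q - 2 * th) ^ d) Q + eps / 2).
  { clear - Hpos Heps.
    assert (K : forall eps, 0 < eps -> exists th0, 0 < th0 /\ forall th, 0 < th <= th0 ->
       lsum (fun q => snd q ^ d) Q <= lsum (fun q => (snd q - 2 * th) ^ d) Q + eps).
    { clear eps Heps. induction Q as [|q Q' IH]; intros eps Heps.
      - exists 1. split; [lra|]. simpl. intros; lra.
      (* Below, shrinking [snd q] by 2 th is treated as adding 2 th to [- snd q], up to the sign
         (-1)^d, which the absolute value removes. *)
      - destruct (IH (fun q Hq => Hpos q (or_intror Hq)) (eps / 2)) as (t1 & Ht1 & H1); [lra|].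
        destruct (fprod_shift_cont d (fun _ => - snd q) (eps / 2)) as (t2 & Ht2 & H2); [lra|].
        exists (Rmin t1 (t2 / 2)). split; [apply Rmin_glb_lt; lra|]. intros th [Hth0 Hth].
        assert (th <= t1) by (eapply Rle_trans; [apply Hth|apply Rmin_l]).
        assert (th <= t2 / 2) by (eapply Rle_trans; [apply Hth|apply Rmin_r]).
        specialize (H1 th ltac:(lra)). specialize (H2 (2 * th) ltac:(lra)).
        rewrite !fprod_const in H2.
        assert (E : Rabs ((snd q - 2 * th) ^ d - snd q ^ d) <= eps / 2).
        { replace (snd q - 2 * th) with ((-1) * (- snd q + 2 * th)) by ring.
          replace (snd q ^ d) with (((-1) * (- snd q)) ^ d) by (f_equal; ring).
          rewrite !Rpow_mult_distr, <- Rmult_minus_distr_l, Rabs_mult, <- RPow_abs.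
          rewrite Rabs_left by lra. replace (- -1) with 1 by ring. rewrite pow1. lra. }
        apply Rabs_le_inv in E. simpl. lra. }
    destruct (K (eps / 2) ltac:(lra)) as (th0 & Hth0 & H).
    destruct (list_pos_lower_bound (fun q => snd q / 2) Q) as (e & He & Hmin).
    { intros q Hq. specialize (Hpos q Hq). lra. }
    exists (Rmin th0 e). split; [apply Rmin_glb_lt; auto|]. split.
    - intros q Hq. specialize (Hmin q Hq). assert (R0 := Rmin_r th0 e). lra.
    - apply H. split; [apply Rmin_glb_lt; auto|apply Rmin_l]. }
  destruct Hth as (th & Hth & Hth2 & Hth3).
  pose (Q' := map (fun q => (fst q, snd q - th)) Q).
  destruct (cubes_compact Q' (fun k j => a k j - eta k / 4) (fun k j => b k j + eta k / 4)) as [n Hn].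
  { intros q' x Hq' Hx. apply in_map_iff in Hq'. destruct Hq' as (q & <- & Hq). simpl in Hx.
    assert (HAx : A x). { apply (HA q); auto. intros j. specialize (Hx j). simpl in Hx. lra. }
    destruct (Hcov x HAx) as [k Hk]. exists k. intros j. specialize (Hk j).
    destruct (Heta' k). lra. }
  destruct (list_pos_lower_bound eta (seq 0 n)) as (e0 & He0 & Hmin); [intros; apply Heta'|].
  (* Each box was enlarged by [eta k / 4] on both sides, and counting grid points adds 1/N to every
     edge; with 1/N at most half of every relevant [eta k] the total stays within [eta k]. *)
  destruct (small_inv_INR (Rmin (e0 / 2) th)) as (N & HN & HNinv).
  { apply Rmin_glb_lt; lra. }
  assert (HN1 : / INR N <= e0 / 2) by (eapply Rle_trans; [apply HNinv|apply Rmin_l]).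
  assert (HN2 : / INR N <= th) by (eapply Rle_trans; [apply HNinv|apply Rmin_r]).
  assert (HN3 : 0 < / INR N) by (apply Rinv_0_lt_compat; apply (lt_INR 0); auto).
  destruct (list_bound (fun q : pt d * R => enorm (fst q) + Rabs (snd q)) Q) as [B HB].
  destruct (INR_archimed 1 B) as [T HT]; [lra|].
  pose (G := ngrid d (2 * T * N)).
  assert (L1 : INR N ^ d * lsum (fun q => (snd q - 2 * th) ^ d) Q <=
     lsum (fun z => lsum (fun q => chi (cube (fst q) (snd q) (gridpt T N z))) Q') G).
  { rewrite lsum_swap. unfold Q'. rewrite lsum_map, <- lsum_scal. apply lsum_le. intros q Hq. simpl.
    specialize (Hth2 q Hq). eapply Rle_trans; [|apply grid_count_lower; auto].
    - apply Rmult_le_compat_l; [apply pow_le, pos_INR|]. apply pow_incr. lra.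
    - intros j. specialize (HB q Hq). simpl in HB. assert (C := coord_le_enorm (fst q) j).
      specialize (Hpos q Hq). assert (C2 := Rle_abs (snd q)).
      unfold Rabs at 1 in C; destruct (Rcase_abs (fst q j)); lra.
    - lra. }
  (* A grid point in the shrunk cubes counts at most once on the left, by disjointness, and at least
     once on the right, since finitely many enlarged boxes cover these cubes. *)
  assert (L2 : lsum (fun z => lsum (fun q => chi (cube (fst q) (snd q) (gridpt T N z))) Q') G
     <= lsum (fun z => lsum (fun k => chi (in_box (fun j => a k j - eta k / 4) (fun j => b k j + eta k / 4) (gridpt T N z))) (seq 0 n)) G).
  { apply lsum_le. intros z _. set (p := gridpt T N z).
    destruct (classic (exists q, In q Q' /\ cube (fst q) (snd q) p)) as [(q & Hq & Hqp)|Hno].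
    - apply Rle_trans with 1.
      + eapply Rle_trans; [|apply (Hdisj p)]. unfold Q'. rewrite lsum_map. apply lsum_le.
        intros q' Hq'. apply chi_le. simpl. intros Hc j. specialize (Hc j). simpl in Hc. lra.
      + destruct (Hn q p Hq Hqp) as (k & Hk & Hkp).
        pose (g := fun k => chi (in_box (fun j => a k j - eta k / 4) (fun j => b k j + eta k / 4) p)).
        change (1 <= lsum g (seq 0 n)).
        eapply Rle_trans; [|apply (lsum_in_le g _ k)].
        * unfold g. rewrite chi_true; [lra|]. intros j. specialize (Hkp j). lra.
        * intros; apply chi_bounds.
        * apply in_seq; lia.
    - rewrite (lsum_ext _ (fun _ => 0)).
      + rewrite lsum_const, Rmult_0_r. apply lsum_nonneg; intros; apply chi_bounds.
      + intros q Hq. apply chi_false. intros Hc. apply Hno. exists q; auto. }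
  assert (L3 : lsum (fun z => lsum (fun k => chi (in_box (fun j => a k j - eta k / 4) (fun j => b k j + eta k / 4) (gridpt T N z))) (seq 0 n)) G
     <= INR N ^ d * (s + eps / 2)).
  { rewrite lsum_swap.
    apply Rle_trans with (lsum (fun k => INR N ^ d * (box_vol (a k) (b k) + eps / 2 * (/ 2) ^ (S k))) (seq 0 n)).
    - apply lsum_le. intros k Hk. eapply Rle_trans; [apply grid_count_upper; auto|].
      + intros j. specialize (Hab k j). destruct (Heta' k). lra.
      + apply Rmult_le_compat_l; [apply pow_le, pos_INR|].
        destruct (Heta' k) as [H1 H2]. specialize (Hmin k Hk).
        rewrite (fprod_ext d _ (fun j => b k j - a k j + (eta k / 2 + / INR N))) by (intros; lra).
        apply H2. lra.
    - rewrite lsum_scal. apply Rmult_le_compat_l; [apply pow_le, pos_INR|].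
      rewrite lsum_plus, geom_half_sum.
      assert (lsum (fun k => box_vol (a k) (b k)) (seq 0 n) <= s).
      { apply infinite_sum_nonneg_ge; auto. intros k; apply box_vol_nonneg; auto. }
      assert (0 < (/ 2) ^ n) by (apply pow_lt; lra). nra. }
  assert (L4 : lsum (fun q => (snd q - 2 * th) ^ d) Q <= s + eps / 2).
  { apply (Rmult_le_reg_l (INR N ^ d)); [apply pow_lt, (lt_INR 0); auto|]. lra. }
  lra.
Qed.

Lemma is_vol_ge_cubes {d} (A : rset d) v (Q : list (pt d * R)) :
  is_vol A v ->
  (forall q, In q Q -> 0 < snd q) ->
  (forall q p, In q Q -> half_open_cube (fst q) (snd q) p -> A p) ->
  (forall p, lsum (fun q => chi (half_open_cube (fst q) (snd q) p)) Q <= 1) ->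
  lsum (fun q => snd q ^ d) Q <= v.
Proof. intros [_ Hv] H1 H2 H3. apply Hv. intros s Hs. apply (box_cover_sum_ge A s Q); auto. Qed.

Lemma interior_vol_pos {d} (A : rset d) v : is_vol A v -> nonempty_interior A -> 0 < v.
Proof.
  intros Hv (c & e & He & HA). assert (Hd := pos_INR d). set (s := e / (INR d + 1)).
  assert (Hs : 0 < s) by (apply Rdiv_lt_0_compat; lra).
  apply Rlt_le_trans with (s ^ d); [apply pow_lt; auto|].
  replace (s ^ d) with (lsum (fun q => snd q ^ d) ((c, s) :: nil)) by (simpl; ring).
  apply (is_vol_ge_cubes A); auto.
  - intros q [<-|[]]; auto.
  - intros q p [<-|[]] Hp. apply HA. apply Rle_lt_trans with (INR d * s).
    + apply enorm_le_coord; [lra|]. intros j. specialize (Hp j). simpl in Hp. rewrite Rabs_right; lra.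
    + unfold s. apply (Rmult_lt_reg_r (INR d + 1)); [lra|]. field_simplify; [|lra]. nra.
  - intros p. simpl. assert (B := chi_bounds (half_open_cube c s p)). lra.
Qed.

Lemma rball_bounded {d} r : Defs.bounded (@rball d r).
Proof. exists r. auto. Qed.

Lemma rball_interior {d} r : 0 < r -> nonempty_interior (@rball d r).
Proof.
  intros Hr. exists (fun _ => 0), r. split; auto. intros y Hy. unfold rball, edist in *.
  rewrite (enorm_ext y (fun j => y j - 0)) by (intros; ring). lra.
Qed.

Lemma rball_vol d : (1 <= d)%nat ->
  exists om, 0 < om /\ forall r, 0 < r -> is_vol (@rball d r) (om * r ^ d).
Proof.
  intros Hd. destruct (bounded_vol (@rball d 1) Hd (rball_bounded 1)) as [om Hom].
  exists om. split.
  - apply (interior_vol_pos (@rball d 1)); auto. apply rball_interior; lra.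
  - intros r Hr. assert (E : @rball d r = hom (fun _ => 0) r (rball 1)).
    { apply functional_extensionality. intros p. apply propositional_extensionality.
      split.
      - intros Hp. exists (fun j => / r * p j). split.
        + unfold rball in *. rewrite enorm_scal, Rabs_right by (left; apply Rinv_0_lt_compat; auto).
          apply (Rmult_le_reg_l r); auto. rewrite <- Rmult_assoc, Rinv_r by lra. lra.
        + intros j; field; lra.
      - intros (y & Hy & Hp). unfold rball in *. rewrite (enorm_ext p (fun j => r * y j)) by (intros; rewrite Hp; ring).
        rewrite enorm_scal, Rabs_right by lra. nra. }
    rewrite E, Rmult_comm. apply is_vol_hom; auto.
Qed.

(** * A tiling of space by cubes of growing size *)

Definition pt_eq_dec {d} (x y : pt d) : {x = y} + {x <> y} := excluded_middle_informative (x = y).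

Definition grid_corner {d} (T : nat) (s : R) (z : Fin.t d -> nat) : pt d :=
  fun j => (INR (z j) - INR T) * s.

Lemma nat_floor m x : 0 <= x < INR m -> exists k, (k < m)%nat /\ INR k <= x < INR k + 1.
Proof.
  induction m; intros H; [simpl in H; lra|]. rewrite S_INR in H.
  destruct (Rlt_dec x (INR m)).
  - destruct IHm as (k & Hk & Hx); [lra|]. exists k; split; auto; lia.
  - exists m. split; [lia|]. lra.
Qed.

Lemma nat_floor_unique k k' x : INR k <= x < INR k + 1 -> INR k' <= x < INR k' + 1 -> k = k'.
Proof.
  intros H H'. assert (INR k < INR (S k')) by (rewrite S_INR; lra).
  assert (INR k' < INR (S k)) by (rewrite S_INR; lra).
  apply INR_lt in H0. apply INR_lt in H1. lia.
Qed.

Lemma grid_cell_iff {d} T s (z : Fin.t d -> nat) j t : 0 < s ->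
  grid_corner T s z j <= t < grid_corner T s z j + s <->
  INR (z j) <= t / s + INR T < INR (z j) + 1.
Proof.
  intros Hs. unfold grid_corner.
  assert (E : t = t / s * s) by (field; lra).
  set (x := t / s) in *. rewrite E. split; intros [H1 H2]; split.
  - apply Rmult_le_reg_r in H1; auto; lra.
  - replace ((INR (z j) - INR T) * s + s) with ((INR (z j) - INR T + 1) * s) in H2 by ring.
    apply Rmult_lt_reg_r in H2; auto; lra.
  - apply Rmult_le_compat_r; lra.
  - replace ((INR (z j) - INR T) * s + s) with ((INR (z j) - INR T + 1) * s) by ring.
    apply Rmult_lt_compat_r; lra.
Qed.

Lemma grid_cell_exists {d} T s (p : pt d) : 0 < s -> (forall j, - (INR T * s) <= p j < INR T * s) ->
  exists z, (forall j, (z j < 2 * T)%nat) /\ half_open_cube (grid_corner T s z) s p.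
Proof.
  intros Hs Hp.
  destruct (choice (fun j k => (k < 2 * T)%nat /\ INR k <= p j / s + INR T < INR k + 1)) as [z Hz].
  { intros j. apply nat_floor. specialize (Hp j).
    rewrite mult_INR. simpl (INR 2).
    assert (E : p j = p j / s * s) by (field; lra). set (x := p j / s) in *.
    destruct Hp as [H1 H2]. rewrite E in H1, H2.
    apply Rmult_lt_reg_r in H2; auto. rewrite <- Ropp_mult_distr_l_reverse in H1.
    apply Rmult_le_reg_r in H1; auto. lra. }
  exists z. split; [apply Hz|]. intros j. apply grid_cell_iff; auto. apply Hz.
Qed.

Lemma grid_cell_unique {d} T s (z z' : Fin.t d -> nat) p : 0 < s ->
  half_open_cube (grid_corner T s z) s p -> half_open_cube (grid_corner T s z') s p -> z = z'.
Proof.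
  intros Hs H H'. apply functional_extensionality. intros j.
  apply (nat_floor_unique _ _ (p j / s + INR T)).
  - apply (grid_cell_iff T s z); auto.
  - apply (grid_cell_iff T s z'); auto.
Qed.

(* Tiles of side 2^n filling [-4^(n+1), 4^(n+1))^d minus [-4^n, 4^n)^d (nothing is removed
   when n = 0); the bounds are multiples of 2^n, hence the fit is exact. *)
Definition tile_corner {d} (n : nat) : (Fin.t d -> nat) -> pt d := grid_corner (2 ^ (n + 2)) (2 ^ n).

Definition shell_tiles (d n : nat) : list (pt d) :=
  nodup pt_eq_dec
    (cfilter (fun q => n = O \/ ~ (forall j, - 4 ^ n <= q j < 4 ^ n))
       (map (tile_corner n) (ngrid d (2 * 2 ^ (n + 2))))).

Lemma in_shell_tiles d n q : In q (shell_tiles d n) <->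
  (exists z, (forall j, (z j < 2 * 2 ^ (n + 2))%nat) /\ q = tile_corner n z) /\
  (n = O \/ ~ (forall j, - 4 ^ n <= q j < 4 ^ n)).
Proof.
  unfold shell_tiles. rewrite nodup_In, in_cfilter, in_map_iff. split.
  - intros [(z & <- & Hz) H]. split; auto. exists z; split; auto. apply ngrid_in; auto.
  - intros [(z & Hz & ->) H]. split; auto. exists z; split; auto. apply in_ngrid; auto.
Qed.

Lemma four_pow n : 4 ^ n = 2 ^ n * 2 ^ n.
Proof. rewrite <- Rpow_mult_distr. f_equal; lra. Qed.

Lemma four_pow_S_tile n : 4 ^ (S n) = INR (2 ^ (n + 2)) * 2 ^ n.
Proof. rewrite pow_INR, pow_add. change (INR 2) with 2.
  change (4 ^ S n) with (4 * 4 ^ n). rewrite four_pow. ring. Qed.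

Lemma four_pow_tile n : 4 ^ n = INR (2 ^ n) * 2 ^ n.
Proof. rewrite pow_INR, four_pow. change (INR 2) with 2. ring. Qed.

(** [n] is the least level whose outer cube contains [p]. The grid cell of [p] has not been removed:
    a cell with its corner in the inner cube lies entirely in that cube, and then a smaller level
    would do. *)
Lemma shell_tiles_cover {d} (p : pt d) : exists n q, In q (shell_tiles d n) /\ cube q (2 ^ n) p.
Proof.
  assert (Hex : exists n, forall j, - 4 ^ (S n) <= p j < 4 ^ (S n)).
  { destruct (Pow_x_infinity 4) with (b := enorm p + 1) as [N HN]; [rewrite Rabs_right; lra|].
    exists N. intros j. specialize (HN (S N) ltac:(lia)).
    rewrite Rabs_right in HN by (apply Rle_ge, pow_le; lra).
    assert (C := coord_le_enorm p j). apply Rabs_le_inv in C. lra. }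
  destruct (nat_least _ Hex) as (n & Hn & Hmin).
  exists n.
  assert (Hs : 0 < 2 ^ n) by (apply pow_lt; lra).
  destruct (grid_cell_exists (2 ^ (n + 2)) (2 ^ n) p Hs) as (z & Hz & Hq).
  { intros j. rewrite <- four_pow_S_tile. apply Hn. }
  change (half_open_cube (tile_corner n z) (2 ^ n) p) in Hq.
  exists (tile_corner n z). split.
  - apply in_shell_tiles. split; [exists z; split; auto|].
    destruct n as [|n]; auto. right. intros Hc.
    assert (S n <= n)%nat; [|lia]. apply Hmin. intros j. specialize (Hc j). specialize (Hq j).
    split; [lra|]. apply Rnot_le_lt. intros Hge.
    unfold tile_corner, grid_corner in Hc, Hq. rewrite four_pow_tile in Hc, Hge.
    destruct Hc as [_ Hc]. apply Rmult_lt_reg_r in Hc; auto.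
    (* Corner and bound are multiples of the side, so a strict inequality between them leaves room
       for one whole side. *)
    assert (Hc' : INR (z j) < INR (2 ^ S n + 2 ^ (S n + 2))) by (rewrite plus_INR; lra).
    apply INR_lt in Hc'.
    assert (Hc2 : INR (z j) + 1 <= INR (2 ^ S n + 2 ^ (S n + 2))) by (rewrite <- S_INR; apply le_INR; lia).
    rewrite plus_INR in Hc2.
    assert ((INR (z j) - INR (2 ^ (S n + 2)) + 1) * 2 ^ S n <= INR (2 ^ S n) * 2 ^ S n)
      by (apply Rmult_le_compat_r; lra). lra.
  - intros j. specialize (Hq j). lra.
Qed.

Lemma shell_tile_range d n q p : In q (shell_tiles d n) -> half_open_cube q (2 ^ n) p ->
  forall j, - 4 ^ (S n) <= p j < 4 ^ (S n).
Proof.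
  intros Hq Hp j. apply in_shell_tiles in Hq. destruct Hq as [(z & Hz & ->) _].
  specialize (Hp j). specialize (Hz j). unfold tile_corner, grid_corner in Hp. rewrite four_pow_S_tile.
  assert (Hs : 0 < 2 ^ n) by (apply pow_lt; lra). assert (H0 := pos_INR (z j)).
  assert (H1 : INR (z j) + 1 <= 2 * INR (2 ^ (n + 2))).
  { rewrite <- S_INR. change 2 with (INR 2) at 1. rewrite <- mult_INR. apply le_INR. lia. }
  split; nra.
Qed.

(** The corner violates one of the bounds of the inner cube. If it is the lower one, the whole tile
    lies below it, again because all bounds are multiples of the side. *)
Lemma shell_tile_outside d n q : In q (shell_tiles d (S n)) ->
  exists j, 4 ^ (S n) <= q j \/ q j + 2 ^ (S n) <= - 4 ^ (S n).
Proof.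
  intros Hq. apply in_shell_tiles in Hq. destruct Hq as [(z & Hz & ->) [H|H]]; [lia|].
  apply not_all_ex_not in H. destruct H as [j Hj]. exists j.
  assert (Hs : 0 < 2 ^ S n) by (apply pow_lt; lra).
  destruct (Rle_dec (4 ^ S n) (tile_corner (S n) z j)) as [H|H]; auto. right.
  assert (H' : tile_corner (S n) z j < - 4 ^ S n) by (apply Rnot_le_lt; intros K; apply Hj; lra).
  unfold tile_corner, grid_corner in *. rewrite four_pow_tile in *.
  rewrite <- Ropp_mult_distr_l_reverse in *. apply Rmult_lt_reg_r in H'; auto.
  assert (Hc' : INR (z j + 2 ^ S n) < INR (2 ^ (S n + 2))) by (rewrite plus_INR; lra).
  apply INR_lt in Hc'.
  assert (Hc2 : INR (z j + 2 ^ S n) + 1 <= INR (2 ^ (S n + 2))) by (rewrite <- S_INR; apply le_INR; lia).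
  rewrite plus_INR in Hc2.
  assert ((INR (z j) - INR (2 ^ (S n + 2)) + 1) * 2 ^ S n <= - INR (2 ^ S n) * 2 ^ S n)
      by (apply Rmult_le_compat_r; lra). lra.
Qed.

Lemma shell_tile_far d n q p : In q (shell_tiles d (S n)) -> cube q (2 ^ S n) p -> 4 ^ (S n) <= enorm p.
Proof.
  intros Hq Hp. destruct (shell_tile_outside d n q Hq) as [j Hj]. specialize (Hp j).
  eapply Rle_trans; [|apply (coord_le_enorm p j)].
  assert (0 < 4 ^ S n) by (apply pow_lt; lra). cbv beta in Hp.
  unfold Rabs; destruct Rcase_abs; lra.
Qed.

Fixpoint tiles (d n : nat) : list (nat * pt d) :=
  match n with
  | O => nil
  | S m => tiles d m ++ map (pair m) (shell_tiles d m)
  end.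

Lemma in_tiles d n k q : In (k, q) (tiles d n) <-> (k < n)%nat /\ In q (shell_tiles d k).
Proof.
  induction n; simpl; [split; [tauto|lia]|].
  rewrite in_app_iff, IHn, in_map_iff. split.
  - intros [[? ?]|(q' & E & Hq')]; [split; auto; lia|]. injection E as <- <-. split; auto.
  - intros [H1 H2]. destruct (Nat.eq_dec k n) as [->|]; [right; exists q; auto|left; split; auto; lia].
Qed.

Lemma NoDup_tiles d n : NoDup (tiles d n).
Proof.
  induction n; simpl; [constructor|]. apply NoDup_app; auto.
  - apply NoDup_map_NoDup_ForallPairs; [|apply NoDup_nodup]. intros x y E; congruence.
  - intros [k q] H H'. apply in_tiles in H. apply in_map_iff in H'. destruct H' as (? & E & _).
    injection E as <- <-. lia.
Qed.

(** Tiles of a lower level lie in the cube that all higher levels avoid; tiles of one level are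
    cells of a single grid. *)
Lemma tiles_disjoint d k k' q q' p :
  In q (shell_tiles d k) -> In q' (shell_tiles d k') ->
  half_open_cube q (2 ^ k) p -> half_open_cube q' (2 ^ k') p -> (k, q) = (k', q').
Proof.
  assert (W : forall k k' q q', In q (shell_tiles d k) -> In q' (shell_tiles d k') ->
     half_open_cube q (2 ^ k) p -> half_open_cube q' (2 ^ k') p -> ~ (k < k')%nat).
  { clear. intros k k' q q' Hq Hq' Hp Hp' Hk. destruct k' as [|k']; [lia|].
    destruct (shell_tile_outside d k' q' Hq') as [j Hj].
    assert (B := shell_tile_range d k q p Hq Hp j). specialize (Hp' j).
    assert (4 ^ S k <= 4 ^ S k') by (apply Rle_pow; [lra|lia]). lra. }
  intros Hq Hq' Hp Hp'.
  assert (k = k').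
  { assert (A := W k k' q q' Hq Hq' Hp Hp'). assert (B := W k' k q' q Hq' Hq Hp' Hp). lia. }
  subst k'. f_equal. apply in_shell_tiles in Hq, Hq'.
  destruct Hq as [(z & Hz & ->) _]. destruct Hq' as [(z' & Hz' & ->) _].
  f_equal. apply (grid_cell_unique (2 ^ (k + 2)) (2 ^ k) z z' p); auto. apply pow_lt; lra.
Qed.

Definition meets_ball {d} (r : R) (kq : nat * pt d) : Prop :=
  exists p, cube (snd kq) (2 ^ fst kq) p /\ rball r p.

(** A tile of level k >= 1 meeting the ball has 4^k <= r, hence side at most sqrt r; at level 0 the
    side is 1 <= sqrt r. So all these tiles are disjoint subsets of the slightly larger ball. *)
Lemma tiles_volume d n r V : 1 <= r -> is_vol (@rball d (r + INR d * sqrt r)) V ->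
  lsum (fun kq => chi (meets_ball r kq) * (2 ^ fst kq) ^ d) (tiles d n) <= V.
Proof.
  intros Hr HV. rewrite <- lsum_cfilter.
  pose (Q := map (fun kq : nat * pt d => (snd kq, 2 ^ fst kq)) (cfilter (meets_ball r) (tiles d n))).
  replace (lsum _ _) with (lsum (fun q => snd q ^ d) Q) by (unfold Q; rewrite lsum_map; auto).
  apply (is_vol_ge_cubes (@rball d (r + INR d * sqrt r))); auto.
  - intros q Hq. apply in_map_iff in Hq. destruct Hq as (kq & <- & _). apply pow_lt; lra.
  - intros q p Hq Hp. apply in_map_iff in Hq. destruct Hq as ([k q'] & <- & Hq). simpl in Hp.
    apply in_cfilter in Hq. destruct Hq as [Hq (p' & Hp' & Hr')]. simpl in Hp'.
    apply in_tiles in Hq. destruct Hq as [_ Hq]. unfold rball in *.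
    assert (Hs : 0 < 2 ^ k) by (apply pow_lt; lra).
    assert (Hk : 2 ^ k <= sqrt r).
    { rewrite <- (sqrt_square (2 ^ k)) by lra. apply sqrt_le_1_alt. destruct k.
      - simpl; lra.
      - rewrite <- four_pow. assert (F := shell_tile_far d k q' p' Hq Hp'). lra. }
    eapply Rle_trans; [apply (enorm_edist p p')|]. apply Rplus_le_compat; auto.
    apply Rle_trans with (INR d * 2 ^ k).
    + apply enorm_le_coord; [lra|]. intros j. specialize (Hp j). specialize (Hp' j).
      unfold Rabs; destruct Rcase_abs; lra.
    + apply Rmult_le_compat_l; auto. apply pos_INR.
  - intros p. unfold Q. rewrite lsum_map.
    apply (lsum_chi_unique (fun a : nat * pt d => half_open_cube (snd a) (2 ^ fst a) p)).
    + apply NoDup_cfilter, NoDup_tiles.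
    + intros [k q] [k' q'] H H' Hp Hp'. apply in_cfilter in H, H'.
      destruct H as [H _], H' as [H' _]. apply in_tiles in H, H'.
      apply (tiles_disjoint d k k' q q' p); tauto.
Qed.

Lemma tiles_volume_head d n n0 (f : nat * pt d -> R) : (forall a, 0 <= f a) ->
  lsum (fun kq => chi (fst kq < n0)%nat * f kq) (tiles d n) <= lsum f (tiles d n0).
Proof.
  intros Hf. rewrite <- lsum_cfilter. apply lsum_incl; auto.
  - apply NoDup_cfilter, NoDup_tiles.
  - intros [k q] H. apply in_cfilter in H. destruct H as [H1 H2]. apply in_tiles in H1.
    apply in_tiles. simpl in H2. tauto.
Qed.

(** * Covering space by finite batches of homothets *)

(** Batches record pairs of an index and a position. Consecutive index ranges keep different batches
    from sharing a body, and [functional] keeps one batch from using a body in two positions. *)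
Definition in_range {A} (N N' : nat) (l : list (nat * A)) : Prop :=
  forall i x, In (i, x) l -> (N <= i < N')%nat.
Definition functional {A} (l : list (nat * A)) : Prop :=
  forall i x x', In (i, x) l -> In (i, x') l -> x = x'.

Lemma functional_app {A} N N1 N' (l l' : list (nat * A)) :
  in_range N N1 l -> in_range N1 N' l' -> functional l -> functional l' -> functional (l ++ l').
Proof.
  intros H1 H2 F1 F2 i x x'. rewrite !in_app_iff. intros [H|H] [H'|H']; eauto.
  - apply H1 in H. apply H2 in H'. lia.
  - apply H2 in H. apply H1 in H'. lia.
Qed.

Lemma in_range_app {A} N N1 N' (l l' : list (nat * A)) : (N <= N1 <= N')%nat ->
  in_range N N1 l -> in_range N1 N' l' -> in_range N N' (l ++ l').
Proof.
  intros L H1 H2 i x. rewrite in_app_iff. intros [H|H]; [apply H1 in H|apply H2 in H]; lia.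
Qed.

(* [A] can be covered, within total volume [W], by translates of finitely many of the
   bodies [lam i * K] with [N <= i]; an entry [(i, x)] of the list is the body [x + lam i * K],
   and [kap] stands for the volume of [K]. *)
Definition batch_cover {d} (K : rset d) (lam : nat -> R) (kap : R) (N : nat) (A : rset d) (W : R) : Prop :=
  exists N' l, (N <= N')%nat /\ in_range N N' l /\ functional l /\
    (forall p, A p -> exists i x, In (i, x) l /\ hom x (lam i) K p) /\
    kap * lsum (fun q => lam (fst q) ^ d) l <= W.

Definition origin {d} : pt d := fun _ => 0.

Lemma batch_cover_subset {d} (K : rset d) lam kap N A B W W' : subset A B -> W <= W' ->
  batch_cover K lam kap N B W -> batch_cover K lam kap N A W'.
Proof.
  intros H HW (N' & l & H1 & H2 & H3 & H4 & H5). exists N', l. repeat split; auto; try apply H2 in H0; try lia; try lra.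
  all: try (apply (H2 _ _ H0)).
Qed.

Lemma batch_cover_translate {d} (K : rset d) lam kap N a s W :
  batch_cover K lam kap N (cube origin s) W -> batch_cover K lam kap N (cube a s) W.
Proof.
  intros (N' & l & H1 & H2 & H3 & H4 & H5).
  pose (f := fun q : nat * pt d => (fst q, fun j => a j + snd q j)).
  exists N', (map f l). split; [auto|]. split; [|split; [|split]].
  - intros i x Hi. apply in_map_iff in Hi. destruct Hi as ([i' x'] & E & Hi).
    injection E as <- <-. eauto.
  - intros i x x' Hi Hi'. apply in_map_iff in Hi, Hi'. destruct Hi as ([i1 x1] & E1 & Hi1).
    destruct Hi' as ([i2 x2] & E2 & Hi2). injection E1 as <- <-. injection E2 as E <-.
    simpl in *. subst. f_equal. rewrite (H3 _ _ _ Hi1 Hi2); auto.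
  - intros p Hp. destruct (H4 (fun j => p j - a j)) as (i & x & Hi & (y & Hy & E)).
    + intros j. specialize (Hp j). unfold origin. lra.
    + exists i, (fun j => a j + x j). split.
      * apply in_map_iff. exists (i, x); auto.
      * exists y. split; auto. intros j. specialize (E j). lra.
  - rewrite lsum_map. exact H5.
Qed.

(** The estimate concerns only bodies inside the ball of radius [r], for all [r] at once. Bodies
    that miss their cube are discarded; after that a body inside the ball forces its cube to meet
    the ball, and the cube pays for it. *)
Lemma stage_cover {d} (K : rset d) lam kap s W :
  (forall i, 0 < lam i) -> 0 <= kap -> 0 <= W ->
  (forall N, batch_cover K lam kap N (cube origin s) W) ->
  forall (Z : list (pt d)) N, exists N' l, (N <= N')%nat /\ in_range N N' l /\ functional l /\
    (forall q p, In q Z -> cube q s p -> exists i x, In (i, x) l /\ hom x (lam i) K p) /\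
    forall r, kap * lsum (fun q => chi (subset (hom (snd q) (lam (fst q)) K) (rball r)) * lam (fst q) ^ d) l
              <= lsum (fun q => chi (exists p, cube q s p /\ rball r p) * W) Z.
Proof.
  intros Hlam Hkap HW H. induction Z as [|q Z IH]; intros N.
  - exists N, nil. split; [lia|]. split; [intros i x []|]. split; [intros i x x' []|].
    split; [intros q p []|]. intros r; simpl; lra.
  - destruct (batch_cover_translate K lam kap N q s W (H N)) as (N1 & l1 & A1 & A2 & A3 & A4 & A5).
    pose (l1' := cfilter (fun ix : nat * pt d => exists p, cube q s p /\ hom (snd ix) (lam (fst ix)) K p) l1).
    assert (S1 : forall ix, In ix l1' -> In ix l1) by (intros ix Hix; apply in_cfilter in Hix; tauto).
    destruct (IH N1) as (N' & l2 & B1 & B2 & B3 & B4 & B5).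
    exists N', (l1' ++ l2). split; [lia|].
    assert (R1 : in_range N N1 l1') by (intros i x Hi; apply S1 in Hi; eauto).
    split; [apply (in_range_app N N1 N'); auto|].
    split; [apply (functional_app N N1 N'); auto; intros i x x' Hi Hi'; apply S1 in Hi, Hi'; eauto|].
    split.
    + intros q' p [<-|Hq'] Hp.
      * destruct (A4 p Hp) as (i & x & Hi & Hx). exists i, x. split; auto.
        apply in_app_iff. left. apply in_cfilter. split; auto. exists p; auto.
      * destruct (B4 q' p Hq' Hp) as (i & x & Hi & Hx). exists i, x. split; auto.
        apply in_app_iff; auto.
    + intros r. rewrite lsum_app, Rmult_plus_distr_l. simpl lsum. apply Rplus_le_compat; [|apply B5].
      destruct (classic (exists p, cube q s p /\ rball r p)) as [Hm|Hm].
      * rewrite (chi_true _ Hm), Rmult_1_l. eapply Rle_trans; [|apply A5].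
        apply Rmult_le_compat_l; auto. unfold l1'. rewrite lsum_cfilter. apply lsum_le.
        intros [i x] _. simpl. assert (0 < lam i ^ d) by (apply pow_lt; auto).
        assert (C1 := chi_bounds (exists p, cube q s p /\ hom x (lam i) K p)).
        assert (C2 := chi_bounds (subset (hom x (lam i) K) (rball r))).
        set (c1 := chi _) in *. set (c2 := chi (subset _ _)) in *. set (L := lam i ^ d) in *.
        assert (0 <= c2 * L <= L) by nra. nra.
      * rewrite (chi_false _ Hm), Rmult_0_l.
        rewrite (lsum_ext _ (fun _ => 0)); [rewrite lsum_const; lra|].
        intros [i x] Hi. apply in_cfilter in Hi. simpl in *. destruct Hi as [_ (p & Hp & Hpx)].
        rewrite chi_false; [ring|]. intros Hs. apply Hm. exists p; split; auto.
Qed.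

(** Divergence expressed on every tail, because each batch starts beyond the indices already
    spent. *)
Definition diverges (f : nat -> R) : Prop :=
  forall N B, exists N', (N <= N')%nat /\ B <= lsum f (seq N (N' - N)).

Lemma cv_infty_diverges f : cv_infty (fun n => sum_f_R0 f n) -> diverges f.
Proof.
  intros H N B. destruct (H (B + lsum f (seq 0 N))) as [n Hn].
  exists (S n + N)%nat. split; [lia|]. specialize (Hn (n + N)%nat ltac:(lia)).
  rewrite sum_f_R0_lsum in Hn. replace (S (n + N)) with (N + S n)%nat in Hn by lia.
  rewrite seq_app, lsum_app in Hn. replace (S n + N - N)%nat with (S n) by lia.
  simpl (0 + N)%nat in Hn. lra.
Qed.

Lemma base_cover {d} (K : rset d) lam kap th (e : nat -> R) :
  (1 <= d)%nat -> (forall i, 0 < lam i) -> 0 <= kap -> 0 <= th ->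
  diverges (fun i => lam i ^ d) ->
  (forall n, 0 <= e n) -> Un_cv e 0 ->
  (forall n N, batch_cover K lam kap N (cube origin (2 ^ n)) ((th + e n) * (2 ^ n) ^ d)) ->
  exists (used : nat -> Prop) (x : nat -> pt d),
    (forall p, exists i, used i /\ hom (x i) (lam i) K p) /\
    diverges (fun i => chi (~ used i) * lam i ^ d) /\
    (forall eps, 0 < eps -> exists C, forall r V, 1 <= r -> is_vol (@rball d (r + INR d * sqrt r)) V ->
       forall m, kap * lsum (fun i => chi (used i /\ subset (hom (x i) (lam i) K) (rball r)) * lam i ^ d) (seq 0 m)
                 <= C + (th + eps) * V).
Proof.
  intros Hd Hlam Hkap Hth Hdiv He He0 Hcov.
  assert (Hw : forall n, 0 <= (th + e n) * (2 ^ n) ^ d).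
  { intros n. apply Rmult_le_pos; [specialize (He n); lra|]. apply pow_le, pow_le; lra. }
  assert (Hp : forall i, 0 < lam i ^ d) by (intros; apply pow_lt; auto).
  pose (stage_spec := fun n N (st : nat * list (nat * pt d)) =>
     (N <= fst st)%nat /\ in_range N (fst st) (snd st) /\ functional (snd st) /\
     (forall q p, In q (shell_tiles d n) -> cube q (2 ^ n) p -> exists i x, In (i, x) (snd st) /\ hom x (lam i) K p) /\
     (forall r, kap * lsum (fun q => chi (subset (hom (snd q) (lam (fst q)) K) (rball r)) * lam (fst q) ^ d) (snd st)
              <= lsum (fun q => chi (exists p, cube q (2 ^ n) p /\ rball r p) * ((th + e n) * (2 ^ n) ^ d)) (shell_tiles d n)) /\
     1 <= lsum (fun i => chi (~ exists x, In (i, x) (snd st)) * lam i ^ d) (seq N (fst st - N))).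
  assert (Hstage : forall n N, exists st, stage_spec n N st).
  { intros n N. destruct (stage_cover K lam kap (2 ^ n) ((th + e n) * (2 ^ n) ^ d) Hlam Hkap (Hw n) (Hcov n) (shell_tiles d n) N)
      as (N1 & l & H1 & H2 & H3 & H4 & H5).
    destruct (Hdiv N1 1) as (N2 & HN2 & Hgap). exists (N2, l). unfold stage_spec. simpl. split; [lia|]. split; [|split; [|split; [|split]]]; auto.
    - intros i x Hi. apply H2 in Hi. lia.
    - replace (N2 - N)%nat with ((N1 - N) + (N2 - N1))%nat by lia.
      rewrite seq_app, lsum_app. replace (N + (N1 - N))%nat with N1 by lia.
      assert (0 <= lsum (fun i => chi (~ exists x, In (i, x) l) * lam i ^ d) (seq N (N1 - N))).
      { apply lsum_nonneg. intros i _. apply Rmult_le_pos; [apply chi_bounds|apply Rlt_le, Hp]. }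
      assert (E : lsum (fun i => chi (~ exists x, In (i, x) l) * lam i ^ d) (seq N1 (N2 - N1))
        = lsum (fun i => lam i ^ d) (seq N1 (N2 - N1))).
      { apply lsum_ext. intros i Hi. rewrite chi_true; [ring|]. intros [x Hx]. apply H2 in Hx.
        apply in_seq in Hi. lia. }
      rewrite E. lra. }
  destruct (choice2 _ Hstage) as [F HF0]. clear Hstage Hcov.
  pose (start := fix start n := match n with O => O | S m => fst (F m (start m)) end).
  pose (batch := fun n => snd (F n (start n))).
  assert (HF : forall n, stage_spec n (start n) (start (S n), batch n)).
  { intros n. unfold batch. simpl. rewrite <- surjective_pairing. apply HF0. }
  clearbody batch. clearbody start. clear F HF0.
  unfold stage_spec in HF. simpl fst in HF. simpl snd in HF.
  assert (Hmono : forall n m, (n <= m)%nat -> (start n <= start m)%nat).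
  { intros n m L. induction L; auto. destruct (HF m) as [A _]. lia. }
  assert (Huniq : forall n m i x y, In (i, x) (batch n) -> In (i, y) (batch m) -> n = m).
  { intros n m i x y Hx Hy. destruct (HF n) as (_ & A & _). destruct (HF m) as (_ & B & _).
    apply A in Hx. apply B in Hy. destruct (Nat.lt_trichotomy n m) as [L|[L|L]]; auto.
    - specialize (Hmono (S n) m L). lia.
    - specialize (Hmono (S m) n L). lia. }
  pose (placed := fun i (x : pt d) => exists n, In (i, x) (batch n)).
  assert (Hplaced : forall i x y, placed i x -> placed i y -> x = y).
  { intros i x y [n Hx] [m Hy]. assert (n = m) by eauto. subst m.
    destruct (HF n) as (_ & _ & A & _). eauto. }
  pose (used := fun i => exists x, placed i x).
  pose (pos := fun i => epsilon (inhabits (@origin d)) (placed i)).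
  assert (Hpos : forall i x, placed i x -> pos i = x).
  { intros i x Hx. apply (Hplaced i); auto. apply epsilon_spec. exists x; auto. }
  assert (Hgap : forall n, lsum (fun i => chi (~ used i) * lam i ^ d) (seq (start n) (start (S n) - start n)) >= 1).
  { intros n. destruct (HF n) as (A1 & A2 & _ & _ & _ & A6). rewrite (lsum_ext _ (fun i => chi (~ exists x, In (i, x) (batch n)) * lam i ^ d)); [lra|].
    intros i Hi. apply in_seq in Hi. f_equal. apply chi_iff.
    split; intros H H'; apply H.
    - destruct H' as [x Hx]. exists x. exists n; auto.
    - destruct H' as [x [m Hx]]. exists x. replace n with m; auto.
      destruct (HF m) as (_ & B & _). apply B in Hx.
      destruct (Nat.lt_trichotomy n m) as [L|[L|L]]; [|congruence|].
      + specialize (Hmono (S n) m L). lia.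
      + specialize (Hmono (S m) n L). lia. }
  assert (Hgap' : forall n k, INR k <= lsum (fun i => chi (~ used i) * lam i ^ d) (seq (start n) (start (n + k)%nat - start n))).
  { intros n k. induction k.
    - simpl. apply lsum_nonneg. intros i _. apply Rmult_le_pos; [apply chi_bounds|apply Rlt_le, Hp].
    - assert (L1 := Hmono n (n + k)%nat ltac:(lia)). assert (L2 := Hmono (n + k)%nat (n + S k)%nat ltac:(lia)).
      replace (start (n + S k)%nat - start n)%nat with ((start (n + k)%nat - start n) + (start (n + S k)%nat - start (n + k)%nat))%nat by lia.
      rewrite seq_app, lsum_app, S_INR. replace (start n + (start (n + k)%nat - start n))%nat with (start (n + k)%nat) by lia.
      specialize (Hgap (n + k)%nat). replace (S (n + k)) with (n + S k)%nat in Hgap by lia. lra. }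
  assert (Hstart : forall n, (n <= start n)%nat).
  { assert (Hs : forall n, (start n < start (S n))%nat).
    { intros n. destruct (HF n) as (A & _). destruct (Nat.eq_dec (start n) (start (S n))) as [E|]; [|lia].
      specialize (Hgap n). rewrite E, Nat.sub_diag in Hgap. simpl in Hgap. lra. }
    induction n; [lia|]. specialize (Hs n). lia. }
  exists used, pos. split; [|split].
  - intros p. destruct (shell_tiles_cover p) as (n & q & Hq & Hqp).
    destruct (HF n) as (_ & _ & _ & A & _). destruct (A q p Hq Hqp) as (i & x & Hi & Hx).
    exists i. assert (placed i x) by (exists n; auto). split; [exists x; auto|]. rewrite (Hpos i x); auto.
  - intros N B. destruct (INR_archimed 1 B) as [k Hk]; [lra|].
    exists (start (N + k)%nat). assert (L1 := Hstart N). assert (L2 := Hmono N (N + k)%nat ltac:(lia)).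
    split; [lia|]. specialize (Hgap' N k).
    replace (start (N + k)%nat - N)%nat with ((start N - N) + (start (N + k)%nat - start N))%nat by lia.
    rewrite seq_app, lsum_app. replace (N + (start N - N))%nat with (start N) by lia.
    assert (0 <= lsum (fun i => chi (~ used i) * lam i ^ d) (seq N (start N - N))).
    { apply lsum_nonneg. intros i _. apply Rmult_le_pos; [apply chi_bounds|apply Rlt_le, Hp]. }
    lra.
  - intros eps Heps. destruct (He0 eps Heps) as [n0 Hn0].
    (* This constant absorbs the excess on the finitely many levels below [n0], where [e] may be
       larger than [eps]; it does not depend on [r]. *)
    exists (lsum (fun kq => e (fst kq) * (2 ^ fst kq) ^ d) (tiles d n0)).
    intros r V Hr HV m.
    pose (w := fun q : nat * pt d => chi (subset (hom (snd q) (lam (fst q)) K) (rball r)) * lam (fst q) ^ d).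
    assert (Hw0 : forall q, 0 <= w q).
    { intros q. apply Rmult_le_pos; [apply chi_bounds|apply Rlt_le, Hp]. }
    pose (all := fun n => flat_map batch (seq 0 n)).
    assert (S1 : lsum (fun i => chi (used i /\ subset (hom (pos i) (lam i) K) (rball r)) * lam i ^ d) (seq 0 m)
       <= lsum w (all m)).
    { rewrite (lsum_ext _ (fun i => chi (used i) * w (i, pos i))).
      2:{ intros i _. unfold w; simpl. rewrite <- Rmult_assoc. f_equal.
          destruct (classic (used i)) as [U|U].
          - rewrite (chi_true (used i)), Rmult_1_l by auto. apply chi_iff. tauto.
          - rewrite (chi_false (used i)), Rmult_0_l by auto. rewrite chi_false; [auto|tauto]. }
      rewrite <- lsum_cfilter, <- (lsum_map w (fun i => (i, pos i))). apply lsum_incl; auto.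
      - apply NoDup_map_NoDup_ForallPairs; [|apply NoDup_cfilter, seq_NoDup]. intros a b _ _ E; congruence.
      - intros q Hq. apply in_map_iff in Hq. destruct Hq as (i & <- & Hi). apply in_cfilter in Hi.
        destruct Hi as [Hi [x [n Hx]]]. apply in_flat_map. exists n.
        destruct (HF n) as (_ & A & _). assert (A' := A _ _ Hx). assert (L := Hstart n).
        apply in_seq in Hi. split; [apply in_seq; lia|]. rewrite (Hpos i x); auto. exists n; auto. }
    assert (S2 : forall n, kap * lsum w (all n) <= lsum (fun kq => chi (meets_ball r kq) * ((th + e (fst kq)) * (2 ^ fst kq) ^ d)) (tiles d n)).
    { induction n; [simpl; lra|]. unfold all. rewrite seq_S, flat_map_app, lsum_app, Rmult_plus_distr_l.
      simpl tiles. rewrite lsum_app. apply Rplus_le_compat; auto. simpl. rewrite app_nil_r, lsum_map.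
      destruct (HF n) as (_ & _ & _ & _ & A & _). apply A. }
    eapply Rle_trans; [apply Rmult_le_compat_l; [auto|apply S1]|]. eapply Rle_trans; [apply S2|].
    apply Rle_trans with (lsum (fun kq => chi (fst kq < n0)%nat * (e (fst kq) * (2 ^ fst kq) ^ d) + (th + eps) * (chi (meets_ball r kq) * (2 ^ fst kq) ^ d)) (tiles d m)).
    + apply lsum_le. intros [k q] _. simpl.
      assert (C := chi_bounds (meets_ball r (k, q))). set (c := chi (meets_ball r (k, q))) in *.
      assert (P : 0 < (2 ^ k) ^ d) by (apply pow_lt, pow_lt; lra). set (P0 := (2 ^ k) ^ d) in *.
      specialize (He k). assert (0 <= c * P0 <= P0) by nra.
      destruct (Nat.lt_ge_cases k n0) as [L|L].
      * rewrite chi_true by auto.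
        assert (e k * (c * P0) <= e k * P0) by (apply Rmult_le_compat_l; lra).
        assert (0 <= eps * (c * P0)) by (apply Rmult_le_pos; lra). nra.
      * rewrite chi_false by lia. specialize (Hn0 k L). unfold Rdist in Hn0. apply Rabs_def2 in Hn0.
        assert (e k * (c * P0) <= eps * (c * P0)) by (apply Rmult_le_compat_r; lra). nra.
    + rewrite lsum_plus, lsum_scal. apply Rplus_le_compat.
      * apply tiles_volume_head. intros [k q]. apply Rmult_le_pos; [apply He|]. apply pow_le, pow_le; simpl; lra.
      * apply Rmult_le_compat_l; [lra|]. apply (tiles_volume d m r V); auto.
Qed.

(** * Limits at infinity *)

Definition tends (f : R -> R) (l : R) : Prop :=
  forall eps, 0 < eps -> exists R0, forall r, R0 <= r -> Rabs (f r - l) <= eps.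

Lemma tends_const c : tends (fun _ => c) c.
Proof. intros eps He. exists 0. intros r _. rewrite Rminus_diag, Rabs_R0; lra. Qed.

Lemma tends_eq f a b : tends f a -> a = b -> tends f b.
Proof. intros H <-; auto. Qed.

Lemma tends_plus f g a b : tends f a -> tends g b -> tends (fun r => f r + g r) (a + b).
Proof.
  intros Hf Hg eps He. destruct (Hf (eps / 2)) as [R1 H1]; [lra|]. destruct (Hg (eps / 2)) as [R2 H2]; [lra|].
  exists (Rmax R1 R2). intros r Hr.
  specialize (H1 r (Rle_trans _ _ _ (Rmax_l R1 R2) Hr)). specialize (H2 r (Rle_trans _ _ _ (Rmax_r R1 R2) Hr)).
  replace (f r + g r - (a + b)) with ((f r - a) + (g r - b)) by ring.
  eapply Rle_trans; [apply Rabs_triang|lra].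
Qed.

Lemma tends_mult f g a b : tends f a -> tends g b -> tends (fun r => f r * g r) (a * b).
Proof.
  intros Hf Hg eps He. assert (Ha := Rabs_pos a). assert (Hb := Rabs_pos b).
  destruct (Hf (Rmin 1 (eps / (2 * (Rabs b + 1))))) as [R1 H1].
  { apply Rmin_glb_lt; [lra|apply Rdiv_lt_0_compat; lra]. }
  destruct (Hg (eps / (2 * (Rabs a + 1)))) as [R2 H2]; [apply Rdiv_lt_0_compat; lra|].
  exists (Rmax R1 R2). intros r Hr.
  specialize (H1 r (Rle_trans _ _ _ (Rmax_l R1 R2) Hr)). specialize (H2 r (Rle_trans _ _ _ (Rmax_r R1 R2) Hr)).
  assert (H3 := Rle_trans _ _ _ H1 (Rmin_l _ _)). assert (H4 := Rle_trans _ _ _ H1 (Rmin_r _ _)).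
  replace (f r * g r - a * b) with (f r * (g r - b) + (f r - a) * b) by ring.
  eapply Rle_trans; [apply Rabs_triang|]. rewrite !Rabs_mult.
  assert (Hfa : Rabs (f r) <= Rabs a + 1).
  { replace (f r) with (a + (f r - a)) by ring. eapply Rle_trans; [apply Rabs_triang|lra]. }
  assert (Rabs (f r) * Rabs (g r - b) <= eps / 2).
  { apply Rle_trans with ((Rabs a + 1) * (eps / (2 * (Rabs a + 1)))); [|right; field; lra].
    apply Rmult_le_compat; auto; apply Rabs_pos. }
  assert (Rabs (f r - a) * Rabs b <= eps / 2).
  { apply Rle_trans with ((eps / (2 * (Rabs b + 1))) * (Rabs b + 1)); [|right; field; lra].
    apply Rmult_le_compat; auto; try apply Rabs_pos; lra. }
  lra.
Qed.

Lemma tends_pow f a n : tends f a -> tends (fun r => f r ^ n) (a ^ n).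
Proof. intros H. induction n; simpl; [apply tends_const|]. apply tends_mult; auto. Qed.

Lemma tends_inv_inf f : (forall B, exists R0, forall r, R0 <= r -> B <= f r) -> tends (fun r => / f r) 0.
Proof.
  intros H eps He. destruct (H (/ eps)) as [R0 HR]. exists R0. intros r Hr. specialize (HR r Hr).
  assert (0 < / eps) by (apply Rinv_0_lt_compat; auto).
  rewrite Rminus_0_r, Rabs_right; [|apply Rle_ge, Rlt_le, Rinv_0_lt_compat; lra].
  rewrite <- (Rinv_inv eps). apply Rinv_le_contravar; auto.
Qed.

Lemma tends_ext f g l r0 : (forall r, r0 <= r -> f r = g r) -> tends f l -> tends g l.
Proof.
  intros H Hf eps He. destruct (Hf eps He) as [R0 H0]. exists (Rmax r0 R0). intros r Hr.
  rewrite <- H; [apply H0|]; eapply Rle_trans; try apply Hr; [apply Rmax_r|apply Rmax_l].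
Qed.

Lemma tends_inv_r : tends (fun r => / r) 0.
Proof. apply (tends_inv_inf (fun r => r)). intros B; exists B; auto. Qed.

Lemma tends_inv_sqrt : tends (fun r => / sqrt r) 0.
Proof.
  apply (tends_inv_inf sqrt). intros B. exists (B * B). intros r Hr.
  eapply Rle_trans; [|apply sqrt_le_1_alt, Hr]. replace (B * B) with (Rsqr B) by auto.
  rewrite sqrt_Rsqr_abs. apply Rle_abs.
Qed.

Lemma tends_ratio a d : tends (fun r => ((r + a) / r) ^ d) 1.
Proof.
  rewrite <- (pow1 d). apply tends_pow.
  apply (tends_ext (fun r => 1 + a * / r) _ _ 1).
  - intros r Hr. field; lra.
  - eapply tends_eq.
    + apply tends_plus; [apply tends_const|]. apply tends_mult; [apply tends_const|apply tends_inv_r].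
    + ring.
Qed.

Lemma pow_ge_self r d : 1 <= r -> (1 <= d)%nat -> r <= r ^ d.
Proof. intros Hr Hd. rewrite <- (pow_1 r) at 1. apply Rle_pow; auto. Qed.

Lemma tends_inv_vol om d : 0 < om -> (1 <= d)%nat -> tends (fun r => / (om * r ^ d)) 0.
Proof.
  intros Hom Hd. apply tends_inv_inf. intros B. exists (Rmax 1 (B / om)). intros r Hr.
  assert (H1 := Rle_trans _ _ _ (Rmax_l _ _) Hr). assert (H2 := Rle_trans _ _ _ (Rmax_r _ _) Hr).
  assert (H3 := pow_ge_self r d H1 Hd).
  replace B with (om * (B / om)) by (field; lra). apply Rmult_le_compat_l; lra.
Qed.

Lemma tends_le_eventually f l y : tends f l -> l < y -> exists R0, forall r, R0 <= r -> f r <= y.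
Proof.
  intros H Hl. destruct (H (y - l)) as [R0 H0]; [lra|]. exists R0. intros r Hr.
  specialize (H0 r Hr). apply Rabs_le_inv in H0. lra.
Qed.

Lemma tends_ge_eventually f l y : tends f l -> y < l -> exists R0, forall r, R0 <= r -> y <= f r.
Proof.
  intros H Hl. destruct (H (l - y)) as [R0 H0]; [lra|]. exists R0. intros r Hr.
  specialize (H0 r Hr). apply Rabs_le_inv in H0. lra.
Qed.

(** The limsup is the supremum of the values that [g] reaches or exceeds at arbitrarily large
    arguments; the eventual bound makes it finite. *)
Lemma limsup_exists (g : R -> R) (th : R) : (forall r, 0 <= g r) ->
  (forall eps, 0 < eps -> exists R0, forall r, R0 <= r -> g r <= th + eps) ->
  exists b, 0 <= b <= th /\ limsup_infty g b.
Proof.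
  intros H0 Hth.
  pose (E := fun y => forall R0, exists r, R0 <= r /\ y <= g r).
  assert (HE : forall y, E y -> y <= th).
  { intros y Hy. apply le_epsilon. intros eps He. destruct (Hth eps He) as [R0 HR].
    destruct (Hy R0) as (r & Hr & Hyr). specialize (HR r Hr). lra. }
  destruct (completeness E) as [b [Hb1 Hb2]].
  - exists th. exact HE.
  - exists 0. intros R0. exists R0. split; [lra|auto].
  - exists b. split; [split|split].
    + apply Hb1. intros R0. exists R0. split; [lra|auto].
    + apply Hb2. exact HE.
    + intros eps He. apply NNPP. intros Hn. assert (b + eps <= b); [|lra].
      apply Hb1. intros R0. apply NNPP. intros Hr. apply Hn. exists R0. intros r Hr'.
      apply Rnot_lt_le. intros Hlt. apply Hr. exists r. split; auto; lra.
    + intros eps He R0. apply NNPP. intros Hn. assert (b <= b - eps); [|lra].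
      apply Hb2. intros y Hy. destruct (Hy R0) as (r & Hr & Hyr).
      apply Rnot_lt_le. intros Hlt. apply Hn. exists r. split; auto; lra.
Qed.

(** Convergence of [h] is what yields equality, limsups being only subadditive; hence the padding is
    built with a limit density. *)
Lemma limsup_plus_tends g h b c : limsup_infty g b -> tends h c ->
  limsup_infty (fun r => g r + h r) (b + c).
Proof.
  intros [H1 H2] Hh. split.
  - intros eps He. destruct (H1 (eps / 2)) as [R1 K1]; [lra|]. destruct (Hh (eps / 2)) as [R2 K2]; [lra|].
    exists (Rmax R1 R2). intros r Hr.
    specialize (K1 r (Rle_trans _ _ _ (Rmax_l R1 R2) Hr)). specialize (K2 r (Rle_trans _ _ _ (Rmax_r R1 R2) Hr)).
    apply Rabs_le_inv in K2. lra.
  - intros eps He R0. destruct (Hh (eps / 2)) as [R2 K2]; [lra|].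
    destruct (H2 (eps / 2) ltac:(lra) (Rmax R0 R2)) as (r & Hr & K1). exists r.
    split; [eapply Rle_trans; [apply Rmax_l|apply Hr]|].
    specialize (K2 r (Rle_trans _ _ _ (Rmax_r R0 R2) Hr)). apply Rabs_le_inv in K2. lra.
Qed.

Lemma infinite_sum_plus f g a b : infinite_sum f a -> infinite_sum g b ->
  infinite_sum (fun k => f k + g k) (a + b).
Proof.
  intros H1 H2.
  assert (H := CV_plus (sum_f_R0 f) (sum_f_R0 g) a b H1 H2).
  intros eps He. destruct (H eps He) as [N HN]. exists N. intros n Hn.
  rewrite plus_sum. apply HN; auto.
Qed.

Lemma nth_root d y : (1 <= d)%nat -> 0 <= y -> exists x, 0 <= x /\ x ^ d = y.
Proof.
  intros Hd [Hy|<-].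
  - assert (Hd' : 0 < INR d) by (apply (lt_INR 0); lia).
    exists (Rpower y (/ INR d)). assert (0 < Rpower y (/ INR d)) by apply exp_pos.
    split; [lra|]. rewrite <- Rpower_pow, Rpower_mult by auto. rewrite Rinv_l by lra. apply Rpower_1; auto.
  - exists 0. split; [lra|]. apply pow_i; lia.
Qed.

Lemma pow_le_reg x y d : 0 <= x -> 0 <= y -> (1 <= d)%nat -> x ^ d <= y ^ d -> x <= y.
Proof.
  intros Hx Hy Hd H. apply Rnot_lt_le. intros Hlt.
  assert (y ^ d < x ^ d); [|lra]. destruct d; [lia|]. clear H Hd.
  induction d; [simpl; lra|]. change (y * y ^ S d < x * x ^ S d).
  assert (0 <= y ^ S d) by (apply pow_le; auto). nra.
Qed.

(** * Placing bodies along a ray with prescribed density *)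

Lemma hom_subset_ball {d} (K : rset d) D x lam r : (forall y, K y -> enorm y <= D) -> 0 <= lam ->
  enorm x + lam * D <= r -> subset (hom x lam K) (rball r).
Proof.
  intros HD Hl H p (y & Hy & E). unfold rball. rewrite (enorm_ext p (fun j => x j + lam * y j)) by auto.
  eapply Rle_trans; [apply enorm_triang|]. rewrite enorm_scal, Rabs_right by lra.
  specialize (HD y Hy). nra.
Qed.

Lemma hom_in_ball_center {d} (K : rset d) D x lam r : (forall y, K y -> enorm y <= D) -> 0 <= lam ->
  (exists c, K c) -> subset (hom x lam K) (rball r) -> enorm x <= r + lam * D.
Proof.
  intros HD Hl [c Hc] H. assert (Hb : rball r (fun j => x j + lam * c j)).
  { apply H. exists c; auto. }
  unfold rball in Hb.
  rewrite (enorm_ext x (fun j => (x j + lam * c j) - lam * c j)) by (intros; ring).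
  eapply Rle_trans; [apply (enorm_sub_le (fun j => x j + lam * c j) (fun j => lam * c j))|].
  rewrite enorm_scal, Rabs_right by lra. specialize (HD c Hc). nra.
Qed.

(* The i-th body sits at distance rho_i with om * rho_i^d = T_i^2 / (1 + c T_i), where T_i is
   the volume of the first i bodies: this is about T_i / c for c > 0, while T_i is of smaller
   order than the volume of the ball for c = 0. *)
Lemma ray_padding {d} (K : rset d) lam kap om M D (J : nat -> Prop) c :
  (1 <= d)%nat -> (exists p, K p) -> (forall y, K y -> enorm y <= D) -> 0 < kap -> 0 < om ->
  (forall i, 0 < lam i <= M) -> diverges (fun i => chi (J i) * lam i ^ d) -> 0 <= c ->
  exists x : nat -> pt d, exists S : R -> R,
    (forall r, 0 <= r -> infinite_sum (fun i => chi (J i /\ subset (hom (x i) (lam i) K) (rball r)) * (lam i ^ d * kap)) (S r)) /\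
    tends (fun r => S r / (om * r ^ d)) c.
Proof.
  intros Hd HK HD Hkap Hom Hlam Hdiv Hc.
  assert (HD0 : 0 <= D). { destruct HK as [p Hp]. specialize (HD p Hp). assert (H := enorm_nonneg p). lra. }
  assert (HM : 0 < M) by (specialize (Hlam O); lra).
  assert (Hv : forall i, 0 < lam i ^ d * kap <= M ^ d * kap).
  { intros i. destruct (Hlam i). split; [apply Rmult_lt_0_compat; auto; apply pow_lt; auto|].
    apply Rmult_le_compat_r; [lra|]. apply pow_incr; lra. }
  set (v := fun i => chi (J i) * (lam i ^ d * kap)).
  assert (Hv0 : forall i, 0 <= v i <= M ^ d * kap).
  { intros i. unfold v. assert (C := chi_bounds (J i)). specialize (Hv i).
    set (w := lam i ^ d * kap) in *. set (W := M ^ d * kap) in *. nra. }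
  set (T := fun i => lsum v (seq 0 (S i))).
  assert (HT0 : forall i, 0 <= T i) by (intros; apply lsum_nonneg; intros; apply Hv0).
  assert (HTinf : forall B, exists n, B < T n).
  { intros B. destruct (Hdiv O ((B + 1) / kap)) as (n & _ & Hn). rewrite Nat.sub_0_r in Hn. exists n.
    unfold T. rewrite seq_S, lsum_app. simpl (lsum v ((0 + n)%nat :: nil)). assert (H := Hv0 n).
    assert (E : lsum v (seq 0 n) = kap * lsum (fun i => chi (J i) * lam i ^ d) (seq 0 n)).
    { rewrite <- lsum_scal. apply lsum_ext. intros; unfold v; ring. }
    assert (kap * ((B + 1) / kap) <= lsum v (seq 0 n)) by (rewrite E; apply Rmult_le_compat_l; lra).
    replace (kap * ((B + 1) / kap)) with (B + 1) in H0 by (field; lra). lra. }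
  assert (Hden : forall i, 0 < 1 + c * T i).
  { intros i. assert (0 <= c * T i) by (apply Rmult_le_pos; auto). lra. }
  assert (Hrho : forall i, exists rho, 0 <= rho /\ om * rho ^ d = T i * T i / (1 + c * T i)).
  { intros i. destruct (nth_root d (T i * T i / (1 + c * T i) / om) Hd) as (rho & H1 & H2).
    - apply Rle_mult_inv_pos; auto. apply Rle_mult_inv_pos; auto. specialize (HT0 i). nra.
    - exists rho. split; auto. rewrite H2. specialize (Hden i). field. split; lra. }
  destruct (choice _ Hrho) as [rho Hrho'].
  destruct (unit_vector d Hd) as [u Hu].
  pose (x := fun i (j : Fin.t d) => rho i * u j).
  assert (Hx : forall i, enorm (x i) = rho i).
  { intros i. unfold x. rewrite enorm_scal, Hu, Rabs_right; [ring|]. destruct (Hrho' i); lra. }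
  pose (t := fun r i => chi (J i /\ subset (hom (x i) (lam i) K) (rball r)) * (lam i ^ d * kap)).
  assert (Ht : forall r i, 0 <= t r i <= v i).
  { intros r i. unfold t, v. assert (C1 := chi_bounds (J i /\ subset (hom (x i) (lam i) K) (rball r))).
    assert (C2 := chi_le (J i /\ subset (hom (x i) (lam i) K) (rball r)) (J i) ltac:(tauto)).
    specialize (Hv i). set (w := lam i ^ d * kap) in *. nra. }
  (* The last body [m] inside the ball decides. From rho_m <= r + MD follows T_m^2 <= W (1 + c T_m),
     and T_m > (c + dl) W + 1/dl would contradict this. *)
  assert (Hup : forall r, 0 <= r -> forall dl, 0 < dl -> forall m,
     lsum (t r) (seq 0 m) <= (c + dl) * (om * (r + M * D) ^ d) + / dl).
  { intros r Hr dl Hdl m. set (W := om * (r + M * D) ^ d).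
    assert (HMD : 0 <= M * D) by (apply Rmult_le_pos; lra).
    assert (HW : 0 <= W) by (apply Rmult_le_pos; [lra|]; apply pow_le; lra).
    assert (Hdi : 0 < / dl) by (apply Rinv_0_lt_compat; auto).
    induction m.
    - simpl. assert (0 <= (c + dl) * W) by (apply Rmult_le_pos; lra). lra.
    - destruct (classic (J m /\ subset (hom (x m) (lam m) K) (rball r))) as [[H1 H2]|H].
      + apply Rle_trans with (T m); [apply lsum_le; intros; apply Ht|].
        assert (H3 := hom_in_ball_center K D (x m) (lam m) r HD ltac:(specialize (Hlam m); lra) HK H2).
        rewrite Hx in H3. assert (H4 : rho m <= r + M * D).
        { eapply Rle_trans; [apply H3|]. apply Rplus_le_compat_l, Rmult_le_compat_r; auto. apply Hlam. }
        destruct (Hrho' m) as [H5 H6].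
        assert (H7 : T m * T m / (1 + c * T m) <= W).
        { rewrite <- H6. unfold W. apply Rmult_le_compat_l; [lra|]. apply pow_incr; auto. }
        assert (H8 : T m * T m <= W * (1 + c * T m)).
        { specialize (Hden m). replace (T m * T m) with (T m * T m / (1 + c * T m) * (1 + c * T m)) by (field; lra).
          apply Rmult_le_compat_r; lra. }
        apply Rnot_lt_le. intros Hlt. specialize (HT0 m). set (y := T m) in *.
        assert (A1 := Rmult_le_compat_r y _ _ HT0 (Rlt_le _ _ Hlt)).
                assert (A3 : dl * W * y <= W - / dl * y) by lra.
        assert (A4 : / dl < y). { assert (0 <= (c + dl) * W) by (apply Rmult_le_pos; lra). lra. }
        assert (A5 : 1 < dl * y). { apply (Rmult_lt_reg_l (/ dl)); auto. rewrite <- Rmult_assoc, Rinv_l by lra. lra. }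
        assert (A6 : 0 < / dl * y) by (apply Rmult_lt_0_compat; lra).
        assert (A7 : W * 1 <= W * (dl * y)) by (apply Rmult_le_compat_l; lra). lra.
      + rewrite seq_S, lsum_app. simpl (lsum (t r) ((0 + m)%nat :: nil)). unfold t at 2.
        rewrite (chi_false _ H). lra. }
  assert (HS : forall r, exists S, 0 <= r -> infinite_sum (t r) S /\ forall dl, 0 < dl -> S <= (c + dl) * (om * (r + M * D) ^ d) + / dl).
  { intros r. destruct (Rle_dec 0 r) as [Hr|Hr]; [|exists 0; intros; lra].
    destruct (infinite_sum_bounded (t r) _ (fun k => proj1 (Ht r k)) (Hup r Hr 1 Rlt_0_1)) as (S & HS & _).
    exists S. intros _. split; auto. intros dl Hdl.
    destruct (infinite_sum_bounded (t r) _ (fun k => proj1 (Ht r k)) (Hup r Hr dl Hdl)) as (S' & HS' & H).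
    replace S with S'; [apply H|]. eapply uniqueness_sum; eauto. }
  destruct (choice _ HS) as [S HS'].
  exists x, S. split; [intros r Hr; apply HS'; auto|].
  (* Let [n] be the first index with rho_n > r - MD. The padding bodies before it all lie in the
     ball, and T_n >= c W; at most the volume of body [n] itself, bounded by M^d kap, is lost. *)
  assert (Hlow : forall r, M * D <= r -> c * (om * (r - M * D) ^ d) - M ^ d * kap <= S r).
  { intros r Hr. assert (HMD : 0 <= M * D) by (apply Rmult_le_pos; lra).
    set (W := om * (r - M * D) ^ d).
    assert (HW : 0 <= W) by (apply Rmult_le_pos; [lra|]; apply pow_le; lra).
    destruct (nat_least (fun n => W < T n * T n / (1 + c * T n))) as (n & Hn & Hmin).
    { destruct (HTinf ((c + 1) * W + 1)) as [n Hn]. exists n. specialize (Hden n).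
      assert (0 <= c * W) by (apply Rmult_le_pos; auto).
      apply (Rmult_lt_reg_r (1 + c * T n)); auto. unfold Rdiv. rewrite Rmult_assoc, Rinv_l by lra.
      set (y := T n) in *. assert (c * W * y + (W + 1) * y <= y * y) by nra. nra. }
    destruct (HS' r ltac:(lra)) as [HSr _].
    apply Rle_trans with (lsum (t r) (seq 0 n)).
    - assert (E : lsum (t r) (seq 0 n) = lsum v (seq 0 n)).
      { apply lsum_ext. intros i Hi. apply in_seq in Hi. unfold t, v. f_equal. apply chi_iff. split; [tauto|]. intros HJ. split; auto.
        apply (hom_subset_ball K D); auto; [specialize (Hlam i); lra|]. rewrite Hx.
        destruct (Hrho' i) as [H5 H6].
        assert (H7 : om * rho i ^ d <= W).
        { rewrite H6. apply Rnot_lt_le. intros Hlt. specialize (Hmin i Hlt). lia. }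
        unfold W in H7. apply Rmult_le_reg_l in H7; auto.
        apply pow_le_reg in H7; auto; [|lra].
        assert (lam i * D <= M * D) by (apply Rmult_le_compat_r; auto; apply Hlam). lra. }
      rewrite E. assert (ET : T n = lsum v (seq 0 n) + v n).
      { unfold T. rewrite seq_S, lsum_app. simpl. ring. }
      assert (Hb := Hv0 n). specialize (HT0 n). specialize (Hden n).
      apply (Rmult_lt_compat_r (1 + c * T n)) in Hn; auto.
      unfold Rdiv in Hn. rewrite Rmult_assoc, Rinv_l in Hn by lra.
      assert (c * W <= T n); [|lra]. apply Rnot_lt_le. intros Hlt. set (y := T n) in *. nra.
    - apply infinite_sum_nonneg_ge; auto. intros k; apply Ht. }
  assert (Hmd := Rmult_le_pos M D (Rlt_le _ _ HM) HD0).
  intros eps He.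
  destruct (tends_le_eventually (fun r => (c + eps / 2) * ((r + M * D) / r) ^ d + / (eps / 2) * / (om * r ^ d)) (c + eps / 2) (c + eps)) as [R1 H1].
  { eapply tends_eq.
    - apply tends_plus; apply tends_mult; [apply tends_const|apply tends_ratio|apply tends_const|apply tends_inv_vol; auto].
    - ring. }
  { lra. }
  destruct (tends_ge_eventually (fun r => c * ((r + - (M * D)) / r) ^ d + - (M ^ d * kap) * / (om * r ^ d)) c (c - eps)) as [R2 H2].
  { eapply tends_eq.
    - apply tends_plus; apply tends_mult; [apply tends_const|apply tends_ratio|apply tends_const|apply tends_inv_vol; auto].
    - ring. }
  { lra. }
  exists (Rmax (Rmax R1 R2) (M * D + 1)). intros r Hr.
  assert (Hr3 := Rle_trans _ _ _ (Rmax_r _ _) Hr). assert (Hr12 := Rle_trans _ _ _ (Rmax_l _ _) Hr).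
  specialize (H1 r (Rle_trans _ _ _ (Rmax_l _ _) Hr12)). specialize (H2 r (Rle_trans _ _ _ (Rmax_r _ _) Hr12)).
  specialize (Hlow r ltac:(lra)). destruct (HS' r ltac:(lra)) as [_ Hhigh]. specialize (Hhigh (eps / 2) ltac:(lra)).
  assert (Hpos : 0 < r ^ d) by (apply pow_lt; lra).
  assert (Hpos' : 0 < om * r ^ d) by (apply Rmult_lt_0_compat; auto).
  assert (Hrr : 0 < r) by lra.
  apply Rabs_le. split.
  - assert (c - eps <= S r / (om * r ^ d)); [|lra]. eapply Rle_trans; [apply H2|].
    apply Rle_trans with ((c * (om * (r - M * D) ^ d) - M ^ d * kap) / (om * r ^ d)).
    + right. unfold Rdiv, Rminus. rewrite Rpow_mult_distr, pow_inv. field. split; lra.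
    + apply Rmult_le_compat_r; auto. apply Rlt_le, Rinv_0_lt_compat; auto.
  - assert (S r / (om * r ^ d) <= c + eps); [|lra]. eapply Rle_trans; [|apply H1].
    apply Rle_trans with (((c + eps / 2) * (om * (r + M * D) ^ d) + / (eps / 2)) / (om * r ^ d)).
    + apply Rmult_le_compat_r; auto. apply Rlt_le, Rinv_0_lt_compat; auto.
    + right. replace ((r + M * D) / r) with ((r + M * D) * / r) by auto. rewrite Rpow_mult_distr, pow_inv. field. repeat split; lra.
Qed.

Lemma exact_density_cover {d} (K : rset d) lam kap th (e : nat -> R) M :
  (1 <= d)%nat -> convex_body K -> is_vol K kap -> (forall i, 0 < lam i <= M) ->
  cv_infty (fun n => sum_f_R0 (fun i => lam i ^ d) n) -> 0 <= th ->
  (forall n, 0 <= e n) -> Un_cv e 0 ->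
  (forall n N, batch_cover K lam kap N (cube origin (2 ^ n)) ((th + e n) * (2 ^ n) ^ d)) ->
  exists x : nat -> pt d, covers (fun i => hom (x i) (lam i) K) /\ density_is (fun i => hom (x i) (lam i) K) th.
Proof.
  intros Hd (_ & _ & [D HD] & Hint) Hvol Hlam Hdiv Hth He He0 Hcov.
  assert (Hkap := interior_vol_pos K kap Hvol Hint). assert (HKin := nonempty_interior_point K Hint).
  destruct (rball_vol d Hd) as (om & Hom & HV).
  destruct (base_cover K lam kap th e Hd (fun i => proj1 (Hlam i)) (Rlt_le _ _ Hkap) Hth (cv_infty_diverges _ Hdiv) He He0 Hcov)
    as (used & xb & Hcover & Hunused & Hacc).
  pose (tb := fun r i => chi (used i /\ subset (hom (xb i) (lam i) K) (rball r)) * (lam i ^ d * kap)).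
  assert (Hv : forall i, 0 < lam i ^ d * kap).
  { intros i. apply Rmult_lt_0_compat; auto. apply pow_lt, Hlam. }
  assert (Htb : forall r i, 0 <= tb r i).
  { intros r i. apply Rmult_le_pos; [apply chi_bounds|apply Rlt_le, Hv]. }
  assert (Htbacc : forall eps, 0 < eps -> exists C, forall r, 1 <= r -> forall m,
     lsum (tb r) (seq 0 m) <= C + (th + eps) * (om * (r + INR d * sqrt r) ^ d)).
  { intros eps Heps. destruct (Hacc eps Heps) as [C HC]. exists C. intros r Hr m.
    assert (Hrd : 0 < r + INR d * sqrt r).
    { assert (0 <= INR d * sqrt r) by (apply Rmult_le_pos; [apply pos_INR|apply sqrt_pos]). lra. }
    eapply Rle_trans; [|apply (HC r _ Hr (HV _ Hrd) m)]. right. rewrite <- lsum_scal.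
    apply lsum_ext. intros; unfold tb; ring. }
  assert (HSb : forall r, exists S, 0 <= S /\ (1 <= r -> infinite_sum (tb r) S)).
  { intros r. destruct (Rle_dec 1 r) as [Hr|Hr]; [|exists 0; split; [|intros]; lra].
    destruct (Htbacc 1 Rlt_0_1) as [C HC].
    destruct (infinite_sum_bounded (tb r) _ (Htb r) (HC r Hr)) as (S & HS & HS0). exists S. split; [lra|auto]. }
  destruct (choice _ HSb) as [Sb HSb'].
  (* The volume bound is available for [1 <= r]; the value 0 elsewhere keeps [gb] nonnegative and
     does not change its limsup at infinity. *)
  pose (gb := fun r => if Rle_dec 1 r then Sb r / (om * r ^ d) else 0).
  assert (Hgb0 : forall r, 0 <= gb r).
  { intros r. unfold gb. destruct Rle_dec; [|lra]. apply Rle_mult_inv_pos; [apply HSb'|].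
    apply Rmult_lt_0_compat; auto. apply pow_lt; lra. }
  destruct (limsup_exists gb th Hgb0) as (b & Hb & Hlim).
  { intros eps Heps. destruct (Htbacc (eps / 2)) as [C HC]; [lra|].
    destruct (tends_le_eventually (fun r => C * / (om * r ^ d) + (th + eps / 2) * (1 + INR d * / sqrt r) ^ d) (th + eps / 2) (th + eps)) as [R0 HR].
    - apply (tends_eq _ (C * 0 + (th + eps / 2) * (1 + INR d * 0) ^ d)).
      + apply tends_plus; apply tends_mult; try apply tends_const; [apply tends_inv_vol; auto|].
        apply tends_pow, tends_plus; [apply tends_const|].
        apply tends_mult; [apply tends_const|apply tends_inv_sqrt].
      + replace (1 + INR d * 0) with 1 by ring. rewrite pow1. ring.
    - lra.
    - exists R0. intros r Hr. specialize (HR r Hr). unfold gb. destruct (Rle_dec 1 r) as [Hr1|_]; [|lra].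
      destruct (infinite_sum_bounded (tb r) _ (Htb r) (HC r Hr1)) as (S & HS & HS0).
      replace (Sb r) with S; [|eapply uniqueness_sum; [apply HS|apply HSb'; auto]].
      eapply Rle_trans; [|apply HR].
      assert (Hpos : 0 < r ^ d) by (apply pow_lt; lra).
      assert (Hpos' : 0 < om * r ^ d) by (apply Rmult_lt_0_compat; auto).
      assert (Hsq : 0 < sqrt r) by (apply sqrt_lt_R0; lra).
      apply Rle_trans with ((C + (th + eps / 2) * (om * (r + INR d * sqrt r) ^ d)) / (om * r ^ d)).
      + apply Rmult_le_compat_r; [apply Rlt_le, Rinv_0_lt_compat; auto|apply HS0].
      + right. replace (1 + INR d * / sqrt r) with ((r + INR d * sqrt r) * / r).
        * rewrite Rpow_mult_distr, pow_inv. field. split; lra.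
        * rewrite <- (sqrt_sqrt r) at 1 3 by lra. field. lra. }
  destruct (ray_padding K lam kap om M D (fun i => ~ used i) (th - b) Hd HKin HD Hkap Hom Hlam Hunused)
    as (xp & Sp & HSp & Hpad); [lra|].
  pose (x := fun i => if excluded_middle_informative (used i) then xb i else xp i).
  exists x. split.
  - intros p. destruct (Hcover p) as (i & Hi & Hp). exists i. unfold x. destruct excluded_middle_informative; tauto.
  - pose (tp := fun r i => chi (~ used i /\ subset (hom (xp i) (lam i) K) (rball r)) * (lam i ^ d * kap)).
    pose (t := fun r i => tb r i + tp r i).
    assert (Et : forall r i, t r i = chi (subset (hom (x i) (lam i) K) (rball r)) * (lam i ^ d * kap)).
    { intros r i. unfold t, tb, tp, x. destruct excluded_middle_informative as [U|U].
      - rewrite (chi_false (~ used i /\ _)) by tauto. rewrite Rmult_0_l, Rplus_0_r. f_equal. apply chi_iff. tauto.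
      - rewrite (chi_false (used i /\ _)) by tauto. rewrite Rmult_0_l, Rplus_0_l. f_equal. apply chi_iff. tauto. }
    assert (Hts : forall r i, (subset (hom (x i) (lam i) K) (rball r) -> is_vol (hom (x i) (lam i) K) (t r i)) /\
                    (~ subset (hom (x i) (lam i) K) (rball r) -> t r i = 0)).
    { intros r i. rewrite Et. split; intros H.
      - rewrite chi_true, Rmult_1_l by auto. apply is_vol_hom; auto. apply Hlam.
      - rewrite chi_false by auto. ring. }
    (* For r < 1 only summability matters, and it follows by comparison with r = 1. *)
    assert (Hall : forall r, exists S, 0 < r -> infinite_sum (t r) S /\ (1 <= r -> S = Sb r + Sp r)).
    { intros r. destruct (Rle_dec 1 r) as [Hr|Hr].
      - exists (Sb r + Sp r). intros _. split; auto. apply infinite_sum_plus; [apply HSb'; auto|apply HSp; lra].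
      - destruct (Rlt_dec 0 r) as [Hr0|]; [|exists 0; intros; lra].
        assert (Hmon : forall i, 0 <= t r i <= t 1 i).
        { intros i. rewrite !Et. specialize (Hv i).
          assert (C := chi_bounds (subset (hom (x i) (lam i) K) (rball r))).
          assert (C' := chi_le (subset (hom (x i) (lam i) K) (rball r)) (subset (hom (x i) (lam i) K) (rball 1))).
          assert (chi (subset (hom (x i) (lam i) K) (rball r)) <= chi (subset (hom (x i) (lam i) K) (rball 1))).
          { apply C'. intros H p Hp. specialize (H p Hp). unfold rball in *. lra. }
          split; [apply Rmult_le_pos; lra|apply Rmult_le_compat_r; lra]. }
        assert (H1 : infinite_sum (t 1) (Sb 1 + Sp 1)) by (apply infinite_sum_plus; [apply HSb'; lra|apply HSp; lra]).
        destruct (infinite_sum_bounded (t r) (Sb 1 + Sp 1)) as (S & HS & _).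
        + intros k; apply Hmon.
        + intros n. apply Rle_trans with (lsum (t 1) (seq 0 n)).
          * apply lsum_le. intros; apply Hmon.
          * apply infinite_sum_nonneg_ge; auto. intros k. specialize (Hmon k). lra.
        + exists S. intros _. split; auto. lra. }
    destruct (choice _ Hall) as [S HS].
    exists (fun r => S r / (om * r ^ d)). split.
    + intros r Hr. exists (t r), (S r), (om * r ^ d). split; [apply Hts|]. split; [apply HS; auto|]. split; auto.
    + replace th with (b + (th - b)) by ring.
      destruct (limsup_plus_tends gb _ b (th - b) Hlim Hpad) as [L1 L2].
      assert (Eg : forall r, 1 <= r -> S r / (om * r ^ d) = gb r + Sp r / (om * r ^ d)).
      { intros r Hr. destruct (HS r ltac:(lra)) as [_ E]. rewrite (E Hr). unfold gb. destruct Rle_dec; [|lra]. unfold Rdiv; ring. }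
      split.
      * intros eps Heps. destruct (L1 eps Heps) as [R0 HR0]. exists (Rmax R0 1). intros r Hr.
        rewrite Eg; [apply HR0|]; eapply Rle_trans; try apply Hr; [apply Rmax_l|apply Rmax_r].
      * intros eps Heps R0. destruct (L2 eps Heps (Rmax R0 1)) as (r & Hr & H). exists r.
        split; [eapply Rle_trans; [apply Rmax_l|apply Hr]|]. rewrite Eg; auto. eapply Rle_trans; [apply Rmax_r|apply Hr].
Qed.

(** * From density coverings by translates to finite families of homothets *)

Lemma choose_near_inf (E : R -> Prop) dl : 0 < dl -> (exists x, E x) -> (forall x, E x -> 0 <= x) ->
  exists x, E x /\ forall y, E y -> x <= y + dl.
Proof.
  intros Hd Hex H0. destruct (is_inf_exists E Hex) as [m [H1 H2]]; [exists 0; auto|].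
  apply NNPP. intros Hn. assert (m + dl <= m); [|lra]. apply H2. intros x Hx.
  apply Rnot_lt_le. intros Hlt. apply Hn. exists x. split; auto. intros y Hy. specialize (H1 y Hy). lra.
Qed.

(** [e n] is taken within 1/(n+1) of the infimum of the rates admissible at n; thus the thresholds
    n0 for the various eps need not be combined explicitly. *)
Lemma rate_sequence (P : nat -> R -> Prop) :
  (forall n, exists e, 0 <= e /\ P n e) ->
  (forall eps, 0 < eps -> exists n0, forall n, (n0 <= n)%nat -> P n eps) ->
  exists e : nat -> R, (forall n, 0 <= e n) /\ Un_cv e 0 /\ forall n, P n (e n).
Proof.
  intros H1 H2.
  assert (H : forall n, exists e, (0 <= e /\ P n e) /\ forall y, 0 <= y /\ P n y -> e <= y + / (INR n + 1)).
  { intros n. apply (choose_near_inf (fun e => 0 <= e /\ P n e)); auto.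
    - apply Rinv_0_lt_compat. assert (K := pos_INR n). lra.
    - tauto. }
  destruct (choice _ H) as [e K]. exists e. split; [intros n; apply K|]. split; [|intros n; apply K].
  intros eps He. destruct (H2 (eps / 2)) as [n0 Hn0]; [lra|].
  destruct (small_inv_INR (eps / 3)) as (n1 & Hn1 & Hn1'); [lra|].
  exists (n0 + n1)%nat. intros n Hn. destruct (K n) as [[K1 _] K2].
  specialize (K2 (eps / 2)). unfold Rdist. rewrite Rminus_0_r, Rabs_right by lra.
  eapply Rle_lt_trans; [apply K2; split; [lra|apply Hn0; lia]|].
  assert (/ (INR n + 1) <= / INR n1); [|lra].
  apply Rinv_le_contravar; [apply (lt_INR 0); auto|]. rewrite <- S_INR. apply le_INR; lia.
Qed.

Lemma NoDup_flat_map {A B} (f : A -> list B) l : NoDup l -> (forall a, In a l -> NoDup (f a)) ->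
  (forall a a' b, In a l -> In a' l -> In b (f a) -> In b (f a') -> a = a') -> NoDup (flat_map f l).
Proof.
  induction l as [|a l IH]; simpl; intros Hn Hf Hd; [constructor|].
  inversion_clear Hn. apply NoDup_app; auto.
  - apply IH; auto. intros a1 a2 b H1 H2. apply Hd; auto.
  - intros b Hb Hb'. apply in_flat_map in Hb'. destruct Hb' as (a' & Ha' & Hb').
    assert (a = a') by (apply (Hd a a' b); auto). congruence.
Qed.

Lemma finite_enumeration {A} (P : A -> Prop) M :
  (~ exists l, NoDup l /\ length l = S M /\ forall i, In i l -> P i) ->
  exists l, (length l <= M)%nat /\ forall i, P i -> In i l.
Proof.
  induction M; intros H.
  - exists nil. split; auto. intros i Hi. exfalso. apply H. exists (i :: nil).
    split; [repeat constructor; auto|]. split; auto. intros j [<-|[]]; auto.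
  - destruct (classic (exists l, NoDup l /\ length l = S M /\ forall i, In i l -> P i)) as [(l & H1 & H2 & H3)|Hn].
    + exists l. split; [lia|]. intros i Hi. apply NNPP. intros Hni. apply H. exists (i :: l).
      split; [constructor; auto|]. split; [simpl; auto|]. intros j [<-|Hj]; auto.
    + destruct (IHM Hn) as (l & H1 & H2). exists l; split; auto.
Qed.

Lemma list_max_bound (l : list nat) : exists m, forall i, In i l -> (i < m)%nat.
Proof.
  induction l as [|a l [m Hm]]; [exists O; intros i []|].
  exists (S (a + m)). intros i [<-|Hi]; [lia|]. specialize (Hm i Hi). lia.
Qed.

Lemma limsup_nonneg g v : (forall r, 0 < r -> 0 <= g r) -> limsup_infty g v -> 0 <= v.
Proof.
  intros Hg [H _]. apply le_epsilon. intros eps He. destruct (H eps He) as [R0 H0].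
  specialize (H0 (Rmax R0 1) (Rmax_l _ _)).
  assert (0 < Rmax R0 1) by (eapply Rlt_le_trans; [apply Rlt_0_1|apply Rmax_r]).
  specialize (Hg _ H1). lra.
Qed.

Lemma density_nonneg {d} (C : nat -> rset d) v : (1 <= d)%nat -> density_is C v -> 0 <= v.
Proof.
  intros Hd (g & Hg & Hl). apply (limsup_nonneg g); auto. intros r Hr.
  destruct (Hg r Hr) as (t & S & V & Ht & HS & HV & ->).
  destruct (rball_vol d Hd) as (om & Hom & HV').
  replace V with (om * r ^ d) by (apply (is_inf_unique _ _ _ (HV' r Hr) HV)).
  apply Rle_mult_inv_pos.
  - apply (infinite_sum_nonneg_ge t S 0); auto. intros k. destruct (Ht k) as [H1 H2].
    destruct (classic (subset (C k) (rball r))) as [H|H]; [apply (is_vol_nonneg _ _ (H1 H))|rewrite H2; auto; lra].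
  - apply Rmult_lt_0_compat; auto. apply pow_lt; auto.
Qed.

Lemma nat_floor_nonneg x : 0 <= x -> exists k, INR k <= x < INR k + 1.
Proof.
  intros H. destruct (INR_archimed 1 x) as [m Hm]; [lra|].
  destruct (nat_floor m x) as (k & _ & Hk); [lra|]. exists k; auto.
Qed.

(* Pigeonhole over the cells of side s + 2(D+1) in a large ball: some cell contains at most
   the average number of translation vectors, and the translates meeting the concentric
   cube of side s all have their vectors in that cell. *)
Lemma translate_cover_cube {d} (K : rset d) kap (x : nat -> pt d) v eps :
  (1 <= d)%nat -> convex_body K -> is_vol K kap ->
  covers (fun i => hom (x i) 1 K) -> density_is (fun i => hom (x i) 1 K) v -> 0 < eps ->
  exists s0, 0 < s0 /\ forall s, s0 <= s -> exists l : list (pt d),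
    (forall p, cube origin s p -> exists y, In y l /\ hom y 1 K p) /\
    kap * INR (length l) <= (v + eps) * s ^ d.
Proof.
  intros Hd (_ & _ & [D0 HD0] & Hint) Hvol Hcov Hden Heps.
  assert (Hv := density_nonneg _ _ Hd Hden).
  assert (Hkap := interior_vol_pos K kap Hvol Hint).
  destruct (rball_vol d Hd) as (om & Hom & HV). destruct Hden as (g & Hg & Hlim & _).
  pose (D := Rabs D0).
  assert (HDpos : 0 <= D) by apply Rabs_pos.
  assert (HD : forall y, K y -> enorm y <= D).
  { intros y Hy. eapply Rle_trans; [apply HD0; auto|apply Rle_abs]. }
  destruct (tends_le_eventually (fun s => (v + eps / 2) * ((s + 2 * (D + 1)) / s) ^ d) (v + eps / 2) (v + eps)) as [s1 Hs1].
  { eapply tends_eq; [apply tends_mult; [apply tends_const|apply tends_ratio]|ring]. }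
  { lra. }
  exists (Rmax s1 1). split; [eapply Rlt_le_trans; [apply Rlt_0_1|apply Rmax_r]|].
  intros s Hs. specialize (Hs1 s (Rle_trans _ _ _ (Rmax_l _ _) Hs)).
  assert (Hspos : 1 <= s) by (eapply Rle_trans; [apply Rmax_r|apply Hs]). clear Hs.
  (* The margin D + 1 on each side is strictly larger than [D], so the vector of a translate meeting
     the inner cube falls into the half-open cell. *)
  set (s' := s + 2 * (D + 1)) in *. assert (Hs' : 0 < s') by (unfold s'; lra).
  assert (Hdpos := pos_INR d).
  (* A cell has diameter at most d s' and the body radius at most [D]: a translate with vector in a
     cell meeting the ball of radius rho lies in the ball of radius rho + c. *)
  set (c := INR d * s' + D). assert (Hc : 0 <= c) by (unfold c; assert (0 <= INR d * s') by (apply Rmult_le_pos; lra); lra).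
  destruct (Hlim (eps / 4)) as [R0 HR0]; [lra|].
  destruct (tends_le_eventually (fun r => (v + eps / 4) * ((r + c) / r) ^ d) (v + eps / 4) (v + eps / 2)) as [R1 HR1].
  { eapply tends_eq; [apply tends_mult; [apply tends_const|apply tends_ratio]|ring]. }
  { lra. }
  pose (rho := Rmax (Rmax R0 R1) 1).
  assert (Hrho : 1 <= rho) by apply Rmax_r.
  assert (Hrho1 : R1 <= rho) by (eapply Rle_trans; [apply Rmax_r|apply Rmax_l]).
  assert (Hrho0 : R0 <= rho) by (eapply Rle_trans; [apply Rmax_l|apply Rmax_l]).
  specialize (HR1 rho Hrho1). specialize (HR0 (rho + c) ltac:(lra)).
  destruct (Hg (rho + c) ltac:(lra)) as (t & S & V & Ht & HS & HV1 & Eg).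
  assert (EV : V = om * (rho + c) ^ d) by (apply (is_inf_unique _ _ _ HV1 (HV (rho + c) ltac:(lra)))).
  rewrite Eg, EV in HR0.
  assert (Hpc : 0 < (rho + c) ^ d) by (apply pow_lt; lra).
  assert (Hprho : 0 < rho ^ d) by (apply pow_lt; lra).
  assert (HSle : S <= (v + eps / 4) * (om * (rho + c) ^ d)).
  { assert (0 < om * (rho + c) ^ d) by (apply Rmult_lt_0_compat; auto).
    replace S with (S / (om * (rho + c) ^ d) * (om * (rho + c) ^ d)) by (field; lra).
    apply Rmult_le_compat_r; lra. }
  assert (Ht0 : forall i, 0 <= t i).
  { intros i. destruct (Ht i) as [H1 H2].
    destruct (classic (subset (hom (x i) 1 K) (rball (rho + c)))) as [H|H]; [apply (is_vol_nonneg _ _ (H1 H))|rewrite H2; auto; lra]. }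
  assert (Htk : forall i, subset (hom (x i) 1 K) (rball (rho + c)) -> t i = kap).
  { intros i Hi. destruct (Ht i) as [H1 _]. apply (is_inf_unique _ _ _ (H1 Hi)).
    assert (H2 := is_vol_hom K kap (x i) 1 Rlt_0_1 Hvol). rewrite pow1, Rmult_1_l in H2. exact H2. }
  destruct (INR_archimed s' (rho + 1) Hs') as [T HT].
  pose (cell := fun z : Fin.t d -> nat => half_open_cube (grid_corner T s' z) s').
  pose (Z := cfilter (fun z => exists p, cell z p /\ rball rho p) (nodup (fun a b => excluded_middle_informative (a = b)) (ngrid d (2 * T)))).
  assert (HZn : NoDup Z) by (apply NoDup_cfilter, NoDup_nodup).
  assert (HZcov : forall p, rball rho p -> exists z, In z Z /\ cell z p).
  { intros p Hp. destruct (grid_cell_exists T s' p Hs') as (z & Hz & Hzp).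
    - intros j. assert (C := coord_le_enorm p j). unfold rball in Hp. apply Rabs_le_inv in C. lra.
    - exists z. split; auto. apply in_cfilter. split; [apply nodup_In, in_ngrid; auto|]. exists p; auto. }
  assert (HZvol : om * rho ^ d <= INR (length Z) * s' ^ d).
  { rewrite <- lsum_const. rewrite <- (lsum_map (fun q : pt d * R => snd q ^ d) (fun z => (grid_corner T s' z, s'))).
    apply (is_vol_le_cubes (@rball d rho)); auto.
    - apply HV; lra.
    - intros q Hq. apply in_map_iff in Hq. destruct Hq as (z & <- & _). simpl; lra.
    - intros p Hp. destruct (HZcov p Hp) as (z & Hz & Hzp). exists (grid_corner T s' z, s').
      split; [apply in_map_iff; exists z; auto|]. intros j. specialize (Hzp j). simpl; lra. }
  assert (HZpos : 0 < INR (length Z)).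
  { destruct (pos_INR (length Z)) as [H|H]; auto. rewrite <- H, Rmult_0_l in HZvol.
    assert (0 < om * rho ^ d) by (apply Rmult_lt_0_compat; auto). lra. }
  assert (HZball : forall z i, In z Z -> cell z (x i) -> subset (hom (x i) 1 K) (rball (rho + c))).
  { intros z i Hz Hi. apply in_cfilter in Hz. destruct Hz as (_ & p & Hzp & Hp).
    apply (hom_subset_ball K D); auto; [lra|].
    assert (edist (x i) p <= INR d * s').
    { apply enorm_le_coord; [lra|]. intros j. specialize (Hi j). specialize (Hzp j). apply Rabs_le. lra. }
    assert (H2 := enorm_edist (x i) p). unfold rball in Hp. unfold c. lra. }
  (* [M] is the integer part of the average number of vectors per cell that the density permits. If
     every cell held M + 1 of them, their total volume would exceed the bound [HSle]. *)
  destruct (nat_floor_nonneg ((v + eps / 4) * (om * (rho + c) ^ d) / (INR (length Z) * kap))) as (M & HM1 & HM2).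
  { apply Rle_mult_inv_pos; [|apply Rmult_lt_0_compat; auto].
    apply Rmult_le_pos; [lra|]. apply Rmult_le_pos; lra. }
  assert (Hz : exists z, In z Z /\ ~ exists l, NoDup l /\ length l = Datatypes.S M /\ forall i, In i l -> cell z (x i)).
  { apply NNPP. intros Hno.
    assert (Hl : forall z, exists l, In z Z -> NoDup l /\ length l = Datatypes.S M /\ forall i, In i l -> cell z (x i)).
    { intros z. destruct (classic (In z Z)) as [H|H]; [|exists nil; tauto].
      apply NNPP. intros Hn. apply Hno. exists z. split; auto. intros (l & Hl). apply Hn. exists l; auto. }
    destruct (choice _ Hl) as [L HL].
    pose (all := flat_map L Z).
    assert (Hall : NoDup all).
    { apply NoDup_flat_map; auto; [intros; apply HL; auto|]. intros z z' i Hz Hz' Hi Hi'.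
      apply (grid_cell_unique T s' z z' (x i)); auto; [apply (HL z)|apply (HL z')]; auto. }
    destruct (list_max_bound all) as [m Hm].
    assert (H1 : lsum t all <= S).
    { apply Rle_trans with (lsum t (seq 0 m)); [|apply infinite_sum_nonneg_ge; auto].
      apply lsum_incl; auto. intros i Hi. apply in_seq. specialize (Hm i Hi). lia. }
    assert (H2 : lsum t all = INR (length Z) * (INR (Datatypes.S M) * kap)).
    { unfold all. rewrite lsum_flat_map, <- lsum_const. apply lsum_ext. intros z Hz.
      destruct (HL z Hz) as (_ & E & Hi). rewrite <- E, <- lsum_const. apply lsum_ext.
      intros i Hi'. apply Htk. apply (HZball z); auto. }
    rewrite S_INR in H2.
    assert (H3 : (v + eps / 4) * (om * (rho + c) ^ d) < (INR M + 1) * (INR (length Z) * kap)).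
    { assert (0 < INR (length Z) * kap) by (apply Rmult_lt_0_compat; auto).
      replace ((v + eps / 4) * (om * (rho + c) ^ d)) with ((v + eps / 4) * (om * (rho + c) ^ d) / (INR (length Z) * kap) * (INR (length Z) * kap)) by (field; split; lra).
      apply Rmult_lt_compat_r; auto. }
    lra. }
  destruct Hz as (z & Hz & Hno). destruct (finite_enumeration _ M Hno) as (li & Hli & Hin).
  exists (map (fun i j => x i j - grid_corner T s' z j - (D + 1)) li). split.
  - intros p Hp. destruct (Hcov (fun j => p j + grid_corner T s' z j + (D + 1))) as (i & y & Hy & E).
    exists (fun j => x i j - grid_corner T s' z j - (D + 1)). split.
    + apply in_map_iff. exists i. split; auto. apply Hin. intros j. specialize (E j). specialize (Hp j).
      unfold origin in Hp. assert (C := coord_le_enorm y j). specialize (HD y Hy).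
      apply Rabs_le_inv in C. assert (Es : s' = s + 2 * (D + 1)) by reflexivity. lra.
    + exists y. split; auto. intros j. specialize (E j). lra.
  - rewrite length_map.
    apply Rle_trans with ((v + eps / 2) * s' ^ d).
    + apply Rle_trans with (kap * INR M); [apply Rmult_le_compat_l; [lra|apply le_INR; auto]|].
      apply Rle_trans with ((v + eps / 4) * (om * (rho + c) ^ d) / INR (length Z)).
      * apply Rle_trans with (kap * ((v + eps / 4) * (om * (rho + c) ^ d) / (INR (length Z) * kap))).
        -- apply Rmult_le_compat_l; lra.
        -- right; field; split; lra.
      * apply Rle_trans with ((v + eps / 4) * ((rho + c) / rho) ^ d * s' ^ d).
        -- replace ((rho + c) / rho) with ((rho + c) * / rho) by auto. rewrite Rpow_mult_distr, pow_inv.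
           apply (Rmult_le_reg_r (INR (length Z))); auto. replace ((v + eps / 4) * (om * (rho + c) ^ d) / INR (length Z) * INR (length Z)) with ((v + eps / 4) * (om * (rho + c) ^ d)) by (field; lra).
           apply Rle_trans with (((v + eps / 4) * (rho + c) ^ d * / rho ^ d) * (om * rho ^ d)); [right; field; lra|].
           replace ((v + eps / 4) * ((rho + c) ^ d * / rho ^ d) * s' ^ d * INR (length Z)) with ((v + eps / 4) * (rho + c) ^ d * / rho ^ d * (INR (length Z) * s' ^ d)) by ring.
           apply Rmult_le_compat_l; auto.
           apply Rmult_le_pos; [apply Rmult_le_pos; lra|apply Rlt_le, Rinv_0_lt_compat; auto].
        -- apply Rmult_le_compat_r; [apply pow_le; lra|auto].
    + assert (0 < s ^ d) by (apply pow_lt; lra).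
      apply Rle_trans with ((v + eps / 2) * (s' / s) ^ d * s ^ d).
      * right. replace (s' / s) with (s' * / s) by auto. rewrite Rpow_mult_distr, pow_inv. field. lra.
      * apply Rmult_le_compat_r; [lra|auto].
Qed.

(** In other words, mu K + (lam - mu) c is contained in lam K: a larger homothet contains an
    explicit translate of a smaller one. *)
Lemma convex_comb {d} (K : rset d) : convex K -> forall y c mu lam, K y -> K c -> 0 <= mu <= lam -> 0 < lam ->
  K (fun j => / lam * (mu * y j + (lam - mu) * c j)).
Proof.
  intros Hc y c mu lam Hy Hcc Hmu Hl.
  replace (fun j => / lam * (mu * y j + (lam - mu) * c j)) with (fun j => (1 - mu / lam) * c j + mu / lam * y j).
  - apply Hc; auto. split; [apply Rle_mult_inv_pos; lra|].
    apply (Rmult_le_reg_r lam); auto. unfold Rdiv. rewrite Rmult_assoc, Rinv_l by lra. lra.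
  - apply functional_extensionality. intros j. field. lra.
Qed.

Lemma select_near (A : Type) (lam : nat -> R) L dl (l : list A) : cluster_point lam L -> 0 < dl ->
  forall N, exists N' (l' : list (nat * A)), (N <= N')%nat /\ in_range N N' l' /\ functional l' /\
    (forall y, In y l -> exists i, In (i, y) l') /\ length l' = length l /\
    forall i y, In (i, y) l' -> Rabs (lam i - L) < dl.
Proof.
  intros HL Hdl. induction l as [|a l IH]; intros N.
  - exists N, nil. split; [lia|]. split; [intros i x []|]. split; [intros i x x' []|].
    split; [intros y []|]. split; auto. intros i y [].
  - destruct (HL dl Hdl N) as (i & Hi & Hi').
    destruct (IH (S i)) as (N' & l' & H1 & H2 & H3 & H4 & H5 & H6).
    assert (R1 : in_range N (S i) ((i, a) :: nil)).
    { intros i' x [E|[]]. injection E as <- <-. lia. }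
    exists N', (((i, a) :: nil) ++ l'). split; [lia|].
    split; [apply (in_range_app N (S i) N'); auto; lia|].
    split; [apply (functional_app N (S i) N'); auto|].
    { intros i' x x' [E|[]] [E'|[]]. congruence. }
    split; [|split].
    + intros y [<-|Hy]; [exists i; simpl; auto|]. destruct (H4 y Hy) as [i' Hi'']. exists i'; simpl; auto.
    + simpl; auto.
    + intros i' y [E|Hy]; [injection E as <- <-; auto|eauto].
Qed.

(** Put mu = L (1 - dl). Each selected body has mu <= lam_i <= L (1 + dl), hence contains a
    translate of mu K and replaces it in the covering scaled by mu, at a volume not exceeding that
    of L (1 + dl) K. *)
Lemma batch_near_cluster {d} (K : rset d) lam kap L dl s (l : list (pt d)) N :
  convex K -> (exists c, K c) -> (forall i, 0 < lam i) -> 0 <= kap -> cluster_point lam L -> 0 < L -> 0 < dl < 1 ->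
  (forall p, cube origin (s / (L * (1 - dl))) p -> exists y, In y l /\ hom y 1 K p) ->
  batch_cover K lam kap N (cube origin s) (kap * INR (length l) * (L * (1 + dl)) ^ d).
Proof.
  intros HK [c Hc] Hlam Hkap HL HLpos Hdl Hcov.
  destruct (select_near _ lam L (L * dl) l HL ltac:(apply Rmult_lt_0_compat; lra) N) as (N' & l' & H1 & H2 & H3 & H4 & H5 & H6).
  set (mu := L * (1 - dl)) in *. assert (Hmu : 0 < mu) by (apply Rmult_lt_0_compat; lra).
  assert (H7 : forall i y, In (i, y) l' -> mu <= lam i <= L * (1 + dl)).
  { intros i y Hi. specialize (H6 i y Hi). apply Rabs_def2 in H6. unfold mu. lra. }
  pose (f := fun q : nat * pt d => (fst q, fun j => mu * snd q j - (lam (fst q) - mu) * c j)).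
  exists N', (map f l'). split; [auto|]. split; [|split; [|split]].
  - intros i x Hi. apply in_map_iff in Hi. destruct Hi as ([i' x'] & E & Hi).
    injection E as <- <-. eauto.
  - intros i x x' Hi Hi'. apply in_map_iff in Hi, Hi'. destruct Hi as ([i1 x1] & E1 & Hi1).
    destruct Hi' as ([i2 x2] & E2 & Hi2). injection E1 as <- <-. injection E2 as E <-.
    simpl in *. subst. rewrite (H3 _ _ _ Hi1 Hi2); auto.
  - intros p Hp. destruct (Hcov (fun j => p j / mu)) as (y & Hy & k & Hk & E).
    { intros j. specialize (Hp j). unfold origin in *. split.
      - apply Rle_mult_inv_pos; lra.
      - unfold Rdiv. rewrite !Rplus_0_l in *. apply Rmult_le_compat_r; [apply Rlt_le, Rinv_0_lt_compat; auto|lra]. }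
    destruct (H4 y Hy) as [i Hi]. specialize (H7 i y Hi).
    exists i, (fun j => mu * y j - (lam i - mu) * c j). split.
    + apply in_map_iff. exists (i, y); auto.
    + exists (fun j => / lam i * (mu * k j + (lam i - mu) * c j)). split.
      * apply convex_comb; auto. lra.
      * intros j. specialize (E j). specialize (Hlam i).
        replace (p j) with (mu * (p j / mu)) by (field; lra). rewrite E. field. lra.
  - rewrite lsum_map. simpl. rewrite Rmult_assoc. apply Rmult_le_compat_l; auto.
    rewrite <- H5, <- lsum_const. apply lsum_le. intros [i y] Hi. simpl. specialize (H7 i y Hi).
    apply pow_incr. specialize (Hlam i). lra.
Qed.

Lemma cluster_point_nonneg lam L : (forall i, 0 < lam i) -> cluster_point lam L -> 0 <= L.
Proof.
  intros Hlam HL. apply Rnot_lt_le. intros Hlt. destruct (HL (- L) ltac:(lra) O) as (i & _ & Hi).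
  specialize (Hlam i). apply Rabs_def2 in Hi. lra.
Qed.

Lemma rates_near_cluster {d} (K : rset d) lam kap th L :
  (1 <= d)%nat -> convex_body K -> is_vol K kap -> (forall i, 0 < lam i) -> cluster_point lam L -> L <> 0 ->
  is_transl_cov_density K th -> 0 <= th ->
  exists e : nat -> R, (forall n, 0 <= e n) /\ Un_cv e 0 /\
    forall n N, batch_cover K lam kap N (cube origin (2 ^ n)) ((th + e n) * (2 ^ n) ^ d).
Proof.
  intros Hd HK Hvol Hlam HL HL0 [_ Hth] Hth0.
  assert (Hint : nonempty_interior K) by (destruct HK as (_ & _ & _ & ?); auto).
  assert (Hkap := interior_vol_pos K kap Hvol Hint).
  assert (HLpos : 0 < L) by (assert (H := cluster_point_nonneg lam L Hlam HL); lra).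
  assert (Hgood : forall eps, 0 < eps -> exists n0, forall n, (n0 <= n)%nat -> forall N,
     batch_cover K lam kap N (cube origin (2 ^ n)) ((th + eps) * (2 ^ n) ^ d)).
  { intros eps Heps.
    destruct (tends_le_eventually (fun r => (th + eps / 2) * ((r + 2) / r) ^ d) (th + eps / 2) (th + eps)) as [R0 HR0].
    { eapply tends_eq; [apply tends_mult; [apply tends_const|apply tends_ratio]|ring]. }
    { lra. }
    pose (rho := Rmax R0 1). specialize (HR0 rho (Rmax_l _ _)).
    (* With this [dl] the quotient (1 + dl) / (1 - dl) equals (rho + 2) / rho, whose d-th power has
       been controlled by the choice of rho. *)
    assert (Hrho : 1 <= rho) by apply Rmax_r. pose (dl := / (rho + 1)).
    assert (Hdl : 0 < dl < 1).
    { unfold dl. split; [apply Rinv_0_lt_compat; lra|]. rewrite <- Rinv_1. apply Rinv_lt_contravar; lra. }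
    assert (Hv : exists v, (exists x : nat -> pt d, covers (fun i => hom (x i) 1 K) /\ density_is (fun i => hom (x i) 1 K) v) /\ v < th + eps / 4).
    { apply NNPP. intros Hn. assert (th + eps / 4 <= th); [|lra]. apply Hth. intros v Hv.
      apply Rnot_lt_le. intros Hlt. apply Hn. exists v; auto. }
    destruct Hv as (v & (x & Hx1 & Hx2) & Hv).
    destruct (translate_cover_cube K kap x v (eps / 4) Hd HK Hvol Hx1 Hx2) as (s0 & Hs0 & Hs); [lra|].
    set (mu := L * (1 - dl)). assert (Hmu : 0 < mu) by (apply Rmult_lt_0_compat; lra).
    destruct (Pow_x_infinity 2) with (b := s0 * mu) as [n0 Hn0]; [rewrite Rabs_right; lra|].
    exists n0. intros n Hn N. specialize (Hn0 n Hn).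
    assert (H2 : 0 < 2 ^ n) by (apply pow_lt; lra).
    rewrite Rabs_right in Hn0 by lra.
    destruct (Hs (2 ^ n / mu)) as (l & Hl1 & Hl2).
    { apply (Rmult_le_reg_r mu); auto. unfold Rdiv. rewrite Rmult_assoc, Rinv_l by lra. lra. }
    apply (batch_cover_subset K lam kap N _ (cube origin (2 ^ n)) (kap * INR (length l) * (L * (1 + dl)) ^ d)).
    - intros p Hp; auto.
    - apply Rle_trans with (((th + eps / 2) * (2 ^ n / mu) ^ d) * (L * (1 + dl)) ^ d).
      + apply Rmult_le_compat_r; [apply pow_le, Rmult_le_pos; lra|].
        eapply Rle_trans; [apply Hl2|]. apply Rmult_le_compat_r; [|lra].
        apply pow_le. apply Rle_mult_inv_pos; lra.
      + rewrite Rmult_assoc, <- Rpow_mult_distr.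
        replace (2 ^ n / mu * (L * (1 + dl))) with ((rho + 2) / rho * 2 ^ n).
        * rewrite Rpow_mult_distr, <- Rmult_assoc. apply Rmult_le_compat_r; [apply pow_le; lra|auto].
        * unfold mu, dl. field. repeat split; lra.
    - apply batch_near_cluster; auto; try lra; [apply HK|apply nonempty_interior_point; auto]. }
  apply (rate_sequence (fun n e => forall N, batch_cover K lam kap N (cube origin (2 ^ n)) ((th + e) * (2 ^ n) ^ d))).
  (* For small n any finite rate is enough: the cube lies in the one of side 2^(n + n1), for which
     the rate 1 is already available. *)
  - intros n. destruct (Hgood 1 Rlt_0_1) as [n1 Hn1]. specialize (Hn1 (n + n1)%nat ltac:(lia)).
    assert (H2 : 0 < (2 ^ n) ^ d) by (apply pow_lt, pow_lt; lra).
    assert (H3 : 0 <= (2 ^ (n + n1)) ^ d) by (apply pow_le, pow_le; lra).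
    exists ((th + 1) * (2 ^ (n + n1)) ^ d / (2 ^ n) ^ d). split.
    + apply Rle_mult_inv_pos; auto. apply Rmult_le_pos; lra.
    + intros N. eapply batch_cover_subset; [| |apply Hn1].
      * intros p Hp j. specialize (Hp j). assert (2 ^ n <= 2 ^ (n + n1)) by (apply Rle_pow; [lra|lia]). lra.
      * replace ((th + (th + 1) * (2 ^ (n + n1)) ^ d / (2 ^ n) ^ d) * (2 ^ n) ^ d) with (th * (2 ^ n) ^ d + (th + 1) * (2 ^ (n + n1)) ^ d) by (field; lra).
        assert (0 <= th * (2 ^ n) ^ d) by (apply Rmult_le_pos; lra). lra.
  - exact Hgood.
Qed.

(** * Existence of the translative covering density, and part (a) *)

Lemma interior_cube {d} (K : rset d) : nonempty_interior K -> exists c a, 0 < a /\ subset (cube c a) K.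
Proof.
  intros (c & e & He & HA). assert (Hd := pos_INR d). exists c, (e / (INR d + 1)).
  assert (Hs : 0 < e / (INR d + 1)) by (apply Rdiv_lt_0_compat; lra). split; auto.
  intros p Hp. apply HA. apply Rle_lt_trans with (INR d * (e / (INR d + 1))).
  - apply enorm_le_coord; [lra|]. intros j. specialize (Hp j). rewrite Rabs_right; lra.
  - apply (Rmult_lt_reg_r (INR d + 1)); [lra|]. field_simplify; [|lra]. nra.
Qed.

Lemma subdivide_cube {d} (a : pt d) s M p : 0 < s -> (0 < M)%nat -> cube a s p ->
  exists z, In z (ngrid d M) /\ cube (fun j => a j + INR (z j) * (s / INR M)) (s / INR M) p.
Proof.
  intros Hs HM Hp. assert (HM' : 0 < INR M) by (apply (lt_INR 0); auto).
  set (h := s / INR M). assert (Hh : 0 < h) by (apply Rdiv_lt_0_compat; auto).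
  assert (Es : s = INR M * h) by (unfold h; field; lra).
  destruct (choice (fun j k => (k < M)%nat /\ a j + INR k * h <= p j <= a j + INR k * h + h)) as [z Hz].
  { intros j. specialize (Hp j). rewrite Es in Hp.
    destruct (Rlt_dec (p j) (a j + INR M * h)) as [H|H].
    - destruct (nat_floor M ((p j - a j) / h)) as (k & Hk & Hk').
      + split; [apply Rle_mult_inv_pos; lra|]. apply (Rmult_lt_reg_r h); auto. unfold Rdiv. rewrite Rmult_assoc, Rinv_l by lra. lra.
      + exists k. split; auto.
        assert (E : p j - a j = (p j - a j) / h * h) by (field; lra). set (y := (p j - a j) / h) in *.
        assert (INR k * h <= y * h) by (apply Rmult_le_compat_r; lra).
        assert (y * h <= (INR k + 1) * h) by (apply Rmult_le_compat_r; lra). lra.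
    - exists (M - 1)%nat. split; [lia|]. rewrite minus_INR by lia. simpl (INR 1). lra. }
  exists z. split; [apply in_ngrid; apply Hz|]. intros j. apply Hz.
Qed.

Lemma seq_combine {A} N (l : list A) : exists l' : list (nat * A),
  in_range N (N + length l) l' /\ functional l' /\ length l' = length l /\ forall y, In y l -> exists i, In (i, y) l'.
Proof.
  revert N. induction l as [|a l IH]; intros N.
  - exists nil. split; [intros i x []|]. split; [intros i x x' []|]. split; auto. intros y [].
  - destruct (IH (S N)) as (l' & H1 & H2 & H3 & H4).
    assert (R1 : in_range N (S N) ((N, a) :: nil)).
    { intros i' x [E|[]]. injection E as <- <-. lia. }
    exists (((N, a) :: nil) ++ l'). split; [|split; [|split]].
    + replace (N + length (a :: l))%nat with (S N + length l)%nat by (simpl; lia).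
      apply (in_range_app N (S N)); auto; lia.
    + apply (functional_app N (S N) (S N + length l)); auto.
      intros i' x x' [E|[]] [E'|[]]. congruence.
    + simpl; auto.
    + intros y [<-|Hy]; [exists N; simpl; auto|]. destruct (H4 y Hy) as [i' Hi'']. exists i'; simpl; auto.
Qed.

(** K contains a cube of side a, and M = floor(2^n / a) + 1 pieces per edge are fine enough; M <=
    2^n (1/a + 1) gives the constant. *)
Lemma batch_constant_family {d} (K : rset d) kap : 0 <= kap -> nonempty_interior K ->
  exists C, 0 <= C /\ forall n N, batch_cover K (fun _ => 1) kap N (cube origin (2 ^ n)) (C * (2 ^ n) ^ d).
Proof.
  intros Hkap Hint. destruct (interior_cube K Hint) as (c & a & Ha & HK).
  assert (Hia : 0 < / a) by (apply Rinv_0_lt_compat; auto).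
  exists (kap * (/ a + 1) ^ d). split; [apply Rmult_le_pos; auto; apply pow_le; lra|].
  intros n N. assert (H2 : 1 <= 2 ^ n) by (apply pow_R1_Rle; lra).
  destruct (nat_floor_nonneg (2 ^ n / a)) as (k & Hk1 & Hk2); [apply Rle_mult_inv_pos; lra|].
  pose (M := S k).
  assert (HM : 0 < INR M) by (apply (lt_INR 0); unfold M; lia).
  assert (HM1 : INR M <= 2 ^ n * (/ a + 1)) by (unfold M; rewrite S_INR; unfold Rdiv in Hk1; lra).
  assert (HM2 : 2 ^ n / INR M <= a).
  { unfold M in *. rewrite S_INR in *. apply (Rmult_le_reg_r (INR k + 1)); auto.
    unfold Rdiv at 1. rewrite Rmult_assoc, Rinv_l by lra.
    apply (Rmult_lt_compat_r a) in Hk2; auto. unfold Rdiv in Hk2. rewrite Rmult_assoc, Rinv_l in Hk2 by lra. lra. }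
  set (h := 2 ^ n / INR M) in *.
  destruct (seq_combine (A := pt d) N (map (fun z (j : Fin.t d) => INR (z j) * h - c j) (ngrid d M))) as (l & L1 & L2 & L3 & L4).
  rewrite length_map, ngrid_length in L1, L3.
  exists (N + M ^ d)%nat, l. split; [lia|]. split; auto. split; auto. split.
  - intros p Hp. destruct (subdivide_cube origin (2 ^ n) M p) as (z & Hz & Hzp); auto; [lra|unfold M; lia|].
    destruct (L4 (fun j => INR (z j) * h - c j)) as [i Hi]; [apply in_map_iff; exists z; auto|].
    exists i, (fun j => INR (z j) * h - c j). split; auto.
    exists (fun j => p j - INR (z j) * h + c j). split; [|intros j; ring].
    apply HK. intros j. specialize (Hzp j). unfold origin in Hzp. fold h in Hzp. simpl in *. lra.
  - rewrite (lsum_ext _ (fun _ => 1)) by (intros; apply pow1). rewrite lsum_const, L3, pow_INR.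
    rewrite Rmult_1_r, Rmult_assoc. apply Rmult_le_compat_l; auto.
    rewrite <- Rpow_mult_distr. apply pow_incr. split; [lra|]. lra.
Qed.

(** The infimum exists as soon as some covering by translates has a density. Applying
    [exact_density_cover] to the constant family lam_i = 1, with the crude rate [C] as target,
    produces one of density [C]. *)
Lemma transl_cov_density_exists {d} (K : rset d) : (1 <= d)%nat -> convex_body K ->
  exists th, is_transl_cov_density K th /\ 0 <= th.
Proof.
  intros Hd HK. destruct (HK) as (_ & _ & Hb & Hint).
  destruct (bounded_vol K Hd Hb) as [kap Hvol].
  assert (Hkap := interior_vol_pos K kap Hvol Hint).
  destruct (batch_constant_family K kap (Rlt_le _ _ Hkap) Hint) as (C & HC & Hbatch).
  destruct (exact_density_cover K (fun _ => 1) kap C (fun _ => 0) 1) as (x & Hx1 & Hx2); auto.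
  - intros _; lra.
  - intros B. destruct (INR_archimed 1 B) as [N HN]; [lra|]. exists N. intros n Hn.
    rewrite sum_f_R0_lsum, (lsum_ext _ (fun _ => 1)) by (intros; apply pow1).
    rewrite lsum_const, length_seq, S_INR. apply le_INR in Hn. lra.
  - intros _; lra.
  - intros eps He. exists O. intros n _. rewrite Rdist_eq; auto.
  - intros n N. rewrite Rplus_0_r. apply Hbatch.
  - destruct (is_inf_exists (fun v => exists x : nat -> pt d,
             covers (fun i => hom (x i) 1 K) /\ density_is (fun i => hom (x i) 1 K) v)) as [th Hth].
    + exists C, x; auto.
    + exists 0. intros v (y & _ & Hy). apply (density_nonneg _ _ Hd Hy).
    + exists th. split; auto. apply Hth. intros v (y & _ & Hy). apply (density_nonneg _ _ Hd Hy).
Qed.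

Lemma cover_nonzero_cluster {d} (K : rset d) (lam : nat -> R) M L :
  (1 <= d)%nat -> convex_body K -> (forall i, 0 < lam i <= M) ->
  cv_infty (fun n => sum_f_R0 (fun i => lam i ^ d) n) -> L <> 0 -> cluster_point lam L ->
  exists th, is_transl_cov_density K th /\
    exists x : nat -> pt d, covers (fun i => hom (x i) (lam i) K) /\ density_is (fun i => hom (x i) (lam i) K) th.
Proof.
  intros Hd HK Hlam Hdiv HL0 HL. destruct (HK) as (_ & _ & Hb & Hint).
  destruct (bounded_vol K Hd Hb) as [kap Hvol].
  destruct (transl_cov_density_exists K Hd HK) as (th & Hth & Hth0). exists th. split; auto.
  destruct (rates_near_cluster K lam kap th L) as (e & He & He0 & Hbatch); auto; [apply Hlam|].
  apply (exact_density_cover K lam kap th e M); auto.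
Qed.

(** * Small homothets: covering a cube almost without overlap *)

Lemma functional_map {A B} (g : nat -> A -> B) l :
  functional l -> functional (map (fun q => (fst q, g (fst q) (snd q))) l).
Proof.
  intros H i x x' Hi Hi'. apply in_map_iff in Hi, Hi'. destruct Hi as ([i1 x1] & E1 & Hi1).
  destruct Hi' as ([i2 x2] & E2 & Hi2). injection E1 as <- <-. injection E2 as E <-.
  simpl in *. subst. rewrite (H _ _ _ Hi1 Hi2); auto.
Qed.

Lemma in_range_map {A B} (g : nat -> A -> B) N N' l :
  in_range N N' l -> in_range N N' (map (fun q => (fst q, g (fst q) (snd q))) l).
Proof.
  intros H i x Hi. apply in_map_iff in Hi. destruct Hi as ([i' x'] & E & Hi).
  injection E as <- <-. eauto.
Qed.

Lemma functional_combine {A} (I : list nat) (V : list A) : NoDup I -> functional (combine I V).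
Proof.
  revert V. induction I as [|i I IH]; intros V Hn; [intros j x x' []|].
  inversion_clear Hn. destruct V as [|v V]; [intros j x x' []|].
  intros j x x' [E|Hj] [E'|Hj'].
  - congruence.
  - injection E as <- <-. apply in_combine_l in Hj'. tauto.
  - injection E' as <- <-. apply in_combine_l in Hj. tauto.
  - apply (IH V H0 j); auto.
Qed.

Lemma in_combine_firstn {A B} (I : list A) (V : list B) v :
  In v (firstn (length I) V) -> exists i, In (i, v) (combine I V).
Proof.
  revert V. induction I as [|i I IH]; intros V; simpl; [tauto|].
  destruct V as [|w V]; simpl; [tauto|]. intros [<-|H]; [exists i; auto|].
  destruct (IH V H) as [j Hj]. exists j; auto.
Qed.

Lemma in_combine_left {A B} (I : list A) (V : list B) i :
  In i I -> (length I <= length V)%nat -> exists v, In (i, v) (combine I V).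
Proof.
  revert V. induction I as [|j I IH]; intros V; simpl; [tauto|].
  destruct V as [|w V]; simpl; [lia|]. intros [<-|H] L; [exists w; auto|].
  destruct (IH V H) as [v Hv]; [lia|]. exists v; auto.
Qed.

Lemma halving_level y s : 0 < y <= s -> exists k, y <= s / 2 ^ k < 2 * y.
Proof.
  intros Hy. destruct (nat_least (fun k => s / 2 ^ k < 2 * y)) as (k & Hk & Hmin).
  - destruct (Pow_x_infinity 2) with (b := s / y) as [n Hn]; [rewrite Rabs_right; lra|].
    exists n. specialize (Hn n (Nat.le_refl _)). assert (0 < 2 ^ n) by (apply pow_lt; lra).
    rewrite Rabs_right in Hn by lra. apply (Rmult_lt_reg_r (2 ^ n)); auto.
    replace (s / 2 ^ n * 2 ^ n) with (s / y * y) by (field; lra).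
    assert (s / y * y <= 2 ^ n * y) by (apply Rmult_le_compat_r; lra).
    assert (0 < 2 ^ n * y) by (apply Rmult_lt_0_compat; lra). lra.
  - exists k. split; auto. destruct k as [|k]; [simpl; lra|].
    apply Rnot_lt_le. intros Hlt. assert (S k <= k)%nat; [|lia]. apply Hmin.
    assert (0 < 2 ^ k) by (apply pow_lt; lra).
    replace (s / 2 ^ k) with (2 * (s / 2 ^ S k)) by (simpl; field; lra). lra.
Qed.

(* Greedy by decreasing size: at level k the bodies with container side s / 2^k each take one
   of the free cubes of that side, and the cubes left over are halved. If free cubes survived
   all levels, the containers of all bodies would have total volume at most s^d. *)
Lemma container_tiling {d} (lam : nat -> R) w (a : pt d) s N :
  0 < w -> 0 < s -> (forall i, 0 < lam i) -> Un_cv lam 0 -> diverges (fun i => lam i ^ d) ->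
  exists N' (l : list (nat * (pt d * R))), (N <= N')%nat /\ in_range N N' l /\ functional l /\
    (forall p, cube a s p -> exists i q, In (i, q) l /\ cube (fst q) (snd q) p) /\
    (forall i q, In (i, q) l -> w * lam i <= snd q <= 2 * w * lam i) /\
    lsum (fun iq => snd (snd iq) ^ d) l = s ^ d.
Proof.
  intros Hw Hs Hlam Hcv Hdiv.
  assert (Hsmall : forall eps, 0 < eps -> exists n, forall i, (n <= i)%nat -> w * lam i <= eps).
  { intros eps He. destruct (Hcv (eps / w)) as [n Hn]; [apply Rdiv_lt_0_compat; auto|].
    exists n. intros i Hi. specialize (Hn i Hi). unfold Rdist in Hn. apply Rabs_def2 in Hn.
    replace eps with (w * (eps / w)) by (field; lra). apply Rmult_le_compat_l; lra. }
  (* From [N0] on, w lam_i <= s, so that every body is assigned a level. *)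
  destruct (Hsmall s Hs) as [n1 Hn1]. pose (N0 := (N + n1)%nat).
  assert (Hlev : forall i, exists k, (N0 <= i)%nat -> w * lam i <= s / 2 ^ k < 2 * (w * lam i)).
  { intros i. destruct (Compare_dec.le_dec N0 i) as [H|H]; [|exists O; tauto].
    destruct (halving_level (w * lam i) s) as [k Hk]; [|exists k; auto].
    split; [apply Rmult_lt_0_compat; auto|]. apply Hn1. unfold N0 in H; lia. }
  destruct (choice _ Hlev) as [lev Hlev'].
  pose (vol := fun iq : nat * (pt d * R) => snd (snd iq) ^ d).
  pose (good := fun l : list (nat * (pt d * R)) => (exists N', (N0 <= N')%nat /\ in_range N0 N' l) /\ functional l /\
     forall i q, In (i, q) l -> w * lam i <= snd q <= 2 * w * lam i).
  pose (complete := exists l, good l /\ (forall p, cube a s p -> exists i q, In (i, q) l /\ cube (fst q) (snd q) p) /\ lsum vol l = s ^ d).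
  assert (Hstep : forall k, complete \/ exists l (U : list (pt d)), good l /\
     (forall p, cube a s p -> (exists i q, In (i, q) l /\ cube (fst q) (snd q) p) \/ exists u, In u U /\ cube u (s / 2 ^ k) p) /\
     lsum vol l + INR (length U) * (s / 2 ^ k) ^ d = s ^ d /\
     (forall i, (N0 <= i)%nat -> (lev i < k)%nat -> exists q, In (i, q) l) /\
     (forall i q, In (i, q) l -> (lev i < k)%nat)).
  { induction k as [|k [IH|(l & U & (((N1 & HN1 & R1) & F1 & S1) & C1 & V1 & A1 & B1))]]; [|left; auto|].
    - right. exists nil, (a :: nil). split; [|split; [|split; [|split]]].
      + split; [exists N0; split; [lia|intros i q []]|]. split; [intros i q q' []|intros i q []].
      + intros p Hp. right. exists a. split; [left; auto|]. simpl. replace (s / 1) with s by field. auto.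
      + simpl. replace (s / 1) with s by field. ring.
      + intros; lia.
      + intros i q [].
    - assert (H2k : 0 < 2 ^ k) by (apply pow_lt; lra).
      set (h := s / 2 ^ k) in *. assert (Hh : 0 < h) by (apply Rdiv_lt_0_compat; auto).
      destruct (Hsmall (h / 2) ltac:(lra)) as [B HB].
      (* The bodies of level k; since lam_i tends to 0, they all have index below [B]. Their number
         need not match that of the free cubes: [combine] stops at the shorter list. *)
      pose (I := cfilter (fun i => lev i = k) (seq N0 B)).
      assert (HI : forall i, In i I <-> (N0 <= i)%nat /\ lev i = k).
      { intros i. unfold I. rewrite in_cfilter, in_seq. split; [intuition|]. intros [H1 H2]. split; auto. split; auto.
        destruct (le_lt_dec B i) as [L|L]; [|lia]. specialize (HB i L). specialize (Hlev' i H1).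
        rewrite H2 in Hlev'. fold h in Hlev'. lra. }
      assert (HIn : NoDup I) by (apply NoDup_cfilter, seq_NoDup).
      pose (new := combine I (map (fun u => (u, h)) U)).
      assert (Hnew : forall i q, In (i, q) new -> In i I /\ snd q = h).
      { intros i q H. split; [apply in_combine_l in H; auto|]. apply in_combine_r, in_map_iff in H.
        destruct H as (u & <- & _); auto. }
      assert (Hnewvol : lsum vol new = INR (length new) * h ^ d).
      { rewrite <- lsum_const. apply lsum_ext. intros [i q] H. apply Hnew in H. unfold vol. simpl. destruct H as [_ ->]; auto. }
      assert (Hlen : length new = Nat.min (length I) (length U)).
      { unfold new. rewrite length_combine, length_map; auto. }
      assert (Hgood : good (l ++ new)).
      { split; [|split].
        - destruct (list_max_bound I) as [m Hm]. exists (N1 + m)%nat. split; [lia|]. intros i q H.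
          apply in_app_iff in H. destruct H as [H|H]; [apply R1 in H; lia|].
          destruct (Hnew _ _ H) as [Hi _]. assert (K := Hm i Hi). apply HI in Hi. lia.
        - intros i q q' H H'. apply in_app_iff in H, H'. destruct H as [H|H], H' as [H'|H'].
          + eauto.
          + apply B1 in H. apply Hnew in H'. destruct H' as [H' _]. apply HI in H'. lia.
          + apply B1 in H'. apply Hnew in H. destruct H as [H _]. apply HI in H. lia.
          + apply (functional_combine I _ HIn i q q' H H').
        - intros i q H. apply in_app_iff in H. destruct H as [H|H]; [auto|].
          apply Hnew in H. destruct H as [H ->]. apply HI in H. destruct H as [H1 H2].
          specialize (Hlev' i H1). rewrite H2 in Hlev'. fold h in Hlev'. lra. }
      assert (Hfirst : forall u p, In u (firstn (length I) U) -> cube u h p -> exists i q, In (i, q) (l ++ new) /\ cube (fst q) (snd q) p).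
      { intros u p Hu Hp. destruct (in_combine_firstn I (map (fun u => (u, h)) U) (u, h)) as [i Hi].
        - rewrite firstn_map. apply in_map_iff. exists u; auto.
        - exists i, (u, h). split; auto. apply in_app_iff; auto. }
      destruct (le_lt_dec (length U) (length I)) as [L|L].
      + left. exists (l ++ new). split; auto. split.
        * intros p Hp. destruct (C1 p Hp) as [(i & q & Hi & Hq)|(u & Hu & Hup)].
          -- exists i, q. split; auto. apply in_app_iff; auto.
          -- apply (Hfirst u); auto. rewrite firstn_all2; auto.
        * rewrite lsum_app, Hnewvol, Hlen, Nat.min_r; auto.
      + right. pose (split := fun u : pt d => map (fun z (j : Fin.t d) => u j + INR (z j) * (h / INR 2)) (ngrid d 2)).
        exists (l ++ new), (flat_map split (skipn (length I) U)).
        assert (Eh : s / 2 ^ S k = h / INR 2) by (unfold h; simpl; field; lra). rewrite Eh.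
        split; auto. split; [|split; [|split]].
        * intros p Hp. destruct (C1 p Hp) as [(i & q & Hi & Hq)|(u & Hu & Hup)].
          -- left. exists i, q. split; auto. apply in_app_iff; auto.
          -- rewrite <- (firstn_skipn (length I) U) in Hu. apply in_app_iff in Hu.
             destruct Hu as [Hu|Hu]; [left; apply (Hfirst u); auto|]. right.
             destruct (subdivide_cube u h 2 p Hh ltac:(lia) Hup) as (z & Hz & Hzp).
             exists (fun j => u j + INR (z j) * (h / INR 2)). split; auto.
             apply in_flat_map. exists u. split; auto. apply in_map_iff. exists z; auto.
        * rewrite lsum_app, Hnewvol, Hlen, Nat.min_l by lia.
          assert (El : forall V, INR (length (flat_map split V)) * (h / INR 2) ^ d = INR (length V) * h ^ d).
          { intros V. assert (E2 : h ^ d = INR (2 ^ d) * (h / INR 2) ^ d).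
            { rewrite pow_INR, <- Rpow_mult_distr. f_equal. simpl; field. }
            rewrite E2. induction V as [|u V IHV]; [simpl; ring|].
            simpl flat_map. rewrite length_app, plus_INR, Rmult_plus_distr_r, IHV.
            unfold split. rewrite length_map, ngrid_length. simpl length. rewrite (S_INR (length V)). ring. }
          rewrite El, length_skipn, minus_INR by lia. lra.
        * intros i Hi Hk. destruct (Nat.eq_dec (lev i) k) as [E|E].
          -- destruct (in_combine_left I (map (fun u => (u, h)) U) i) as [q Hq].
             ++ apply HI; auto.
             ++ rewrite length_map; lia.
             ++ exists q. apply in_app_iff; auto.
          -- destruct (A1 i Hi ltac:(lia)) as [q Hq]. exists q. apply in_app_iff; auto.
        * intros i q H. apply in_app_iff in H. destruct H as [H|H]; [apply B1 in H; lia|].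
          apply Hnew in H. destruct H as [H _]. apply HI in H. lia. }
  assert (Hcomplete : complete).
  (* The bodies before [m] need containers of total volume at least s^d + 1. Once all their levels
     have been processed they would all be in [l], whose volume is at most s^d. *)
  { destruct (Hdiv N0 ((s ^ d + 1) / w ^ d)) as (m & Hm & Hsum).
    destruct (list_max_bound (map lev (seq N0 (m - N0)))) as [k Hk].
    destruct (Hstep k) as [H|(l & U & (_ & _ & S1) & C1 & V1 & A1 & B1)]; auto. exfalso.
    assert (Hq : forall i, exists q, In i (seq N0 (m - N0)) -> In (i, q) l).
    { intros i. destruct (classic (In i (seq N0 (m - N0)))) as [H|H]; [|exists (a, 0); tauto].
      destruct (A1 i) as [q Hq]; [apply in_seq in H; lia|apply Hk, in_map; auto|exists q; auto]. }
    destruct (choice _ Hq) as [qq Hqq].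
    assert (Hwd : 0 < w ^ d) by (apply pow_lt; auto).
    assert (H1 : w ^ d * lsum (fun i => lam i ^ d) (seq N0 (m - N0)) <= lsum vol l).
    { apply Rle_trans with (lsum vol (map (fun i => (i, qq i)) (seq N0 (m - N0)))).
      - rewrite lsum_map, <- lsum_scal. apply lsum_le. intros i Hi. unfold vol. simpl.
        rewrite <- Rpow_mult_distr. apply pow_incr. specialize (S1 _ _ (Hqq i Hi)).
        assert (0 < w * lam i) by (apply Rmult_lt_0_compat; auto). lra.
      - apply lsum_incl.
        + intros [i q] Hi. apply pow_le. simpl. specialize (S1 _ _ Hi).
          assert (0 < w * lam i) by (apply Rmult_lt_0_compat; auto). lra.
        + apply NoDup_map_NoDup_ForallPairs; [|apply seq_NoDup]. intros x y _ _ E; congruence.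
        + intros iq Hiq. apply in_map_iff in Hiq. destruct Hiq as (i & <- & Hi). auto. }
    assert (H2 : w ^ d * ((s ^ d + 1) / w ^ d) <= w ^ d * lsum (fun i => lam i ^ d) (seq N0 (m - N0)))
      by (apply Rmult_le_compat_l; lra).
    replace (w ^ d * ((s ^ d + 1) / w ^ d)) with (s ^ d + 1) in H2 by (field; lra).
    assert (0 <= INR (length U) * (s / 2 ^ k) ^ d).
    { apply Rmult_le_pos; [apply pos_INR|]. apply pow_le. apply Rle_mult_inv_pos; [lra|apply pow_lt; lra]. }
    lra. }
  destruct Hcomplete as (l & ((N1 & HN1 & R1) & F1 & S1) & C1 & V1).
  exists N1, l. split; [unfold N0 in HN1; lia|]. split; auto.
  intros i q Hi. specialize (R1 _ _ Hi). unfold N0 in R1. lia.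
Qed.

Lemma batch_cover_union {d} (K : rset d) lam kap N A B W W' :
  (forall N, batch_cover K lam kap N A W) -> (forall N, batch_cover K lam kap N B W') ->
  batch_cover K lam kap N (fun p => A p \/ B p) (W + W').
Proof.
  intros HA HB. destruct (HA N) as (N1 & l1 & A1 & A2 & A3 & A4 & A5).
  destruct (HB N1) as (N2 & l2 & B1 & B2 & B3 & B4 & B5).
  exists N2, (l1 ++ l2). split; [lia|]. split; [apply (in_range_app N N1 N2); auto|].
  split; [apply (functional_app N N1 N2); auto|]. split.
  - intros p [Hp|Hp]; [destruct (A4 p Hp) as (i & x & Hi & Hx)|destruct (B4 p Hp) as (i & x & Hi & Hx)];
      exists i, x; rewrite in_app_iff; auto.
  - rewrite lsum_app. lra.
Qed.

Definition union_cubes {d} (Q : list (pt d * R)) : rset d := fun p => exists q, In q Q /\ cube (fst q) (snd q) p.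
(** The volumes are added with multiplicity; the cubes of a list may overlap, and no disjointness is
    tracked. *)
Definition cubes_vol {d} (Q : list (pt d * R)) : R := lsum (fun q => snd q ^ d) Q.

Lemma cubes_vol_nonneg {d} (Q : list (pt d * R)) : (forall q, In q Q -> 0 < snd q) -> 0 <= cubes_vol Q.
Proof. intros H. apply lsum_nonneg. intros q Hq. apply pow_le, Rlt_le, H; auto. Qed.

(** K contains a cube of side w' = 2w, and the container of body i has side between w lam_i and 2 w
    lam_i. So each body covers its container alone, with volume at most kap / w^d times that of the
    container. *)
Lemma crude_cover {d} (K : rset d) lam kap : nonempty_interior K -> 0 <= kap ->
  (forall i, 0 < lam i) -> Un_cv lam 0 -> diverges (fun i => lam i ^ d) ->
  exists C, 0 <= C /\ forall (Q : list (pt d * R)) N, (forall q, In q Q -> 0 < snd q) ->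
    batch_cover K lam kap N (union_cubes Q) (C * cubes_vol Q).
Proof.
  intros Hint Hkap Hlam Hcv Hdiv. destruct (interior_cube K Hint) as (c & w' & Hw' & HK).
  pose (w := w' / 2). assert (Hw : 0 < w) by (unfold w; lra).
  assert (Hwd : 0 < w ^ d) by (apply pow_lt; auto).
  exists (kap / w ^ d). split; [apply Rle_mult_inv_pos; auto|].
  assert (Hone : forall a s N, 0 < s -> batch_cover K lam kap N (cube a s) (kap / w ^ d * s ^ d)).
  { intros a s N Hs. destruct (container_tiling lam w a s N Hw Hs Hlam Hcv Hdiv) as (N' & l & H1 & H2 & H3 & H4 & H5 & H6).
    pose (pos := fun i (q : pt d * R) (j : Fin.t d) => fst q j - lam i * c j).
    exists N', (map (fun iq => (fst iq, pos (fst iq) (snd iq))) l).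
    split; auto. split; [apply (in_range_map pos); auto|]. split; [apply (functional_map pos); auto|]. split.
    - intros p Hp. destruct (H4 p Hp) as (i & q & Hi & Hq). exists i, (pos i q). split.
      + apply in_map_iff. exists (i, q); auto.
      + specialize (H5 i q Hi). specialize (Hlam i). exists (fun j => (p j - fst q j) / lam i + c j). split.
        * apply HK. intros j. specialize (Hq j). split.
          -- assert (0 <= (p j - fst q j) / lam i) by (apply Rle_mult_inv_pos; lra). lra.
          -- assert ((p j - fst q j) / lam i <= w'); [|lra].
             apply (Rmult_le_reg_r (lam i)); auto. unfold Rdiv. rewrite Rmult_assoc, Rinv_l by lra.
             unfold w in H5. lra.
        * intros j. unfold pos. field. lra.
    - rewrite lsum_map. simpl. unfold Rdiv. rewrite Rmult_assoc. apply Rmult_le_compat_l; auto.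
      rewrite <- H6, <- lsum_scal. apply lsum_le. intros [i q] Hi. simpl. specialize (H5 i q Hi).
      apply (Rmult_le_reg_l (w ^ d)); auto. rewrite <- Rmult_assoc, Rinv_r, Rmult_1_l by lra.
      rewrite <- Rpow_mult_distr. apply pow_incr. split; [|lra]. apply Rmult_le_pos; [lra|]. specialize (Hlam i); lra. }
  intros Q. induction Q as [|q Q IH]; intros N HQ.
  - exists N, nil. split; auto. split; [intros i x []|]. split; [intros i x x' []|].
    split; [intros p (q & [] & _)|]. unfold cubes_vol; simpl; lra.
  - apply (batch_cover_subset K lam kap N _ (fun p => cube (fst q) (snd q) p \/ union_cubes Q p) (kap / w ^ d * snd q ^ d + kap / w ^ d * cubes_vol Q)).
    + intros p (q' & [<-|Hq'] & Hp); [left; auto|right; exists q'; auto].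
    + unfold cubes_vol; simpl. lra.
    + apply batch_cover_union; intros N1.
      * apply Hone. apply HQ; simpl; auto.
      * apply IH. intros q' Hq'; apply HQ; simpl; auto.
Qed.

(** [K'] is K contracted towards an interior point c by the factor 1 - eta, so points within eta rho
    of [K'] belong to K. Fine grid cubes meeting [K'] are therefore inside K and can be left out of
    [Q]; they cover [K'], hence have total volume at least (1 - eta)^d kap. *)
Lemma inner_approximation {d} (K : rset d) kap b w eps : (1 <= d)%nat -> convex_body K -> is_vol K kap ->
  0 < w -> subset K (cube b w) -> 0 < eps ->
  exists M, (0 < M)%nat /\ forall tau, w <= tau <= 2 * w -> exists Q : list (pt d * R),
    (forall q, In q Q -> 0 < snd q) /\
    (forall p, cube b tau p -> K p \/ union_cubes Q p) /\
    cubes_vol Q <= tau ^ d - (1 - eps) * kap.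
Proof.
  intros Hd (Hconv & _ & _ & (c & rho & Hrho & Hball)) Hvol Hw HKb Heps.
  assert (Hkap := is_vol_nonneg _ _ Hvol).
  assert (Heta : exists eta, 0 < eta < 1 /\ (1 - eps) <= (1 - eta) ^ d).
  { destruct (pow_shift_cont d (-1) eps Heps) as (e0 & He0 & H).
    pose (eta := Rmin e0 (/ 2)). assert (0 < eta) by (apply Rmin_glb_lt; lra).
    assert (eta <= / 2) by apply Rmin_r. exists eta. split; [lra|].
    assert (H2 : 0 <= eta <= e0) by (split; [lra|apply Rmin_l]). specialize (H eta H2).
    replace (-1 + eta) with ((-1) * (1 - eta)) in H by ring. rewrite Rpow_mult_distr in H.
    replace ((-1) ^ d * (1 - eta) ^ d - (-1) ^ d) with ((-1) ^ d * ((1 - eta) ^ d - 1)) in H by ring.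
    rewrite Rabs_mult, <- RPow_abs in H. rewrite (Rabs_left (-1)) in H by lra.
    replace (- -1) with 1 in H by ring. rewrite pow1, Rmult_1_l in H. apply Rabs_le_inv in H. lra. }
  destruct Heta as (eta & Heta & Hpow).
  pose (K' := hom (fun j => eta * c j) (1 - eta) K).
  assert (Hvol' : is_vol K' ((1 - eta) ^ d * kap)) by (apply is_vol_hom; auto; lra).
  assert (HK' : forall p p', K' p -> edist p' p < eta * rho -> K p').
  { intros p p' (y & Hy & E) Hpp.
    assert (Hc : K (fun j => c j + / eta * (p' j - p j))).
    { apply Hball. unfold edist. rewrite (enorm_ext _ (fun j => / eta * (p' j - p j))) by (intros; ring).
      rewrite enorm_scal, Rabs_right by (apply Rle_ge, Rlt_le, Rinv_0_lt_compat; lra).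
      apply (Rmult_lt_reg_l eta); [lra|]. rewrite <- Rmult_assoc, Rinv_r by lra. unfold edist in Hpp. lra. }
    assert (H := Hconv _ _ eta Hy Hc ltac:(lra)).
    replace p' with (fun j => (1 - eta) * y j + eta * (c j + / eta * (p' j - p j))); auto.
    apply functional_extensionality. intros j. rewrite E. field. lra. }
  assert (HK'K : subset K' K).
  { intros p Hp. apply (HK' p p Hp). rewrite edist_refl. apply Rmult_lt_0_compat; lra. }
  assert (Hdpos := pos_INR d).
  destruct (small_inv_INR (eta * rho / (2 * (INR d * (2 * w) + 1)))) as (M & HM & HMinv).
  { assert (0 <= INR d * (2 * w)) by (apply Rmult_le_pos; lra).
    apply Rdiv_lt_0_compat; [apply Rmult_lt_0_compat; lra|lra]. }
  exists M. split; auto. intros tau Htau. assert (HM' : 0 < INR M) by (apply (lt_INR 0); auto).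
  set (h := tau / INR M). assert (Hh : 0 < h) by (apply Rdiv_lt_0_compat; lra).
  assert (Hdh : INR d * h < eta * rho).
  { assert (0 <= INR d * (2 * w)) by (apply Rmult_le_pos; lra).
    assert (0 < eta * rho) by (apply Rmult_lt_0_compat; lra).
    apply Rle_lt_trans with (INR d * (2 * w) * (eta * rho / (2 * (INR d * (2 * w) + 1)))).
    - unfold h, Rdiv. rewrite <- Rmult_assoc. apply Rmult_le_compat.
      + apply Rmult_le_pos; lra.
      + apply Rlt_le, Rinv_0_lt_compat; auto.
      + apply Rmult_le_compat_l; lra.
      + apply HMinv.
    - set (X := INR d * (2 * w)) in *. apply (Rmult_lt_reg_r (2 * (X + 1))); [lra|].
      replace (X * (eta * rho / (2 * (X + 1))) * (2 * (X + 1))) with (X * (eta * rho)) by (field; lra). nra. }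
  pose (corner := (fun z j => b j + INR (z j) * h) : (Fin.t d -> nat) -> pt d).
  pose (hit := fun z => exists p, cube (corner z) h p /\ K' p).
  pose (mk := fun z => (corner z, h)).
  assert (Hall : lsum (fun q => snd q ^ d) (map mk (cfilter hit (ngrid d M))) + lsum (fun q => snd q ^ d) (map mk (cfilter (fun z => ~ hit z) (ngrid d M))) = tau ^ d).
  { rewrite !lsum_map, !lsum_cfilter, <- lsum_plus. simpl.
    rewrite (lsum_ext _ (fun _ => h ^ d)).
    - rewrite lsum_const, ngrid_length, pow_INR, <- Rpow_mult_distr. f_equal. unfold h; field; lra.
    - intros z _. destruct (classic (hit z)) as [H|H].
      + rewrite (chi_true (hit z)), (chi_false (~ hit z)) by tauto. ring.
      + rewrite (chi_false (hit z)), (chi_true (~ hit z)) by tauto. ring. }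
  exists (map mk (cfilter (fun z => ~ hit z) (ngrid d M))). split; [|split].
  - intros q Hq. apply in_map_iff in Hq. destruct Hq as (z & <- & _). auto.
  - intros p Hp. destruct (subdivide_cube b tau M p ltac:(lra) HM Hp) as (z & Hz & Hzp).
    change (cube (corner z) h p) in Hzp.
    destruct (classic (hit z)) as [(p0 & Hp0 & HKp0)|H].
    + left. apply (HK' p0); auto. apply Rle_lt_trans with (INR d * h); auto.
      apply enorm_le_coord; [lra|]. intros j. specialize (Hzp j). specialize (Hp0 j). apply Rabs_le. lra.
    + right. exists (mk z). split; auto. apply in_map_iff. exists z. split; auto. apply in_cfilter; auto.
  - assert (Hin : (1 - eta) ^ d * kap <= lsum (fun q => snd q ^ d) (map mk (cfilter hit (ngrid d M)))).
    { apply (is_vol_le_cubes K'); auto.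
      - intros q Hq. apply in_map_iff in Hq. destruct Hq as (z & <- & _). simpl; lra.
      - intros p Hp. assert (Hpc : cube b tau p).
        { intros j. specialize (HKb p (HK'K p Hp) j). simpl in HKb. lra. }
        destruct (subdivide_cube b tau M p ltac:(lra) HM Hpc) as (z & Hz & Hzp).
        exists (mk z). split; auto. apply in_map_iff. exists z. split; auto. apply in_cfilter. split; auto. exists p; auto. }
    assert ((1 - eps) * kap <= (1 - eta) ^ d * kap) by (apply Rmult_le_compat_r; auto).
    unfold cubes_vol. lra.
Qed.

(** [eps] limits the volume of bodies spent against cube volume removed, [theta] the proportion that
    remains. The former is stated through a difference, so that it telescopes over several
    rounds. *)
Definition packs {d} (K : rset d) lam kap eps theta : Prop :=
  forall (Q : list (pt d * R)) N, (forall q, In q Q -> 0 < snd q) ->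
    exists N' l (Q' : list (pt d * R)), (N <= N')%nat /\ in_range N N' l /\ functional l /\
      (forall q, In q Q' -> 0 < snd q) /\
      (forall p, union_cubes Q p -> (exists i x, In (i, x) l /\ hom x (lam i) K p) \/ union_cubes Q' p) /\
      (1 - eps) * (kap * lsum (fun q => lam (fst q) ^ d) l) <= cubes_vol Q - cubes_vol Q' /\
      cubes_vol Q' <= theta * cubes_vol Q.

(* One round of packing: each container receives a translate of its body, and the rest of the
   container is kept as a union of small cubes; the volume removed is at least (1 - eps) times
   the volume of the bodies used, and at least a fixed proportion of the whole. *)
Lemma packing_round {d} (K : rset d) lam kap eps : (1 <= d)%nat -> convex_body K -> is_vol K kap ->
  (forall i, 0 < lam i) -> Un_cv lam 0 -> diverges (fun i => lam i ^ d) -> 0 < eps < 1 ->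
  exists theta, 0 <= theta < 1 /\ packs K lam kap eps theta.
Proof.
  intros Hd HK Hvol Hlam Hcv Hdiv Heps. destruct (HK) as (_ & _ & [D HD] & Hint).
  assert (Hkap := interior_vol_pos K kap Hvol Hint).
  pose (b := fun _ : Fin.t d => - (Rabs D + 1)). pose (w := 2 * (Rabs D + 1)).
  assert (HDpos := Rabs_pos D). assert (Hw : 0 < w) by (unfold w; lra).
  assert (HKb : subset K (cube b w)).
  { intros p Hp j. assert (C := coord_le_enorm p j). specialize (HD p Hp). assert (C2 := Rle_abs D).
    apply Rabs_le_inv in C. unfold b, w. lra. }
  clearbody b w.
  destruct (inner_approximation K kap b w eps Hd HK Hvol Hw HKb ltac:(lra)) as (M & HM & Happ).
  assert (Hwd : 0 < (2 * w) ^ d) by (apply pow_lt; lra).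
  (* A container has side at most 2 w lam_i, so the volume (1 - eps) kap lam_i^d removed from it is
     at least the share [gam]. *)
  pose (gam := (1 - eps) * kap / (2 * w) ^ d).
  assert (Hgam : 0 < gam) by (apply Rdiv_lt_0_compat; auto; apply Rmult_lt_0_compat; lra).
  exists (Rmax 0 (1 - gam)). split; [split; [apply Rmax_l|apply Rmax_lub_lt; lra]|].
  assert (Hone : forall (a : pt d) s N, 0 < s ->
    exists N' l (Q' : list (pt d * R)), (N <= N')%nat /\ in_range N N' l /\ functional l /\
      (forall q, In q Q' -> 0 < snd q) /\
      (forall p, cube a s p -> (exists i x, In (i, x) l /\ hom x (lam i) K p) \/ union_cubes Q' p) /\
      (1 - eps) * (kap * lsum (fun q => lam (fst q) ^ d) l) <= s ^ d - cubes_vol Q' /\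
      cubes_vol Q' <= (1 - gam) * s ^ d).
  { intros a s N Hs. destruct (container_tiling lam w a s N Hw Hs Hlam Hcv Hdiv) as (N' & l & H1 & H2 & H3 & H4 & H5 & H6).
    pose (pos := fun i (q : pt d * R) (j : Fin.t d) => fst q j - lam i * b j).
    assert (Hrem : forall iq : nat * (pt d * R), exists Qi : list (pt d * R), In iq l ->
       (forall q, In q Qi -> 0 < snd q) /\
       (forall p, cube (fst (snd iq)) (snd (snd iq)) p -> hom (pos (fst iq) (snd iq)) (lam (fst iq)) K p \/ union_cubes Qi p) /\
       cubes_vol Qi <= snd (snd iq) ^ d - (1 - eps) * kap * lam (fst iq) ^ d).
    { intros [i [ai t]]. destruct (classic (In (i, (ai, t)) l)) as [Hin|Hin]; [|exists nil; tauto].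
      specialize (H5 _ _ Hin). simpl in *. specialize (Hlam i). set (L := lam i) in *.
      (* Rescaling the container by 1/L turns its body into a translate of K and its side into a
         number between w and 2w. *)
      destruct (Happ (t / L)) as (Q0 & Q1 & Q2 & Q3).
      { split; apply (Rmult_le_reg_r L); auto; unfold Rdiv; rewrite Rmult_assoc, Rinv_l by lra; lra. }
      exists (map (fun q : pt d * R => ((fun j => ai j - L * b j + L * fst q j) : pt d, L * snd q)) Q0). intros _. split; [|split].
      - intros q Hq. apply in_map_iff in Hq. destruct Hq as (q0 & <- & Hq0). simpl. apply Rmult_lt_0_compat; auto.
      - intros p Hp. destruct (Q2 (fun j => b j + (p j - ai j) / L)) as [H|(q & Hq & Hqp)].
        + intros j. specialize (Hp j). simpl in Hp. split.
          * assert (0 <= (p j - ai j) / L) by (apply Rle_mult_inv_pos; lra). lra.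
          * assert ((p j - ai j) / L <= t / L); [|lra]. apply Rmult_le_compat_r; [apply Rlt_le, Rinv_0_lt_compat; auto|lra].
        + left. eexists. split; [apply H|]. intros j. unfold pos. simpl. fold L. field. lra.
        + right. eexists. split; [apply in_map_iff; exists q; split; [reflexivity|auto]|].
          intros j. simpl. specialize (Hqp j). simpl in Hqp.
          assert (E : p j = ai j - L * b j + L * (b j + (p j - ai j) / L)) by (field; lra).
          set (y := b j + (p j - ai j) / L) in *. rewrite E.
          destruct Hqp as [A1 A2]. apply (Rmult_le_compat_l L) in A1; [|lra]. apply (Rmult_le_compat_l L) in A2; [|lra]. lra.
      - unfold cubes_vol in *. rewrite lsum_map. simpl.
        rewrite (lsum_ext _ (fun q => L ^ d * snd q ^ d)) by (intros; apply Rpow_mult_distr).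
        rewrite lsum_scal. assert (HLd : 0 < L ^ d) by (apply pow_lt; auto).
        apply (Rmult_le_compat_l (L ^ d)) in Q3; [|lra].
        replace (t ^ d) with (L ^ d * (t / L) ^ d); [lra|]. rewrite <- Rpow_mult_distr. f_equal. field. lra. }
    destruct (choice _ Hrem) as [rem Hrem'].
    exists N', (map (fun iq => (fst iq, pos (fst iq) (snd iq))) l), (flat_map rem l).
    assert (Hv : cubes_vol (flat_map rem l) <= s ^ d - (1 - eps) * (kap * lsum (fun q => lam (fst q) ^ d) l)).
    { unfold cubes_vol. rewrite lsum_flat_map, <- H6.
      apply Rle_trans with (lsum (fun iq => snd (snd iq) ^ d + (- ((1 - eps) * kap)) * lam (fst iq) ^ d) l).
      - apply lsum_le. intros iq Hiq. destruct (Hrem' iq Hiq) as (_ & _ & H). unfold cubes_vol in H. lra.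
      - rewrite lsum_plus, lsum_scal. lra. }
    split; auto. split; [apply (in_range_map pos); auto|]. split; [apply (functional_map pos); auto|]. split; [|split; [|split]].
    - intros q Hq. apply in_flat_map in Hq. destruct Hq as (iq & Hiq & Hq). apply (Hrem' iq Hiq); auto.
    - intros p Hp. destruct (H4 p Hp) as (i & q & Hi & Hq). destruct (Hrem' (i, q) Hi) as (_ & Hc & _).
      destruct (Hc p Hq) as [H|(q' & Hq' & Hp')].
      + left. exists i, (pos i q). split; auto. apply in_map_iff. exists (i, q); auto.
      + right. exists q'. split; auto. apply in_flat_map. exists (i, q); auto.
    - rewrite lsum_map. simpl. lra.
    - eapply Rle_trans; [apply Hv|].
      assert (Hl : / (2 * w) ^ d * s ^ d <= lsum (fun q => lam (fst q) ^ d) l).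
      { rewrite <- H6, <- lsum_scal. apply lsum_le. intros [i q] Hi. simpl. specialize (H5 i q Hi).
        rewrite <- pow_inv, <- Rpow_mult_distr. specialize (Hlam i).
        assert (0 < w * lam i) by (apply Rmult_lt_0_compat; auto).
        assert (0 < / (2 * w)) by (apply Rinv_0_lt_compat; lra).
        apply pow_incr. split; [apply Rmult_le_pos; lra|].
        apply (Rmult_le_reg_l (2 * w)); [lra|]. rewrite <- Rmult_assoc, Rinv_r by lra. lra. }
      assert (0 <= (1 - eps) * kap) by (apply Rmult_le_pos; lra).
      apply (Rmult_le_compat_l ((1 - eps) * kap)) in Hl; auto. unfold gam, Rdiv. lra. }
  intros Q. induction Q as [|q Q IH]; intros N HQ.
  - exists N, nil, nil. split; auto. split; [intros i x []|]. split; [intros i x x' []|].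
    split; [intros q []|]. split; [intros p (q & [] & _)|]. unfold cubes_vol; simpl; lra.
  - destruct (Hone (fst q) (snd q) N ltac:(apply HQ; simpl; auto)) as (N1 & l1 & Q1 & A1 & A2 & A3 & A4 & A5 & A6 & A7).
    destruct (IH N1 ltac:(intros; apply HQ; simpl; auto)) as (N2 & l2 & Q2 & B1 & B2 & B3 & B4 & B5 & B6 & B7).
    exists N2, (l1 ++ l2), (Q1 ++ Q2). split; [lia|]. split; [apply (in_range_app N N1 N2); auto|].
    split; [apply (functional_app N N1 N2); auto|].
    assert (Hs : 0 < snd q ^ d) by (apply pow_lt, HQ; simpl; auto).
    assert (E1 : cubes_vol (Q1 ++ Q2) = cubes_vol Q1 + cubes_vol Q2) by apply lsum_app.
    assert (E2 : cubes_vol (q :: Q) = snd q ^ d + cubes_vol Q) by reflexivity.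
    split; [|split; [|split]].
    + intros q' Hq'. apply in_app_iff in Hq'. destruct Hq'; auto.
    + intros p (q' & [<-|Hq'] & Hp).
      * destruct (A5 p Hp) as [(i & x & Hi & Hx)|(q1 & Hq1 & Hp1)].
        -- left. exists i, x. rewrite in_app_iff; auto.
        -- right. exists q1. rewrite in_app_iff; auto.
      * destruct (B5 p (ex_intro _ q' (conj Hq' Hp))) as [(i & x & Hi & Hx)|(q1 & Hq1 & Hp1)].
        -- left. exists i, x. rewrite in_app_iff; auto.
        -- right. exists q1. rewrite in_app_iff; auto.
    + rewrite E1, E2, lsum_app. lra.
    + rewrite E1, E2. assert ((1 - gam) * snd q ^ d <= Rmax 0 (1 - gam) * snd q ^ d) by (apply Rmult_le_compat_r; [lra|apply Rmax_r]). lra.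
Qed.

(** The factor 1 - eps does not deteriorate: the volumes removed in successive rounds add up, while
    the remaining proportions multiply. *)
Lemma packing_rounds {d} (K : rset d) lam kap eps theta :
  packs K lam kap eps theta -> 0 <= theta ->
  forall m, packs K lam kap eps (theta ^ m).
Proof.
  intros Hround Hth. induction m as [|m IH]; intros Q N HQ.
  - exists N, nil, Q. split; auto. split; [intros i x []|]. split; [intros i x x' []|].
    split; auto. split; [auto|]. simpl. lra.
  - destruct (Hround Q N HQ) as (N1 & l1 & Q1 & A1 & A2 & A3 & A4 & A5 & A6 & A7).
    destruct (IH Q1 N1 A4) as (N2 & l2 & Q2 & B1 & B2 & B3 & B4 & B5 & B6 & B7).
    exists N2, (l1 ++ l2), Q2. split; [lia|]. split; [apply (in_range_app N N1 N2); auto|].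
    split; [apply (functional_app N N1 N2); auto|]. split; auto. split; [|split].
    + intros p Hp. destruct (A5 p Hp) as [(i & x & Hi & Hx)|Hp1].
      * left. exists i, x. rewrite in_app_iff; auto.
      * destruct (B5 p Hp1) as [(i & x & Hi & Hx)|Hp2]; auto. left. exists i, x. rewrite in_app_iff; auto.
    + rewrite lsum_app. lra.
    + simpl. assert (0 <= theta ^ m) by (apply pow_le; auto).
      apply (Rmult_le_compat_l (theta ^ m)) in A7; auto. lra.
Qed.

Lemma efficient_small_cover {d} (K : rset d) lam kap s e N : (1 <= d)%nat -> convex_body K -> is_vol K kap ->
  (forall i, 0 < lam i) -> Un_cv lam 0 -> diverges (fun i => lam i ^ d) -> 0 < s -> 0 < e ->
  batch_cover K lam kap N (cube origin s) ((1 + e) * s ^ d).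
Proof.
  intros Hd HK Hvol Hlam Hcv Hdiv Hs He.
  assert (Hint : nonempty_interior K) by (destruct HK as (_ & _ & _ & ?); auto).
  assert (Hkap := interior_vol_pos K kap Hvol Hint).
  (* Then 1/(1 - eps) = 1 + e/2: the packing rounds spend at most (1 + e/2) s^d, and the other e/2
     is reserved for covering the remainder at the wasteful rate [C]. *)
  pose (eps := (e / 2) / (1 + e / 2)).
  assert (Heps : 0 < eps < 1).
  { unfold eps. split; [apply Rdiv_lt_0_compat; lra|]. apply (Rmult_lt_reg_r (1 + e / 2)); [lra|].
    unfold Rdiv at 1. rewrite Rmult_assoc, Rinv_l by lra. lra. }
  destruct (packing_round K lam kap eps Hd HK Hvol Hlam Hcv Hdiv Heps) as (theta & Hth & Hround).
  destruct (crude_cover K lam kap Hint (Rlt_le _ _ Hkap) Hlam Hcv Hdiv) as (C & HC & Hcrude).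
  destruct (pow_lt_1_zero theta) with (y := e / 2 / (C + 1)) as [m Hm].
  { rewrite Rabs_right; lra. }
  { apply Rdiv_lt_0_compat; lra. }
  specialize (Hm m (Nat.le_refl _)). rewrite Rabs_right in Hm by (apply Rle_ge, pow_le; lra).
  pose (Q := (@origin d, s) :: nil).
  assert (HQv : cubes_vol Q = s ^ d) by (unfold Q, cubes_vol; simpl; ring).
  destruct (packing_rounds K lam kap eps theta Hround ltac:(lra) m Q N) as (N1 & l1 & Q1 & A1 & A2 & A3 & A4 & A5 & A6 & A7).
  { intros q [<-|[]]; auto. }
  destruct (Hcrude Q1 N1 A4) as (N2 & l2 & B1 & B2 & B3 & B4 & B5).
  exists N2, (l1 ++ l2). split; [lia|]. split; [apply (in_range_app N N1 N2); auto|].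
  split; [apply (functional_app N N1 N2); auto|]. split.
  - intros p Hp. destruct (A5 p) as [(i & x & Hi & Hx)|Hp1].
    + exists (origin, s). split; [left|]; auto.
    + exists i, x. rewrite in_app_iff; auto.
    + destruct (B4 p Hp1) as (i & x & Hi & Hx). exists i, x. rewrite in_app_iff; auto.
  - rewrite lsum_app. rewrite HQv in *. assert (Hsd : 0 < s ^ d) by (apply pow_lt; auto).
    assert (H0 := cubes_vol_nonneg Q1 A4).
    assert (H1 : kap * lsum (fun q => lam (fst q) ^ d) l1 <= (1 + e / 2) * s ^ d).
    { set (X := kap * lsum (fun q => lam (fst q) ^ d) l1) in *.
      assert (E : 1 - eps = / (1 + e / 2)) by (unfold eps; field; lra). rewrite E in A6.
      apply (Rmult_le_reg_l (/ (1 + e / 2))); [apply Rinv_0_lt_compat; lra|].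
      rewrite <- Rmult_assoc, Rinv_l by lra. lra. }
    assert (H2 : C * cubes_vol Q1 <= e / 2 * s ^ d).
    { apply Rle_trans with ((C + 1) * (e / 2 / (C + 1) * s ^ d)); [|right; field; lra].
      apply Rmult_le_compat; auto; [lra|]. eapply Rle_trans; [apply A7|]. apply Rmult_le_compat_r; lra. }
    lra.
Qed.

(** Otherwise infinitely many terms stay above some eps, and by boundedness a subsequence of them
    converges to a nonzero cluster point. *)
Lemma cv_zero_of_cluster lam M : (forall i, 0 < lam i <= M) ->
  (forall L, cluster_point lam L -> L = 0) -> Un_cv lam 0.
Proof.
  intros Hlam Hcl. apply NNPP. intros Hn.
  assert (Hex : exists eps, 0 < eps /\ forall N, exists i, (N <= i)%nat /\ eps <= lam i).
  { apply NNPP. intros H. apply Hn. intros eps He. apply NNPP. intros H'. apply H. exists eps. split; auto.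
    intros N. apply NNPP. intros H2. apply H'. exists N. intros i Hi. unfold Rdist. rewrite Rminus_0_r.
    specialize (Hlam i). rewrite Rabs_right by lra. apply Rnot_le_lt. intros H3. apply H2. exists i; auto. }
  destruct Hex as (eps & He & Hex).
  destruct (choice _ Hex) as [f Hf].
  destruct (real_convergent_subsequence (fun n => lam (f n)) M) as (phi & l & Hphi & Hl).
  { intros n. specialize (Hlam (f n)). rewrite Rabs_right; lra. }
  assert (Hl0 : l = 0).
  { apply Hcl. intros dl Hdl N. destruct (Hl dl Hdl) as [n Hn'].
    exists (f (phi (n + N)%nat)). split.
    - destruct (Hf (phi (n + N)%nat)) as [H1 _]. assert (H2 := increasing_ge phi Hphi (n + N)%nat). lia.
    - apply Hn'. lia. }
  subst l. destruct (Hl eps He) as [n Hn']. specialize (Hn' n (Nat.le_refl _)). unfold Rdist in Hn'.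
  rewrite Rminus_0_r in Hn'. destruct (Hf (phi n)) as [_ H]. apply Rabs_def2 in Hn'. lra.
Qed.

Lemma cover_vanishing {d} (K : rset d) (lam : nat -> R) M :
  (1 <= d)%nat -> convex_body K -> (forall i, 0 < lam i <= M) ->
  cv_infty (fun n => sum_f_R0 (fun i => lam i ^ d) n) -> (forall L, cluster_point lam L -> L = 0) ->
  exists x : nat -> pt d, covers (fun i => hom (x i) (lam i) K) /\ density_is (fun i => hom (x i) (lam i) K) 1.
Proof.
  intros Hd HK Hlam Hdiv Hcl. assert (Hcv := cv_zero_of_cluster lam M Hlam Hcl).
  destruct (HK) as (_ & _ & Hb & Hint). destruct (bounded_vol K Hd Hb) as [kap Hvol].
  apply (exact_density_cover K lam kap 1 (fun n => / (INR n + 1)) M); auto.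
  - lra.
  - intros n. apply Rlt_le, Rinv_0_lt_compat. assert (H := pos_INR n); lra.
  - intros eps He. destruct (small_inv_INR (eps / 2)) as (n & Hn & Hn'); [lra|].
    exists n. intros m Hm. unfold Rdist. assert (H := pos_INR m).
    rewrite Rminus_0_r, Rabs_right by (apply Rle_ge, Rlt_le, Rinv_0_lt_compat; lra).
    apply Rle_lt_trans with (/ INR n); [|lra]. apply Rinv_le_contravar; [apply (lt_INR 0); auto|].
    apply le_INR in Hm. lra.
  - intros n N. apply efficient_small_cover; auto.
    + apply Hlam.
    + apply cv_infty_diverges; auto.
    + apply pow_lt; lra.
    + apply Rinv_0_lt_compat. assert (H := pos_INR n); lra.
Qed.

(** * Touching balls *)

(* [- u] is the outer normal of [K] at a point where a ball inside [K] touches the boundary. *)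
Definition touching_normal {d} (K : rset d) (u : pt d) : Prop :=
  enorm u = 1 /\ exists q rho, 0 < rho /\ (forall y, edist y q <= rho -> K y) /\
    (forall y, K y -> dot u q - rho <= dot u y).

Lemma closed_limit {d} (K : rset d) y : is_closed K ->
  (forall e, 0 < e -> exists z, K z /\ edist z y < e) -> K y.
Proof.
  intros Hc H. apply NNPP. intros Hn. destruct (Hc y Hn) as (e & He & Ho).
  destruct (H e He) as (z & Hz & Hd). exact (Ho z Hd Hz).
Qed.

(** If y in K were strictly beyond the tangent plane at [p], then continuing the segment from y
    slightly past [p] leads to a point w in the open ball. As [p] lies between y and w, a
    neighbourhood of [p] would belong to K. *)
Lemma support_at_touching_point {d} (K : rset d) p q r : convex K -> 0 < r ->
  (forall y, edist y q <= r -> K y) -> edist p q = r ->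
  (forall e, 0 < e -> exists z, ~ K z /\ edist z p < e) ->
  forall y, K y -> dot (fun j => p j - q j) (fun j => y j - p j) <= 0.
Proof.
  intros Hconv Hr Hball Hpq Hout y Hy. apply Rnot_lt_le. intros Ha.
  set (a := dot (fun j => p j - q j) (fun j => y j - p j)) in *.
  set (g := dot (fun j => y j - p j) (fun j => y j - p j)).
  assert (Hg : 0 <= g) by apply dot_self_nonneg.
  (* Small enough for s g < 2a, so that |w - q|^2 = r^2 - 2sa + s^2 g is below r^2. *)
  pose (s := a / (g + 1)). assert (Hs : 0 < s) by (apply Rdiv_lt_0_compat; lra).
  pose (w := fun j => p j - s * (y j - p j)).
  assert (Hw : edist w q < r).
  { apply enorm_lt_sq; auto. unfold w.
    replace (fun j => p j - s * (y j - p j) - q j) with (fun j => 1 * (p j - q j) + (- s) * (y j - p j))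
      by (apply functional_extensionality; intros; ring).
    rewrite (dot_comb_self (fun j => p j - q j) (fun j => y j - p j)). fold a g.
    rewrite <- enorm_sq. fold (edist p q). rewrite Hpq.
    assert (Hsg : s * g < 2 * a).
    { unfold s. apply (Rmult_lt_reg_r (g + 1)); [lra|].
      replace (a / (g + 1) * g * (g + 1)) with (a * g) by (field; lra). nra. }
    nra. }
  destruct (Hout ((r - edist w q) / (1 + s))) as (z & Hz & Hzp); [apply Rdiv_lt_0_compat; lra|].
  apply Hz.
  assert (Hw' : K (fun j => (1 + s) * z j - s * y j)).
  { apply Hball. apply Rle_trans with (edist w q + (1 + s) * edist z p).
    - unfold edist. replace ((1 + s) * enorm (fun j => z j - p j)) with (enorm (fun j => (1 + s) * (z j - p j)))
        by (rewrite enorm_scal, Rabs_right; lra).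
      rewrite (enorm_ext _ (fun j => (w j - q j) + (1 + s) * (z j - p j))) by (intros; unfold w; ring).
      apply enorm_triang.
    - assert ((1 + s) * edist z p <= (1 + s) * ((r - edist w q) / (1 + s))) by (apply Rmult_le_compat_l; lra).
      replace ((1 + s) * ((r - edist w q) / (1 + s))) with (r - edist w q) in H by (field; lra). lra. }
  assert (H := Hconv _ _ (s / (1 + s)) Hw' Hy).
  replace z with (fun j => (1 - s / (1 + s)) * ((1 + s) * z j - s * y j) + s / (1 + s) * y j).
  - apply H. split; [apply Rle_mult_inv_pos; lra|]. apply (Rmult_le_reg_r (1 + s)); [lra|].
    unfold Rdiv. rewrite Rmult_assoc, Rinv_l by lra. lra.
  - apply functional_extensionality. intros j. field. lra.
Qed.

(* Slide a small ball in direction [v] until it touches the boundary; a concentric ball of twice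
   the radius around the starting point shows that the normal at the contact is not orthogonal
   to [v]. *)
Lemma touching_normal_exists {d} (K : rset d) v : convex_body K -> 0 < enorm v ->
  exists u, touching_normal K u /\ dot u v < 0.
Proof.
  intros (Hconv & Hclosed & [M HM] & (x0 & e & He & Hball)) Hv.
  pose (r := e / 4). assert (Hr : 0 < r) by (unfold r; lra).
  pose (c := fun t j => x0 j + t * v j).
  pose (G := fun t => 0 <= t /\ forall y, edist y (c t) <= r -> K y).
  assert (Hcd : forall t s, edist (c t) (c s) = Rabs (t - s) * enorm v).
  { intros t s. rewrite <- enorm_scal. apply enorm_ext. intros; unfold c; ring. }
  assert (Hshift : forall (y : pt d) t s, edist (fun j => y j + (s - t) * v j) (c s) = edist y (c t)).
  { intros y t s. apply enorm_ext. intros; unfold c; ring. }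
  assert (G0 : G 0).
  { split; [lra|]. intros y Hy. apply Hball. assert (E : edist y x0 = edist y (c 0)).
    { apply enorm_ext. intros; unfold c; ring. } unfold r in Hy. lra. }
  destruct (completeness G) as [t [Ht1 Ht2]].
  - exists ((M + enorm x0) / enorm v). intros t [Ht H].
    assert (Hc : K (c t)) by (apply H; rewrite edist_refl; lra). apply HM in Hc.
    apply (Rmult_le_reg_r (enorm v)); auto. unfold Rdiv. rewrite Rmult_assoc, Rinv_l, Rmult_1_r by lra.
    assert (enorm (fun j => t * v j) <= enorm (c t) + enorm x0).
    { rewrite (enorm_ext _ (fun j => c t j - x0 j)) by (intros; unfold c; ring). apply enorm_sub_le. }
    rewrite enorm_scal, Rabs_right in H0 by lra. lra.
  - exists 0; auto.
  - assert (Ht0 : 0 <= t) by (apply Ht1; auto).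
    set (q := c t).
    assert (Hq : forall y, edist y q <= r -> K y).
    { intros y Hy. apply closed_limit; auto. intros e' He'.
      assert (Hs : exists s, G s /\ t - e' / enorm v < s).
      { apply NNPP. intros Hn. assert (0 < e' / enorm v) by (apply Rdiv_lt_0_compat; auto).
        assert (t <= t - e' / enorm v); [|lra]. apply Ht2. intros s Hs. apply Rnot_lt_le. intros Hlt.
        apply Hn. exists s; auto. }
      destruct Hs as (s & Hs & Hts). assert (Hst : s <= t) by (apply Ht1; auto).
      exists (fun j => y j + (s - t) * v j). split.
      - apply Hs. rewrite Hshift. exact Hy.
      - unfold edist. rewrite (enorm_ext _ (fun j => (s - t) * v j)) by (intros; ring).
        rewrite enorm_scal, Rabs_left1 by lra.
        apply Rlt_le_trans with (e' / enorm v * enorm v); [apply Rmult_lt_compat_r; lra|right; field; lra]. }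
    (* Just beyond the last admissible position [t] the ball leaves K; the outside points found
       there accumulate at the contact point [p]. *)
    assert (Hy : forall n, exists y, ~ K y /\ edist y (c (t + / (INR n + 1))) <= r).
    { intros n. assert (Hn : 0 < / (INR n + 1)) by (apply Rinv_0_lt_compat; assert (H := pos_INR n); lra).
      apply NNPP. intros H. assert (t + / (INR n + 1) <= t); [|lra]. apply Ht1. split; [lra|].
      intros y Hy. apply NNPP. intros HK. apply H. exists y; auto. }
    destruct (choice _ Hy) as [y Hy'].
    assert (Hyq : forall n, edist (y n) q <= r + / (INR n + 1) * enorm v).
    { intros n. eapply Rle_trans; [apply (edist_triang _ (c (t + / (INR n + 1))))|].
      apply Rplus_le_compat; [apply Hy'|]. unfold q. rewrite Hcd. right. f_equal.
      rewrite Rabs_right; [ring|]. assert (0 < / (INR n + 1)) by (apply Rinv_0_lt_compat; assert (H := pos_INR n); lra). lra. }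
    destruct (convergent_subsequence y (enorm q + (r + enorm v))) as (phi & p & Hphi & Hp).
    { intros n. eapply Rle_trans; [apply (enorm_edist _ q)|]. apply Rplus_le_compat_l.
      eapply Rle_trans; [apply Hyq|]. apply Rplus_le_compat_l.
      assert (/ (INR n + 1) <= 1).
      { rewrite <- Rinv_1. apply Rinv_le_contravar; [lra|]. assert (H := pos_INR n); lra. }
      apply (Rmult_le_compat_r (enorm v)) in H; lra. }
    assert (Hout : forall e', 0 < e' -> exists z, ~ K z /\ edist z p < e').
    { intros e' He'. destruct (Hp e' He') as [N HN]. exists (y (phi N)). split; [apply Hy'|apply HN; lia]. }
    assert (Hpq1 : edist p q <= r).
    { apply le_epsilon. intros e' He'. destruct (Hp (e' / 2)) as [N HN]; [lra|].
      destruct (small_inv_INR (e' / 2 / enorm v)) as (m & Hm & Hm'); [apply Rdiv_lt_0_compat; lra|].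
      specialize (HN (N + m)%nat ltac:(lia)). specialize (Hyq (phi (N + m)%nat)).
      assert (Hle := increasing_ge phi Hphi (N + m)%nat).
      assert (/ (INR (phi (N + m)%nat) + 1) <= / INR m).
      { apply Rinv_le_contravar; [apply (lt_INR 0); auto|]. rewrite <- S_INR. apply le_INR. lia. }
      assert (/ (INR (phi (N + m)%nat) + 1) * enorm v <= e' / 2).
      { apply Rle_trans with (e' / 2 / enorm v * enorm v); [apply Rmult_le_compat_r; lra|right; field; lra]. }
      assert (Htri := edist_triang p (y (phi (N + m)%nat)) q). rewrite (edist_comm p (y _)) in Htri. lra. }
    assert (Hpq : edist p q = r).
    { apply Rle_antisym; auto. apply Rnot_lt_le. intros Hlt.
      destruct (Hout (r - edist p q)) as (z & Hz & Hzp); [lra|]. apply Hz, Hq.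
      assert (Htri := edist_triang z p q). lra. }
    assert (Hsupp := support_at_touching_point K p q r Hconv Hr Hq Hpq Hout).
    pose (u := fun j => - / r * (p j - q j)).
    assert (Hu : enorm u = 1).
    { unfold u. rewrite enorm_scal. fold (edist p q). rewrite Hpq, Rabs_left.
      - field; lra.
      - assert (0 < / r) by (apply Rinv_0_lt_compat; auto). lra. }
    assert (Hupq : forall z : pt d, dot u z = - / r * dot (fun j => p j - q j) z).
    { intros z. unfold dot. rewrite <- fsum_scal. apply fsum_ext. intros; unfold u; ring. }
    assert (Hsup2 : forall z, K z -> dot u q - r <= dot u z).
    { intros z Hz. specialize (Hsupp z Hz).
      assert (E : dot u z = dot u q + dot u (fun j => p j - q j) + dot u (fun j => z j - p j)).
      { unfold dot. rewrite <- !fsum_plus. apply fsum_ext. intros; ring. }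
      rewrite E, (Hupq (fun j => p j - q j)), (Hupq (fun j => z j - p j)), <- enorm_sq.
      fold (edist p q). rewrite Hpq. replace (- / r * (r * r)) with (- r) by (field; lra).
      assert (0 < / r) by (apply Rinv_0_lt_compat; auto). nra. }
    exists u. split.
    + split; auto. exists q, r. split; auto.
    + assert (Hx : K (fun j => x0 j + (- (2 * r)) * u j)).
      { apply Hball. unfold edist. rewrite (enorm_ext _ (fun j => (- (2 * r)) * u j)) by (intros; ring).
        rewrite enorm_scal, Hu, Rabs_left by lra. unfold r; lra. }
      apply Hsup2 in Hx.
      assert (E1 : dot u (fun j => x0 j + (- (2 * r)) * u j) = dot u x0 - 2 * r).
      { replace (fun j => x0 j + (- (2 * r)) * u j) with (fun j => 1 * x0 j + (- (2 * r)) * u j)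
          by (apply functional_extensionality; intros; ring).
        rewrite dot_lin, <- enorm_sq, Hu. ring. }
      assert (E2 : dot u q = dot u x0 + t * dot u v).
      { unfold q, c. replace (fun j => x0 j + t * v j) with (fun j => 1 * x0 j + t * v j)
          by (apply functional_extensionality; intros; ring). rewrite dot_lin. ring. }
      rewrite E1, E2 in Hx. assert (t * dot u v <= - r) by lra.
      apply Rnot_le_lt. intros Hle. assert (0 <= t * dot u v) by (apply Rmult_le_pos; auto). lra.
Qed.

(** * Steinitz: at most 2d directions suffice *)

(** The dual form of positive spanning, which avoids handling positive combinations. *)
Definition hits_all {d} (U : pt d -> Prop) : Prop :=
  forall v, 0 < enorm v -> exists u, U u /\ 0 < dot u v.

(** Compactness of the unit sphere: a single [u] hitting the limit of supposed counterexamples also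
    hits late ones. The constant serves twice, for extracting a finite subfamily and for bounding
    the polytope left uncovered by the half-spaces. *)
Lemma hits_all_uniform {d} (U : pt d -> Prop) : (forall u, U u -> enorm u = 1) -> hits_all U ->
  exists eps, 0 < eps /\ forall v, enorm v = 1 -> exists u, U u /\ eps <= dot u v.
Proof.
  intros HU Hhit. apply NNPP. intros Hn.
  assert (H : forall n, exists v, enorm v = 1 /\ forall u, U u -> dot u v < / (INR n + 1)).
  { intros n. apply NNPP. intros H. apply Hn. exists (/ (INR n + 1)).
    split; [apply Rinv_0_lt_compat; assert (K := pos_INR n); lra|]. intros v Hv. apply NNPP. intros Hu.
    apply H. exists v. split; auto. intros u HUu. apply Rnot_le_lt. intros Hle. apply Hu. exists u; auto. }
  destruct (choice _ H) as [v Hv].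
  destruct (convergent_subsequence v 1) as (phi & w & Hphi & Hw); [intros n; destruct (Hv n); lra|].
  assert (Hw0 : 0 < enorm w).
  { destruct (Hw (/ 2)) as [N HN]; [lra|]. specialize (HN N (Nat.le_refl _)).
    destruct (Hv (phi N)) as [H1 _]. assert (H2 := enorm_edist (v (phi N)) w). lra. }
  destruct (Hhit w Hw0) as (u & Hu & Huw).
  destruct (Hw (dot u w / 2)) as [N HN]; [lra|].
  destruct (small_inv_INR (dot u w / 2)) as (m & Hm & Hm'); [lra|].
  specialize (HN (N + m)%nat ltac:(lia)). destruct (Hv (phi (N + m)%nat)) as [_ H2]. specialize (H2 u Hu).
  assert (Hle := increasing_ge phi Hphi (N + m)%nat).
  assert (/ (INR (phi (N + m)%nat) + 1) <= / INR m).
  { apply Rinv_le_contravar; [apply (lt_INR 0); auto|]. rewrite <- S_INR. apply le_INR. lia. }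
  assert (H3 := dot_edist u w (v (phi (N + m)%nat))). rewrite (HU u Hu), (edist_comm w (v _)) in H3. lra.
Qed.

Lemma dot_scal {d} (u v : pt d) c : dot u (fun j => c * v j) = c * dot u v.
Proof. unfold dot. rewrite <- fsum_scal. apply fsum_ext; intros; ring. Qed.

(** Enlarge a list greedily: as long as it misses a unit vector v, add some u with u . v >= eps. All
    vectors missed later have nonpositive inner product with this u, so the missed vectors are
    eps-separated, contradicting compactness. *)
Lemma hits_all_finite {d} (U : pt d -> Prop) : (forall u, U u -> enorm u = 1) -> hits_all U ->
  exists l, (forall u, In u l -> U u) /\ hits_all (fun u => In u l).
Proof.
  intros HU Hhit. destruct (hits_all_uniform U HU Hhit) as (eps & Heps & Hunif).
  apply NNPP. intros Hn.
  assert (H : forall l, exists vu : pt d * pt d, (forall u, In u l -> U u) ->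
      enorm (fst vu) = 1 /\ (forall u, In u l -> dot u (fst vu) <= 0) /\ U (snd vu) /\ eps <= dot (snd vu) (fst vu)).
  { intros l. destruct (classic (forall u, In u l -> U u)) as [Hl|Hl]; [|exists (origin, origin); tauto].
    apply NNPP. intros H. apply Hn. exists l. split; auto. intros v Hv. apply NNPP. intros Hv'.
    apply H. pose (v' := fun j => / enorm v * v j).
    assert (Hinv : 0 < / enorm v) by (apply Rinv_0_lt_compat; auto).
    assert (Hv1 : enorm v' = 1).
    { unfold v'. rewrite enorm_scal, Rabs_right by lra. field; lra. }
    destruct (Hunif v' Hv1) as (u & Hu & Huv). exists (v', u). intros _. split; auto. split; [|split; auto].
    intros u' Hu'. simpl. unfold v'. rewrite dot_scal. apply Rnot_lt_le. intros Hlt. apply Hv'. exists u'. split; auto.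
    apply (Rmult_lt_reg_l (/ enorm v)); auto. rewrite Rmult_0_r; auto. }
  destruct (choice _ H) as [F HF].
  pose (L := fix L n := match n with O => nil | S m => snd (F (L m)) :: L m end).
  assert (HL : forall n u, In u (L n) -> U u).
  { induction n; simpl; [tauto|]. intros u [<-|Hu]; auto. apply HF; auto. }
  assert (HLm : forall n m, (n < m)%nat -> In (snd (F (L n))) (L m)).
  { intros n m Hlt. induction Hlt; simpl; auto. }
  pose (v := fun n => fst (F (L n))).
  assert (Hsep : forall n m, (n < m)%nat -> eps <= edist (v n) (v m)).
  { intros n m Hlt. destruct (HF (L n) (HL n)) as (_ & _ & Hu & Huv).
    destruct (HF (L m) (HL m)) as (_ & Hm & _ & _). specialize (Hm _ (HLm n m Hlt)).
    assert (H3 := dot_edist (snd (F (L n))) (v n) (v m)). rewrite (HU _ Hu) in H3. unfold v in *. lra. }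
  destruct (convergent_subsequence v 1) as (phi & w & Hphi & Hw).
  { intros n. destruct (HF (L n) (HL n)) as (H1 & _). unfold v. lra. }
  destruct (Hw (eps / 2)) as [N HN]; [lra|].
  assert (H1 := HN N (Nat.le_refl _)). assert (H2 := HN (S N) ltac:(lia)).
  specialize (Hsep (phi N) (phi (S N)) (Hphi N)).
  assert (H3 := edist_triang (v (phi N)) w (v (phi (S N)))). rewrite (edist_comm w (v _)) in H3. lra.
Qed.

(** Gaussian elimination: one vector with nonzero first coordinate clears that coordinate from the
    others, and the dimension drops by one. *)
Lemma linear_dependence d (I : list nat) (y : nat -> pt d) : NoDup I -> (d < length I)%nat ->
  exists c : nat -> R, (exists i, In i I /\ c i <> 0) /\ forall j, lsum (fun i => c i * y i j) I = 0.
Proof.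
  revert I y. induction d; intros I y Hn HI.
  - exists (fun _ => 1). split; [|intros j; inversion j]. destruct I as [|i I]; [simpl in HI; lia|].
    exists i. split; [left; auto|lra].
  - destruct (classic (exists k, In k I /\ y k Fin.F1 <> 0)) as [(k & Hk & Hyk)|Hz].
    + destruct (in_split k I Hk) as (I1 & I2 & ->).
      assert (Hn' := NoDup_remove_1 _ _ _ Hn). assert (Hk' := NoDup_remove_2 _ _ _ Hn).
      destruct (IHd (I1 ++ I2) (fun i j => y i (Fin.FS j) - y i Fin.F1 / y k Fin.F1 * y k (Fin.FS j))) as (c & (i & Hi & Hci) & Hc); auto.
      { rewrite length_app in *. simpl in HI. lia. }
      pose (ck := - lsum (fun i => c i * (y i Fin.F1 / y k Fin.F1)) (I1 ++ I2)).
      pose (c' := fun i => if Nat.eq_dec i k then ck else c i).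
      assert (Hck : forall i, In i (I1 ++ I2) -> c' i = c i).
      { intros i' Hi'. unfold c'. destruct Nat.eq_dec; auto. subst; tauto. }
      assert (Hsplit : forall j, lsum (fun i => c' i * y i j) (I1 ++ k :: I2) = ck * y k j + lsum (fun i => c i * y i j) (I1 ++ I2)).
      { intros j. rewrite <- (lsum_ext (fun i => c' i * y i j) (fun i => c i * y i j) (I1 ++ I2)) by (intros; rewrite Hck; auto).
        rewrite !lsum_app. simpl. unfold c' at 2. destruct Nat.eq_dec; [ring|tauto]. }
      exists c'. split.
      * exists i. rewrite Hck by auto. split; auto. rewrite in_app_iff in *. simpl. tauto.
      * intros j. rewrite Hsplit. revert j. apply Fin_case.
        -- unfold ck. rewrite Ropp_mult_distr_l_reverse, Rmult_comm, <- lsum_scal.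
           rewrite (lsum_ext _ (fun i => c i * y i Fin.F1)); [ring|]. intros; field; auto.
        -- intros j. specialize (Hc j). unfold ck.
           rewrite Ropp_mult_distr_l_reverse, Rmult_comm, <- lsum_scal.
           rewrite (lsum_ext _ (fun i => c i * y i (Fin.FS j) + (-1) * (y k (Fin.FS j) * (c i * (y i Fin.F1 / y k Fin.F1))))) in Hc by (intros; field; auto).
           rewrite lsum_plus, lsum_scal in Hc. lra.
    + destruct (IHd I (fun i j => y i (Fin.FS j))) as (c & Hex & Hc); auto; [lia|].
      exists c. split; auto. apply Fin_case; auto.
      rewrite (lsum_ext _ (fun _ => 0)); [rewrite lsum_const; ring|].
      intros i Hi. assert (E : y i Fin.F1 = 0) by (apply NNPP; intros H; apply Hz; exists i; auto).
      rewrite E; ring.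
Qed.

(** A shortest sublist with the hitting property. Minimality is stated by position, so that repeated
    entries cause no trouble. *)
Lemma minimal_sublist {A B : Type} (a0 : A) (Hit : A -> B -> Prop) (D : B -> Prop) (F : list A) :
  (forall v, D v -> exists u, In u F /\ Hit u v) ->
  exists F', incl F' F /\ (forall v, D v -> exists u, In u F' /\ Hit u v) /\
    forall i, (i < length F')%nat -> exists y, D y /\ forall j, (j < length F')%nat -> j <> i -> ~ Hit (nth j F' a0) y.
Proof.
  intros HF.
  destruct (nat_least (fun n => exists F', length F' = n /\ incl F' F /\ forall v, D v -> exists u, In u F' /\ Hit u v))
    as (n & (F' & HF'n & Hincl & HF') & Hmin).
  { exists (length F), F. split; auto. split; [apply incl_refl|auto]. }
  exists F'. split; auto. split; auto. intros i Hi. apply NNPP. intros Hno.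
  destruct (nth_split F' a0 Hi) as (l1 & l2 & E & Hl1).
  assert (n <= length (l1 ++ l2))%nat.
  { apply Hmin. exists (l1 ++ l2). split; auto. split.
    - intros u Hu. apply Hincl. rewrite E. rewrite in_app_iff in *. simpl. tauto.
    - intros v Hv. apply NNPP. intros Hv'. apply Hno. exists v. split; auto. intros j Hj Hji Hh. apply Hv'.
      exists (nth j F' a0). split; auto. rewrite E. rewrite in_app_iff. rewrite E, length_app in Hj. simpl in Hj.
      destruct (Nat.lt_ge_cases j i) as [L|L].
      + left. rewrite app_nth1 by lia. apply nth_In. lia.
      + right. rewrite app_nth2 by lia. rewrite Hl1. replace (j - i)%nat with (S (j - i - 1)) by lia.
        simpl. apply nth_In. lia. }
  rewrite E, length_app in HF'n. rewrite length_app in H. simpl in HF'n. lia.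
Qed.

Lemma dot_lsum {d} (u : pt d) (c : nat -> R) (y : nat -> pt d) I :
  dot u (fun j => lsum (fun i => c i * y i j) I) = lsum (fun i => c i * dot u (y i)) I.
Proof.
  induction I as [|i I IH]; simpl.
  - unfold dot. rewrite (fsum_ext _ _ (fun _ => 0)) by (intros; ring). rewrite fsum_const; ring.
  - rewrite <- IH. unfold dot. rewrite <- fsum_scal, <- fsum_plus. apply fsum_ext; intros; ring.
Qed.

Lemma lsum_single (f : nat -> R) I i : NoDup I -> In i I -> (forall j, In j I -> j <> i -> f j = 0) -> lsum f I = f i.
Proof.
  intros Hn Hi H. destruct (in_split i I Hi) as (I1 & I2 & ->). assert (Hk' := NoDup_remove_2 _ _ _ Hn).
  assert (E : lsum f (I1 ++ I2) = 0).
  { rewrite (lsum_ext _ (fun _ => 0)); [rewrite lsum_const; ring|]. intros j Hj. apply H.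
    - rewrite in_app_iff in *. simpl; tauto.
    - intros ->; tauto. }
  rewrite lsum_app in *. simpl. lra.
Qed.

Lemma list_choice_nat {B : Type} (b0 : B) n (P : nat -> B -> Prop) :
  (forall i, (i < n)%nat -> exists b, P i b) -> exists f, forall i, (i < n)%nat -> P i (f i).
Proof.
  intros H. assert (H' : forall i, exists b, (i < n)%nat -> P i b).
  { intros i. destruct (Nat.lt_ge_cases i n) as [L|L]; [destruct (H i L) as [b Hb]; exists b; auto|exists b0; lia]. }
  destruct (choice _ H') as [f Hf]. exists f; auto.
Qed.

(* Both minimality arguments are of Helly type: the witnesses y_i of minimality are linearly
   dependent once there are more than d of them, and the dependence contradicts the choice of
   the y_i. The second one uses the Radon point z = sum of the c_i y_i with c_i > 0. *)
Lemma steinitz {d} (F : list (pt d)) : hits_all (fun u => In u F) ->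
  exists F', incl F' F /\ (length F' <= 2 * d)%nat /\ hits_all (fun u => In u F').
Proof.
  intros HF.
  (* [F1] is a minimal part of [F] that spans linearly. Its witness y_i is orthogonal to every
     member but the i-th; so the y_i are independent, and there are at most d. *)
  destruct (minimal_sublist (@origin d) (fun u v => dot u v <> 0) (fun v => 0 < enorm v) F) as (F1 & Hi1 & Hh1 & Hm1).
  { intros v Hv. destruct (HF v Hv) as (u & Hu & Huv). exists u. split; auto. lra. }
  assert (Hl1 : (length F1 <= d)%nat).
  { apply Nat.nlt_ge. intros Hlt.
    destruct (list_choice_nat (@origin d) _ _ Hm1) as [y Hy].
    destruct (linear_dependence d (seq 0 (length F1)) y) as (c & (i & Hi & Hci) & Hc); [apply seq_NoDup|rewrite length_seq; auto|].
    assert (Hin : (i < length F1)%nat) by (apply in_seq in Hi; lia).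
    destruct (Hy i Hin) as [Hyi Hyj].
    assert (E := dot_lsum (nth i F1 origin) c y (seq 0 (length F1))).
    rewrite (lsum_single _ _ i) in E; [|apply seq_NoDup|auto|].
    - assert (Hne : dot (nth i F1 origin) (y i) <> 0).
      { destruct (Hh1 (y i) Hyi) as (u & Hu & Huv). destruct (In_nth F1 u origin Hu) as (k & Hk & Ek).
        destruct (Nat.eq_dec k i) as [->|Hki]; [rewrite Ek; auto|].
        exfalso. apply (Hyj k Hk Hki). rewrite Ek; auto. }
      assert (E0 : dot (nth i F1 origin) (fun j => lsum (fun i => c i * y i j) (seq 0 (length F1))) = 0).
      { unfold dot. rewrite (fsum_ext _ _ (fun _ => 0)) by (intros; rewrite Hc; ring). rewrite fsum_const; ring. }
      rewrite E0 in E. symmetry in E. apply Rmult_integral in E. tauto.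
    - intros j Hj Hji. apply in_seq in Hj.
      assert (Ej : dot (nth i F1 origin) (y j) = 0).
      { destruct (Hy j ltac:(lia)) as [_ H]. apply NNPP. apply (H i); auto. }
      rewrite Ej; ring. }
  (* The nonzero directions not hit by [F1]; a minimal part [F2] hitting all of these completes
     [F1]. *)
  pose (D := fun v : pt d => 0 < enorm v /\ forall u, In u F1 -> dot u v <= 0).
  destruct (minimal_sublist (@origin d) (fun u v => 0 < dot u v) D F) as (F2 & Hi2 & Hh2 & Hm2).
  { intros v [Hv _]. destruct (HF v Hv) as (u & Hu & Huv). exists u. auto. }
  assert (Hl2 : (length F2 <= d)%nat).
  { apply Nat.nlt_ge. intros Hlt.
    destruct (list_choice_nat (@origin d) _ _ Hm2) as [y Hy].
    set (I := seq 0 (length F2)) in *.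
    assert (Hdep : exists c : nat -> R, (exists i, In i I /\ 0 < c i) /\ forall j, lsum (fun i => c i * y i j) I = 0).
    { destruct (linear_dependence d I y) as (c & (i & Hi & Hci) & Hc); [apply seq_NoDup|unfold I; rewrite length_seq; auto|].
      destruct (Rlt_dec 0 (c i)) as [Hpos|Hneg]; [exists c; split; auto; exists i; auto|].
      exists (fun i => -1 * c i). split; [exists i; split; auto; lra|]. intros j.
      rewrite (lsum_ext _ (fun i => -1 * (c i * y i j))) by (intros; ring). rewrite lsum_scal, Hc; ring. }
    destruct Hdep as (c & (i0 & Hi0 & Hc0) & Hc).
    assert (HI : forall i, In i I -> (i < length F2)%nat) by (intros i Hi; apply in_seq in Hi; lia).
    pose (z := fun j => lsum (fun i => Rmax 0 (c i) * y i j) I).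
    assert (Hz2 : z = fun j => lsum (fun i => Rmax 0 (- c i) * y i j) I).
    { apply functional_extensionality. intros j. unfold z.
      assert (E : lsum (fun i => Rmax 0 (c i) * y i j) I = lsum (fun i => c i * y i j + Rmax 0 (- c i) * y i j) I).
      { apply lsum_ext. intros i _. unfold Rmax; repeat destruct Rle_dec; try lra. replace (c i) with 0 by lra. ring. }
      rewrite E, lsum_plus, Hc. ring. }
    assert (HzD : D z).
    { assert (Hterm : forall u, In u F1 -> forall i, In i I -> Rmax 0 (c i) * dot u (y i) <= 0).
      { intros u Hu i Hi. destruct (Hy i (HI i Hi)) as [[_ H] _]. specialize (H u Hu).
        assert (0 <= Rmax 0 (c i)) by apply Rmax_l. nra. }
      assert (Hle : forall u, In u F1 -> dot u z <= Rmax 0 (c i0) * dot u (y i0)).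
      { intros u Hu. unfold z. rewrite dot_lsum. destruct (in_split i0 I Hi0) as (I1 & I2 & EI). rewrite EI.
        rewrite lsum_app. simpl.
        assert (lsum (fun i => Rmax 0 (c i) * dot u (y i)) I1 <= lsum (fun _ => 0) I1).
        { apply lsum_le. intros i Hi. apply Hterm; auto. rewrite EI, in_app_iff; auto. }
        assert (lsum (fun i => Rmax 0 (c i) * dot u (y i)) I2 <= lsum (fun _ => 0) I2).
        { apply lsum_le. intros i Hi. apply Hterm; auto. rewrite EI, in_app_iff; simpl; auto. }
        rewrite lsum_const in *. lra. }
      split.
      (* The Radon point is nonzero because [F1] spans: some u in [F1] has nonzero, hence negative,
         inner product with y_i0, and the other terms are nonpositive. *)
      - destruct (Hy i0 (HI i0 Hi0)) as [[Hyn Hyl] _]. destruct (Hh1 (y i0) Hyn) as (u & Hu & Hne).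
        specialize (Hyl u Hu). specialize (Hle u Hu). rewrite Rmax_right in Hle by lra.
        destruct (enorm_nonneg z) as [H|H]; auto. exfalso.
        assert (dot u z = 0).
        { unfold dot. rewrite (fsum_ext _ _ (fun _ => 0)); [rewrite fsum_const; ring|]. intros j. rewrite (enorm_eq0 z (eq_sym H)); ring. }
        assert (dot u (y i0) < 0) by lra. nra.
      - intros u Hu. specialize (Hle u Hu). specialize (Hterm u Hu i0 Hi0). lra. }
    (* The member k of [F2] that hits z has nonpositive inner product with all witnesses other than
       y_k. Of the two expressions for z, the one without y_k then gives u . z <= 0. *)
    destruct (Hh2 z HzD) as (u & Hu & Huz). destruct (In_nth F2 u origin Hu) as (k & Hk & Ek).
    assert (Hoff : forall i, In i I -> i <> k -> dot u (y i) <= 0).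
    { intros i Hi Hik. destruct (Hy i (HI i Hi)) as [_ H]. rewrite <- Ek. apply Rnot_lt_le. apply H; auto. }
    assert (Hneg : forall w : nat -> R, (forall i, 0 <= w i) -> w k = 0 -> lsum (fun i => w i * dot u (y i)) I <= 0).
    { intros w Hw Hwk. apply Rle_trans with (lsum (fun _ => 0) I); [|rewrite lsum_const; lra].
      apply lsum_le. intros i Hi. destruct (Nat.eq_dec i k) as [->|Hik]; [rewrite Hwk; lra|].
      specialize (Hoff i Hi Hik). specialize (Hw i). nra. }
    destruct (Rle_dec (c k) 0) as [Hck|Hck].
    - unfold z in Huz. rewrite dot_lsum in Huz.
      assert (H := Hneg (fun i => Rmax 0 (c i)) (fun i => Rmax_l _ _) (Rmax_left _ _ Hck)). simpl in H. lra.
    - rewrite Hz2, dot_lsum in Huz.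
      assert (H := Hneg (fun i => Rmax 0 (- c i)) (fun i => Rmax_l _ _)). simpl in H.
      rewrite Rmax_left in H by lra. specialize (H eq_refl). lra. }
  exists (F1 ++ F2). split; [apply incl_app; auto|]. split; [rewrite length_app; lia|].
  intros v Hv. destruct (classic (exists u, In u F1 /\ 0 < dot u v)) as [(u & Hu & Huv)|Hno].
  - exists u. rewrite in_app_iff; auto.
  - destruct (Hh2 v) as (u & Hu & Huv).
    + split; auto. intros u Hu. apply Rnot_lt_le. intros Hlt. apply Hno. exists u; auto.
    + exists u. rewrite in_app_iff; auto.
Qed.

Lemma touching_normals {d} (K : rset d) : convex_body K ->
  exists l, (forall u, In u l -> touching_normal K u) /\ (length l <= 2 * d)%nat /\ hits_all (fun u => In u l).
Proof.
  intros HK. destruct (hits_all_finite (touching_normal K)) as (F & HF1 & HF2).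
  - intros u [Hu _]; auto.
  - intros v Hv. destruct (touching_normal_exists K (fun j => -1 * v j) HK) as (u & Hu & Huv).
    + rewrite enorm_scal, Rabs_left by lra. lra.
    + exists u. split; auto. rewrite dot_scal in Huv. lra.
  - destruct (steinitz F HF2) as (l & H1 & H2 & H3). exists l. split; auto.
Qed.

(** * Covering by rapidly growing homothets *)

Lemma hom_ball {d} (K : rset d) q rho x lam p : 0 < lam -> (forall y, edist y q <= rho -> K y) ->
  enorm (fun j => p j - x j - lam * q j) <= lam * rho -> hom x lam K p.
Proof.
  intros Hl HK H. exists (fun j => / lam * (p j - x j)). split; [|intros j; field; lra].
  apply HK. unfold edist. rewrite (enorm_ext _ (fun j => / lam * (p j - x j - lam * q j))) by (intros; field; lra).
  assert (0 < / lam) by (apply Rinv_0_lt_compat; auto).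
  rewrite enorm_scal, Rabs_right by lra. apply (Rmult_le_reg_l lam); auto.
  rewrite <- Rmult_assoc, Rinv_r by lra. lra.
Qed.

(* Seen from the touching point, a large homothet looks like a half-space. *)
Lemma halfspace_body {d} (K : rset d) u h T : touching_normal K u -> 0 < h ->
  exists L, forall lam, L <= lam -> 0 < lam -> exists x,
    (forall p, hom x lam K p -> h <= dot u p) /\
    (forall p, 2 * h <= dot u p -> enorm p <= T -> hom x lam K p).
Proof.
  intros (Hu & q & rho & Hrho & Hball & Hsup) Hh.
  (* At distance T a sphere of radius lam rho departs from its tangent plane by about T^2 / (2 lam
     rho); this bound keeps that within [h], the gap between the two half-spaces. *)
  exists (T * T / (2 * h) / rho). intros lam HL Hlam.
  (* The scaled inner ball gets its centre at (h + lam rho) u, so it touches the hyperplane u . p =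
     h from above. *)
  exists (fun j => (h + lam * rho) * u j + (- lam) * q j). split.
  - intros p (y & Hy & E). specialize (Hsup y Hy).
    replace p with (fun j => 1 * ((h + lam * rho) * u j + - lam * q j) + lam * y j)
      by (apply functional_extensionality; intros; rewrite E; ring).
    rewrite dot_lin, dot_lin, <- enorm_sq, Hu. nra.
  - intros p Hp HT. apply (hom_ball K q rho); auto.
    assert (Hlr : 0 < lam * rho) by (apply Rmult_lt_0_compat; auto).
    apply enorm_le_sq; [lra|].
    replace (fun j => p j - ((h + lam * rho) * u j + - lam * q j) - lam * q j)
      with (fun j => 1 * p j + (- (h + lam * rho)) * u j) by (apply functional_extensionality; intros; ring).
    rewrite dot_comb_self, <- !enorm_sq, Hu, (dot_comm p).
    assert (HT2 : T * T <= 2 * h * (lam * rho)).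
    { replace (T * T) with (2 * h * (T * T / (2 * h) / rho * rho)) by (field; lra).
      apply Rmult_le_compat_l; [lra|]. apply Rmult_le_compat_r; lra. }
    assert (Hp2 : enorm p * enorm p <= T * T) by (assert (H := enorm_nonneg p); apply Rmult_le_compat; auto).
    set (t := dot u p) in *. set (s := lam * rho) in *. nra.
Qed.

Lemma large_index (lam : nat -> R) L N : (forall M, exists i, M < lam i) -> exists i, (N <= i)%nat /\ L <= lam i.
Proof.
  intros H. destruct (list_bound lam (seq 0 N)) as [B HB]. destruct (H (Rmax B L)) as [i Hi].
  exists i. split.
  - apply Nat.nlt_ge. intros Hlt. assert (lam i <= B) by (apply HB, in_seq; lia).
    assert (H0' := Rmax_l B L). lra.
  - assert (H0 := Rmax_r B L). lra.
Qed.

Definition indices {A} (l : list (nat * A)) : list nat := map fst l.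

Lemma in_indices {A} (l : list (nat * A)) i : In i (indices l) <-> exists x, In (i, x) l.
Proof.
  unfold indices. rewrite in_map_iff. split.
  - intros ([i' x] & <- & H). exists x; auto.
  - intros [x H]. exists (i, x); auto.
Qed.

Lemma NoDup_indices_functional {A} (l : list (nat * A)) : NoDup (indices l) -> functional l.
Proof.
  induction l as [|[i x] l IH]; simpl; intros Hn; [intros i x x' []|].
  inversion_clear Hn. intros k y y' [E|Hk] [E'|Hk'].
  - congruence.
  - injection E as <- <-. exfalso. apply H. apply in_indices. exists y'; auto.
  - injection E' as <- <-. exfalso. apply H. apply in_indices. exists y; auto.
  - apply (IH H0 k); auto.
Qed.

Lemma halfspace_bodies {d} (K : rset d) (lam : nat -> R) h T (l : list (pt d)) N :
  (forall u, In u l -> touching_normal K u) -> 0 < h -> (forall i, 0 < lam i) -> (forall M, exists i, M < lam i) ->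
  exists s : list (nat * pt d), length s = length l /\ NoDup (indices s) /\ (forall i, In i (indices s) -> (N <= i)%nat) /\
    (forall u, In u l -> exists i x, In (i, x) s /\
       (forall p, hom x (lam i) K p -> h <= dot u p) /\
       (forall p, 2 * h <= dot u p -> enorm p <= T -> hom x (lam i) K p)) /\
    (forall i x, In (i, x) s -> exists u, In u l /\ forall p, hom x (lam i) K p -> h <= dot u p).
Proof.
  intros Hl Hh Hlam Hunb. revert N. induction l as [|u l IH]; intros N.
  - exists nil. split; auto. split; [constructor|]. split; [intros i []|]. split; [intros u []|intros i x []].
  - destruct (halfspace_body K u h T (Hl u (or_introl eq_refl)) Hh) as [L HL].
    destruct (large_index lam L N Hunb) as (i & Hi & HLi).
    destruct (HL (lam i) HLi (Hlam i)) as (x & Hx1 & Hx2).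
    destruct (IH (fun u' H => Hl u' (or_intror H)) (S i)) as (s & H1 & H2 & H3 & H4 & H5).
    exists ((i, x) :: s). split; [simpl; auto|]. split; [|split; [|split]].
    + simpl. constructor; auto. intros Hin. apply H3 in Hin. lia.
    + intros k [<-|Hk]; [auto|]. apply H3 in Hk. lia.
    + intros u' [<-|Hu'].
      * exists i, x. split; [left|]; auto.
      * destruct (H4 u' Hu') as (k & y & Hk & Hy). exists k, y. split; [right|]; auto.
    + intros k y [E|Hk].
      * injection E as <- <-. exists u. split; [left|]; auto.
      * destruct (H5 k y Hk) as (u' & Hu' & H). exists u'. split; [right|]; auto.
Qed.

Lemma hom_enorm_le {d} (K : rset d) D x lam p : (forall y, K y -> enorm y <= D) -> 0 <= lam ->
  hom x lam K p -> enorm p <= enorm x + lam * D.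
Proof. intros HD Hl Hp. apply (hom_subset_ball K D x lam _ HD Hl (Rle_refl _) p Hp). Qed.

Lemma bodies_bounded {d} (K : rset d) D (lam : nat -> R) (S : list (nat * pt d)) : (forall y, K y -> enorm y <= D) ->
  (forall i, 0 < lam i) -> exists B, forall i x p, In (i, x) S -> hom x (lam i) K p -> enorm p <= B.
Proof.
  intros HD Hlam. destruct (list_bound (fun ix : nat * pt d => enorm (snd ix) + lam (fst ix) * D) S) as [B HB].
  exists B. intros i x p Hi Hp. eapply Rle_trans; [|apply (HB _ Hi)]. simpl.
  apply (hom_enorm_le K); auto. apply Rlt_le, Hlam.
Qed.

Definition stage_multiplicity {d} (K : rset d) (lam : nat -> R) (S : list (nat * pt d)) (m : nat) : Prop :=
  forall p (J : list nat), NoDup J -> (forall i, In i J -> exists x, In (i, x) S /\ hom x (lam i) K p) -> (length J <= m)%nat.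

Lemma stage_multiplicity_length {d} (K : rset d) lam S : stage_multiplicity K lam S (length S).
Proof.
  intros p J HJ H. rewrite <- (length_map fst S). apply NoDup_incl_length; auto.
  intros i Hi. destruct (H i Hi) as (x & Hx & _). apply in_indices. exists x; auto.
Qed.

(** This makes room for an extra body: 2d half-space bodies without common point stay at
    multiplicity at most 2d after one more is added. *)
Lemma stage_multiplicity_miss {d} (K : rset d) lam S m : NoDup (indices S) -> (length S <= Datatypes.S m)%nat ->
  (forall p, exists i x, In (i, x) S /\ ~ hom x (lam i) K p) -> stage_multiplicity K lam S m.
Proof.
  intros Hn HS Hmiss p J HJ H. destruct (Hmiss p) as (i & x & Hi & Hp).
  assert (length (i :: J) <= length (indices S))%nat.
  { apply NoDup_incl_length.
    - constructor; auto. intros HiJ. destruct (H i HiJ) as (y & Hy & Hyp).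
      rewrite (NoDup_indices_functional S Hn i x y Hi Hy) in Hp. auto.
    - intros k [<-|Hk]; apply in_indices; [exists x; auto|]. destruct (H k Hk) as (y & Hy & _). exists y; auto. }
  unfold indices in H0. rewrite length_map in H0. simpl in H0. lia.
Qed.

(* Stage [n] places 2d half-space like bodies outside the ball of radius [a] (a single body
   covering a ball when [n = 0]), and the [n]-th body if it has not been used; [P] lists the
   bodies placed before. *)
Definition stage_ok {d} (K : rset d) (lam : nat -> R) (l : list (pt d)) rho0 n (P : list (nat * pt d)) a b
    (S : list (nat * pt d)) c : Prop :=
  b + 1 <= c /\ NoDup (indices S) /\ (forall i, In i (indices S) -> ~ In i (indices P)) /\
  (forall i x p, In (i, x) S -> hom x (lam i) K p -> a <= enorm p < c) /\
  (forall p, enorm p <= 2 * rho0 * b -> n = O \/ (exists u, In u l /\ 2 * a <= dot u p) ->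
     exists i x, In (i, x) S /\ hom x (lam i) K p) /\
  stage_multiplicity K lam S (2 * d) /\
  (In n (indices P) \/ In n (indices S)).

Lemma stage_exists {d} (K : rset d) (lam : nat -> R) (l : list (pt d)) rho0 n P a b :
  (1 <= d)%nat -> convex_body K -> (forall i, 0 < lam i) -> (forall M, exists i, M < lam i) ->
  (forall u, In u l -> touching_normal K u) -> (length l <= 2 * d)%nat -> hits_all (fun u => In u l) ->
  (n = O /\ a = 0) \/ (n <> O /\ 0 < a) -> exists S c, stage_ok K lam l rho0 n P a b S c.
Proof.
  intros Hd HK Hlam Hunb Hl Hlen Hhit Ha. destruct HK as (Hconv & _ & [D HD] & Hint).
  destruct (unit_vector d Hd) as [e He].
  (* [N] lies beyond [n] too, so the large bodies do not consume body [n], which is placed in this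
     same stage if still free. *)
  destruct (list_max_bound (n :: indices P)) as [N HN].
  assert (Hmain : exists s : list (nat * pt d), NoDup (indices s) /\ (forall i, In i (indices s) -> (N <= i)%nat) /\
     (forall i x p, In (i, x) s -> hom x (lam i) K p -> a <= enorm p) /\
     (forall p, enorm p <= 2 * rho0 * b -> n = O \/ (exists u, In u l /\ 2 * a <= dot u p) ->
        exists i x, In (i, x) s /\ hom x (lam i) K p) /\
     ((length s <= 1)%nat \/ ((length s <= 2 * d)%nat /\ forall p, exists i x, In (i, x) s /\ ~ hom x (lam i) K p))).
  { destruct Ha as [[Hn Ha]|[Hn Ha]].
    - destruct Hint as (q & e0 & He0 & Hball).
      destruct (large_index lam (2 * rho0 * b / (e0 / 2)) N Hunb) as (i & Hi & HL).
      exists ((i, fun j => - lam i * q j) :: nil). split; [simpl; constructor; [auto|constructor]|].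
      split; [intros k [<-|[]]; auto|]. split; [|split].
      + intros k x p _ _. rewrite Ha. apply enorm_nonneg.
      + intros p Hp _. exists i, (fun j => - lam i * q j). split; [left; auto|].
        apply (hom_ball K q (e0 / 2)); auto.
        * intros y Hy. apply Hball. lra.
        * rewrite (enorm_ext _ p) by (intros; ring). eapply Rle_trans; [apply Hp|].
          replace (2 * rho0 * b) with (2 * rho0 * b / (e0 / 2) * (e0 / 2)) by (field; lra).
          apply Rmult_le_compat_r; lra.
      + left. simpl. lia.
    - destruct (halfspace_bodies K lam a (2 * rho0 * b) l N Hl Ha Hlam Hunb) as (s & H1 & H2 & H3 & H4 & H5).
      exists s. split; auto. split; auto. split; [|split].
      + intros i x p Hi Hp. destruct (H5 i x Hi) as (u & Hu & Hup). specialize (Hup p Hp).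
        assert (C := dot_cs u p). destruct (Hl u Hu) as [Hu1 _]. rewrite Hu1 in C. lra.
      + intros p Hp [H|(u & Hu & Hup)]; [tauto|]. destruct (H4 u Hu) as (i & x & Hi & _ & Hx). exists i, x; auto.
      (* No point is in all the bodies: some normal has u . p <= 0, while its body satisfies u . p
         >= a > 0. For p = 0 any normal serves, and one exists since [l] hits [e]. *)
      + right. split; [lia|]. intros p.
        assert (Hu : exists u, In u l /\ dot u p <= 0).
        { destruct (enorm_nonneg p) as [Hp|Hp].
          - destruct (Hhit (fun j => -1 * p j)) as (u & Hu & Hup).
            + rewrite enorm_scal, Rabs_left by lra. lra.
            + exists u. split; auto. rewrite dot_scal in Hup. lra.
          - destruct (Hhit e) as (u & Hu & _); [lra|]. exists u. split; auto.
            assert (C := dot_cs u p). rewrite <- Hp in C. lra. }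
        destruct Hu as (u & Hu & Hup). destruct (H4 u Hu) as (i & x & Hi & Hx & _).
        exists i, x. split; auto. intros Hxp. specialize (Hx p Hxp). lra. }
  destruct Hmain as (s & Hs1 & Hs2 & Hs3 & Hs4 & Hs5).
  assert (HnN : (n < N)%nat) by (apply HN; left; auto).
  assert (Hns : ~ In n (indices s)) by (intros H; apply Hs2 in H; lia).
  assert (HsP : forall i, In i (indices s) -> ~ In i (indices P)).
  { intros i Hi HiP. apply Hs2 in Hi. assert (i < N)%nat by (apply HN; right; auto). lia. }
  assert (Hwrap : forall S, NoDup (indices S) -> (forall i, In i (indices S) -> ~ In i (indices P)) ->
     (forall i x p, In (i, x) S -> hom x (lam i) K p -> a <= enorm p) -> incl s S -> (length S <= Datatypes.S (length s))%nat ->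
     (In n (indices P) \/ In n (indices S)) -> exists S' c, stage_ok K lam l rho0 n P a b S' c).
  { intros S H1 H2 H3 H4 H5 H6. destruct (bodies_bounded K D lam S HD Hlam) as [B HB].
    exists S, (Rmax (b + 1) (B + 1)). split; [apply Rmax_l|]. split; auto. split; auto.
    split; [|split; [|split]]; auto.
    - intros i x p Hi Hp. split; [eauto|]. specialize (HB i x p Hi Hp). assert (HR := Rmax_r (b + 1) (B + 1)). lra.
    - intros p Hp Hor. destruct (Hs4 p Hp Hor) as (i & x & Hi & Hx). exists i, x. split; auto.
    - destruct Hs5 as [Hs5|[Hs5 Hmiss]].
      + intros p J HJ HJp. assert (HL := stage_multiplicity_length K lam S p J HJ HJp). lia.
      + apply stage_multiplicity_miss; auto; [lia|]. intros p. destruct (Hmiss p) as (i & x & Hi & Hx). exists i, x; auto. }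
  destruct (classic (In n (indices P))) as [HnP|HnP].
  - apply (Hwrap s); auto. apply incl_refl.
  - assert (HD0 : 0 <= Rabs D) by apply Rabs_pos.
    assert (Ha0 : 0 <= a) by (destruct Ha; lra).
    (* Far enough along [e] for the whole body to stay outside the open ball of radius [a], as every
       member of the stage must. *)
    pose (x := fun j => (a + lam n * Rabs D) * e j).
    assert (Hx : enorm x = a + lam n * Rabs D).
    { unfold x. rewrite enorm_scal, He, Rmult_1_r. apply Rabs_right.
      assert (0 <= lam n * Rabs D) by (apply Rmult_le_pos; auto; apply Rlt_le, Hlam). lra. }
    apply (Hwrap ((n, x) :: s)); auto.
    + simpl. constructor; auto.
    + intros i [<-|Hi]; auto.
    + intros i y p [E|Hi] Hp; [|eauto]. injection E as <- <-.
      destruct Hp as (k & Hk & Ep). specialize (HD k Hk). assert (C := Rle_abs D).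
      assert (H := enorm_sub_le p (fun j => lam n * k j)).
      rewrite (enorm_ext _ x) in H by (intros; rewrite Ep; ring).
      rewrite enorm_scal, Rabs_right in H by (apply Rle_ge, Rlt_le, Hlam).
      assert (lam n * enorm k <= lam n * Rabs D) by (apply Rmult_le_compat_l; [apply Rlt_le, Hlam|lra]). lra.
    + apply incl_tl, incl_refl.
    + right; left; auto.
Qed.

Lemma length_cfilter_split {A} (P : A -> Prop) l : (length (cfilter P l) + length (cfilter (fun a => ~ P a) l) = length l)%nat.
Proof.
  induction l as [|a l IH]; simpl; auto.
  destruct (excluded_middle_informative (P a)), (excluded_middle_informative (~ P a)); try tauto; simpl; lia.
Qed.

(** There are radii H 0 < H 1 < ... such that stage n stays in H n <= |p| < H (n + 2) and covers all
    p with 2 rho0 H n < |p| <= 2 rho0 H (n + 1). The first fact bounds the multiplicity by 2d + 2d,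
    the second gives the covering. *)
Lemma cover_unbounded {d} (K : rset d) (lam : nat -> R) :
  (1 <= d)%nat -> convex_body K -> (forall i, 0 < lam i) -> (forall M, exists i, M < lam i) ->
  exists x : nat -> pt d, covers (fun i => hom (x i) (lam i) K) /\ multiplicity_le (fun i => hom (x i) (lam i) K) (4 * d).
Proof.
  intros Hd HK Hlam Hunb. destruct (touching_normals K HK) as (l & Hl & Hlen & Hhit).
  destruct (hits_all_uniform (fun u => In u l)) as (eps & Heps & Hunif); auto.
  { intros u Hu. destruct (Hl u Hu); auto. }
  (* Every nonzero p has a normal u with |p| <= rho0 (u . p); so beyond radius 2 rho0 a some
     half-space at height 2a contains p. *)
  pose (rho0 := / eps). assert (Hrho0 : 0 < rho0) by (apply Rinv_0_lt_compat; auto).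
  assert (Hrho : forall p : pt d, 0 < enorm p -> exists u, In u l /\ enorm p <= rho0 * dot u p).
  { intros p Hp. assert (Hinv : 0 < / enorm p) by (apply Rinv_0_lt_compat; auto).
    destruct (Hunif (fun j => / enorm p * p j)) as (u & Hu & Hup).
    - rewrite enorm_scal, Rabs_right by lra. field; lra.
    - exists u. split; auto. rewrite dot_scal in Hup. apply (Rmult_le_compat_l (enorm p * rho0)) in Hup.
      + replace (enorm p * rho0 * eps) with (enorm p) in Hup by (unfold rho0; field; lra).
        replace (enorm p * rho0 * (/ enorm p * dot u p)) with (rho0 * dot u p) in Hup by (field; lra). auto.
      + apply Rmult_le_pos; lra. }
  assert (Hstep : forall n (st : list (nat * pt d) * (R * R)), exists Sc : list (nat * pt d) * R,
     (n = O /\ fst (snd st) = 0) \/ (n <> O /\ 0 < fst (snd st)) ->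
     stage_ok K lam l rho0 n (fst st) (fst (snd st)) (snd (snd st)) (fst Sc) (snd Sc)).
  { intros n [P [a b]]. simpl. destruct (classic ((n = O /\ a = 0) \/ (n <> O /\ 0 < a))) as [H|H]; [|exists (nil, 0); tauto].
    destruct (stage_exists K lam l rho0 n P a b Hd HK Hlam Hunb Hl Hlen Hhit H) as (S & c & HS). exists (S, c); auto. }
  destruct (choice2 _ Hstep) as [F HF].
  (* Besides the bodies placed so far, the state carries two consecutive radii: stage n must avoid
     the first and reach past the second, and its own extent determines the third. *)
  pose (st := fix st n := match n with
     | O => (nil, (0, 1))
     | Datatypes.S m => (fst (F m (st m)) ++ fst (st m), (snd (snd (st m)), snd (F m (st m)))) end).
  pose (P := fun n => fst (st n)). pose (H := fun n => fst (snd (st n))). pose (S := fun n => fst (F n (st n))).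
  assert (Hok : forall n, stage_ok K lam l rho0 n (P n) (H n) (H (Datatypes.S n)) (S n) (H (Datatypes.S (Datatypes.S n))) /\ 0 < H (Datatypes.S n)).
  { induction n as [|n [IH1 IH2]].
    - split; [|unfold H; simpl; lra]. apply (HF O). left; auto.
    - assert (Hs : 0 < H (Datatypes.S (Datatypes.S n))) by (destruct IH1 as [A _]; lra).
      split; auto. apply (HF (Datatypes.S n)). right. split; [lia|]. apply IH2. }
  assert (HP : forall n, P (Datatypes.S n) = S n ++ P n) by reflexivity.
  assert (HP0 : P O = nil) by reflexivity. assert (HH0 : H O = 0) by reflexivity. assert (HH1 : H 1%nat = 1) by reflexivity.
  clearbody P H S. clear st F HF Hstep.
  assert (Hmono : forall n, H n + 1 <= H (Datatypes.S n)).
  { intros [|n]; [lra|]. destruct (Hok n) as [[A _] _]. lra. }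
  assert (Hmono2 : forall n m, (n <= m)%nat -> H n <= H m).
  { intros n m L. induction L; [lra|]. specialize (Hmono m). lra. }
  assert (HHn : forall n, INR n <= H n).
  { induction n; [simpl; lra|]. rewrite S_INR. specialize (Hmono n). lra. }
  assert (HPS : forall n i x, In (i, x) (P n) <-> exists m, (m < n)%nat /\ In (i, x) (S m)).
  { induction n; intros i x.
    - rewrite HP0. split; [intros []|intros (m & Hm & _); lia].
    - rewrite HP, in_app_iff, IHn. split.
      + intros [A|(m & Hm & A)]; [exists n; auto|exists m; auto].
      + intros (m & Hm & A). destruct (Nat.eq_dec m n) as [->|]; [left; auto|right; exists m; split; auto; lia]. }
  assert (Hstage : forall n m i x y, In (i, x) (S n) -> In (i, y) (S m) -> n = m /\ x = y).
  { assert (W : forall n m i x y, In (i, x) (S n) -> In (i, y) (S m) -> ~ (n < m)%nat).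
    { intros n m i x y Hx Hy Hlt. destruct (Hok m) as [(_ & _ & A & _) _]. apply (A i).
      - apply in_indices. exists y; auto.
      - apply in_indices. exists x. apply HPS. exists n; auto. }
    intros n m i x y Hx Hy. assert (n = m).
    { assert (A := W n m i x y Hx Hy). assert (B := W m n i y x Hy Hx). lia. }
    subst m. split; auto. destruct (Hok n) as [(_ & A & _) _]. apply (NoDup_indices_functional _ A i); auto. }
  assert (Hall : forall i, exists x, exists n, In (i, x) (S n)).
  { intros i. destruct (Hok i) as [(_ & _ & _ & _ & _ & _ & A) _]. destruct A as [A|A]; apply in_indices in A; destruct A as [x A].
    - apply HPS in A. destruct A as (m & _ & A). exists x, m; auto.
    - exists x, i; auto. }
  destruct (choice _ Hall) as [x Hx].
  exists x. split.
  - intros p.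
    destruct (nat_least (fun n => enorm p <= 2 * rho0 * H (Datatypes.S n))) as (n & Hn & Hmin).
    { destruct (INR_archimed (2 * rho0) (enorm p)) as [n Hn]; [lra|]. exists n.
      specialize (HHn (Datatypes.S n)). rewrite S_INR in HHn.
      apply Rle_trans with (2 * rho0 * INR n); [lra|]. apply Rmult_le_compat_l; lra. }
    destruct (Hok n) as [(_ & _ & _ & _ & A & _) _].
    destruct (A p Hn) as (i & y & Hi & Hy).
    + destruct n as [|n]; [left; auto|right].
      assert (Hlt : 2 * rho0 * H (Datatypes.S n) < enorm p).
      { apply Rnot_le_lt. intros Hle. specialize (Hmin n Hle). lia. }
      assert (Hpos := HHn (Datatypes.S n)). assert (Hpos' := pos_INR (Datatypes.S n)).
      assert (0 <= 2 * rho0 * H (Datatypes.S n)) by (apply Rmult_le_pos; lra).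
      destruct (Hrho p) as (u & Hu & Hup); [lra|]. exists u. split; auto.
      apply (Rmult_le_reg_l rho0); auto. lra.
    + exists i. destruct (Hx i) as [m Hm]. destruct (Hstage _ _ _ _ _ Hi Hm) as [_ <-]. auto.
  - intros p J HJ HJp.
    assert (Hwin : forall n i y, In (i, y) (S n) -> hom y (lam i) K p -> H n <= enorm p < H (Datatypes.S (Datatypes.S n))).
    { intros n i y Hi Hy. destruct (Hok n) as [(_ & _ & _ & A & _) _]. eauto. }
    destruct J as [|i0 J0]; [simpl; lia|]. set (J := i0 :: J0) in *.
    (* [n] is the first stage having a body in the list. Since |p| < H (n + 2), no body of a stage
       from n + 2 on contains p. *)
    destruct (nat_least (fun n => exists i, In i J /\ In (i, x i) (S n))) as (n & (i' & Hi' & Hin') & Hmin).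
    { destruct (Hx i0) as [n Hn]. exists n, i0. split; [left|]; auto. }
    assert (Hmult : forall m (J' : list nat), NoDup J' -> (forall i, In i J' -> In i J /\ In (i, x i) (S m)) -> (length J' <= 2 * d)%nat).
    { intros m J' HJ' HJ2. destruct (Hok m) as [(_ & _ & _ & _ & _ & A & _) _]. apply (A p J' HJ').
      intros i Hi. destruct (HJ2 i Hi) as [H1 H2]. exists (x i). split; auto. }
    rewrite <- (length_cfilter_split (fun i => In (i, x i) (S n)) J).
    assert (length (cfilter (fun i => In (i, x i) (S n)) J) <= 2 * d)%nat.
    { apply (Hmult n); [apply NoDup_cfilter; auto|]. intros i Hi. apply in_cfilter in Hi. auto. }
    assert (length (cfilter (fun i => ~ In (i, x i) (S n)) J) <= 2 * d)%nat; [|lia].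
    apply (Hmult (Datatypes.S n)); [apply NoDup_cfilter; auto|]. intros i Hi. apply in_cfilter in Hi.
    destruct Hi as [Hi Hni]. split; auto. destruct (Hx i) as [m Hm].
    assert (Hnm : (n <= m)%nat) by (apply Hmin; exists i; auto).
    assert (Hm1 : m <> n) by (intros ->; auto).
    destruct (Nat.eq_dec m (Datatypes.S n)) as [<-|Hne]; auto. exfalso.
    assert (L := Hmono2 (Datatypes.S (Datatypes.S n)) m ltac:(lia)).
    assert (W1 := Hwin m i (x i) Hm (HJp i Hi)). assert (W2 := Hwin n i' (x i') Hin' (HJp i' Hi')). lra.
Qed.

Theorem theorem1p1 (d : nat) (K : rset d) (lam : nat -> R) :
  (1 <= d)%nat ->
  convex_body K ->
  (forall i, 0 < lam i) ->
  cv_infty (fun n => sum_f_R0 (fun i => lam i ^ d) n) ->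
  (* (a) *)
  ((exists M, forall i, lam i <= M) ->
   (exists L, L <> 0 /\ cluster_point lam L) ->
   exists th, is_transl_cov_density K th /\
     exists x : nat -> pt d,
       covers (fun i => hom (x i) (lam i) K) /\
       density_is (fun i => hom (x i) (lam i) K) th) /\
  (* (b) *)
  ((exists M, forall i, lam i <= M) ->
   (forall L, cluster_point lam L -> L = 0) ->
   exists x : nat -> pt d,
     covers (fun i => hom (x i) (lam i) K) /\
     density_is (fun i => hom (x i) (lam i) K) 1) /\
  (* (c) *)
  ((forall M, exists i, M < lam i) ->
   exists x : nat -> pt d,
     covers (fun i => hom (x i) (lam i) K) /\
     multiplicity_le (fun i => hom (x i) (lam i) K) (4 * d)).
Proof.
  intros Hd HK Hlam Hdiv. split; [|split].
  - intros [M HM] (L & HL & Hcl). apply (cover_nonzero_cluster K lam M L); auto.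
  - intros [M HM] Hcl. apply (cover_vanishing K lam M); auto.
  - intros Hunb. apply cover_unbounded; auto.
Qed.
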